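(* Let $(M,\omega)$ be a closed Kähler manifold of complex dimension $n$, and let $\mathcal C$ carry the Calabi metric. (1) The Dirichlet problem for the geodesic equation has a unique (modulo parametrization) real analytic solution for any boundary data $u_0\neq u_1$ in $\mathcal C$. With the normalization $\mathrm{Vol}=\frac14$, let $t_0\in(0,\frac\pi2)$ be the unique solution of $\int_Me^{\frac{u_0+u_1}2}\frac{\omega^n}{n!}=\frac14\cos(t_0)$; then the explicit expression of the solution with $u(0)=u_0$, $u(t_0)=u_1$ is $$e^{\frac{u(t)}2}=e^{\frac{u_0}2}\Big(\cos(t)+e^{\frac{u_1-u_0}2}\frac{\sin(t)}{\sin(t_0)}-\cos(t_0)\frac{\sin(t)}{\sin(t_0)}\Big).$$ (2) The space $\mathcal C$ is a metric space with real analytic distance function, the distance $d(u_0,u_1)$ being the length of the geodesic joining $u_0$ and $u_1$. (3) Geodesics are minima of the length functional (over all $C^1$ paths with the same endpoints). (4) Writing the constant sectional curvature of $\mathcal C$ as $s=\frac1{R^2}$ with $R>0$, the diameter $\sup_{u_0,u_1\in\mathcal C}d(u_0,u_1)$ of the space is $\frac\pi2R$.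
   Context: Let $(M,\omega)$ be a closed Kähler manifold of complex dimension $n$, $\mathrm{Vol}=\int_M\frac{\omega^n}{n!}$, and $\mathcal C=\{u\in C^\infty(M,\mathbb R): \int_M e^u\frac{\omega^n}{n!}=\int_M\frac{\omega^n}{n!}\}$ (the space of Kähler metrics, parametrized by volume conformal factors). A smooth curve in $\mathcal C$ is a map $u=u(t)$ from an interval to $\mathcal C$ such that $(t,p)\mapsto u(t)(p)$ is smooth. The tangent space is $T_u\mathcal C=\{v\in C^\infty(M,\mathbb R):\int_M v e^u\frac{\omega^n}{n!}=0\}$. The Calabi metric is $\langle v,w\rangle_u=\int_M vw\,e^u\frac{\omega^n}{n!}$ for $v,w\in T_u\mathcal C$. Its Levi Civita covariant derivative of a smooth section $v$ along $u$ (a smooth $v(t,p)$ with $v(t,\cdot)\in T_{u(t)}\mathcal C$) is $D_tv=v'+\frac12vu'+\frac1{2\mathrm{Vol}}\int_Mvu'e^u\frac{\omega^n}{n!}$, where $'=\partial/\partial t$; a geodesic is a smooth curve with $D_tu'=0$. The Dirichlet problem asks for a geodesic with prescribed endpoints $u_0,u_1$. The length of a path $u:[a,b]\to\mathcal C$ is $\int_a^b\sqrt{\langle u',u'\rangle_u}\,dt$. The sectional curvature of the Calabi metric is constant, equal to $\frac1{4\mathrm{Vol}}$.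
   Formalization: Real analyticity of the distance function is asserted only for pairs u_0≠u_1 (on the diagonal it fails, since d(u(0),u(t))=|t| along a unit-speed geodesic), and the complex dimension n is assumed at least 1 (for a point, the diameter claim is false). *)

(* Defs.v *)
From HB Require Import structures.
From mathcomp Require Import all_boot all_order all_algebra perm.
From mathcomp Require Import all_classical all_reals all_analysis.

Set Implicit Arguments.
Unset Strict Implicit.
Unset Printing Implicit Defensive.

Import Order.TTheory GRing.Theory Num.Theory.
Import numFieldNormedType.Exports.

Local Open Scope classical_set_scope.
Local Open Scope ring_scope.

Section Smooth.
Context {R : realType} {V W : normedModType R}.

Definition iter_derive (s : seq V) (f : V -> W) : V -> W :=
  foldr (fun v g => 'D_v g) f s.

(* C^oo on an open subset of a finite-dimensional space: all iterated
   directional derivatives exist and are themselves (Frechet) differentiable. *)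
Definition smooth_on (U : set V) (f : V -> W) : Prop :=
  forall s x, U x -> differentiable (iter_derive s f) x.

(* C^oo on an arbitrary subset: local extendability to smooth functions on
   open sets.  It is needed for curves defined on closed intervals. *)
Definition smooth_within (S : set V) (f : V -> W) : Prop :=
  forall x, S x -> exists U g,
    [/\ open U, U x, smooth_on U g & forall y, U y -> S y -> g y = f y].

End Smooth.

Section Euclidean.
Context {R : realType}.

(* Integral over R^n (Lebesgue measure), as an iterated integral; used for
   nonnegative Borel functions only. *)
Fixpoint coord_integral (n : nat) : ('rV[R]_n -> \bar R) -> \bar R :=
  match n with
  | 0 => fun f => f 0
  | n'.+1 => fun f =>
      (\int[@lebesgue_measure R]_(t in setT)
         coord_integral (fun z : 'rV[R]_n' => f (row_mx (t%:M : 'rV[R]_1) z)))%E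
  end.

(* C^n is R^(n + n), with x + iy encoded as row_mx x y; Jmap is the
   multiplication by i. *)
Definition Jmap (n : nat) (v : 'rV[R]_(n + n)) : 'rV[R]_(n + n) :=
  row_mx (- rsubmx v) (lsubmx v).

Definition holomorphic_on (n : nat) (U : set 'rV[R]_(n + n))
    (f : 'rV[R]_(n + n) -> 'rV[R]_(n + n)) : Prop :=
  smooth_on U f /\ forall x v, U x -> 'D_(Jmap v) f x = Jmap ('D_v f x).

(* The real basis d/dx_k = basis_vec (k, false), d/dy_k = basis_vec (k, true). *)
Definition basis_vec (n : nat) (i : 'I_n * bool) : 'rV[R]_(n + n) :=
  delta_mx 0 (if i.2 then rshift n i.1 else lshift n i.1).

(* (w ^ ... ^ w) / n! evaluated on (d/dx_1, d/dy_1, ..., d/dx_n, d/dy_n), i.e.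
   the density of w^n/n! with respect to dx_1 dy_1 ... dx_n dy_n. *)
Definition top_power (n : nat) (w : 'rV[R]_(n + n) -> 'rV[R]_(n + n) -> R) : R :=
  ((2 ^ n * n`!)%:R)^-1 *
  \sum_(s : {perm ('I_n * bool)})
     (-1) ^+ s * \prod_(k < n) w (basis_vec (s (k, false)))
                                 (basis_vec (s (k, true))).

Definition derive_within (I : set R) (f : R -> R) (t : R) : R :=
  lim ((s - t)^-1 * (f s - f t) @[s --> within I t^']).

End Euclidean.

Section Manifold.
Context {R : realType} (n : nat) (M : ptopologicalType).

Record chart := Chart {
  dom : set M ;
  coord : M -> 'rV[R]_(n + n) ;
  param : 'rV[R]_(n + n) -> M }.

Definition codom_of (c : chart) : set 'rV[R]_(n + n) := coord c @` dom c.

Definition is_chart (c : chart) : Prop :=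
  [/\ open (dom c), open (codom_of c), {within dom c, continuous (coord c)},
      {within codom_of c, continuous (param c)} &
      forall p, dom c p -> param c (coord c p) = p].

Definition transition (c d : chart) := coord d \o param c.

Definition overlap (c d : chart) : set 'rV[R]_(n + n) :=
  coord c @` (dom c `&` dom d).

(* M is nonempty, its designated point being otherwise irrelevant. *)
Record closed_kahler := ClosedKahler {
  manifold_hausdorff : hausdorff_space M ;
  manifold_second_countable : @second_countable M ;
  manifold_compact : compact [set: M] ;
  atlas : set chart ;
  atlas_chart : forall c, atlas c -> is_chart c ;
  atlas_cover : forall p, exists2 c, atlas c & dom c p ;
  atlas_holomorphic : forall c d, atlas c -> atlas d ->
    holomorphic_on (overlap c d) (transition c d) ;
  (* kform c x v w is the value at the point of coordinates x of the Kahler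
     form, read in the chart c, on the tangent vectors v and w. *)
  kform : chart -> 'rV[R]_(n + n) -> 'rV[R]_(n + n) -> 'rV[R]_(n + n) -> R ;
  kform_linear : forall c x a v v' w, atlas c -> codom_of c x ->
    kform c x (a *: v + v') w = a * kform c x v w + kform c x v' w ;
  kform_alternating : forall c x v w, atlas c -> codom_of c x ->
    kform c x w v = - kform c x v w ;
  kform_smooth : forall c v w, atlas c ->
    smooth_on (codom_of c) (fun x => kform c x v w) ;
  kform_pullback : forall c d x v w, atlas c -> atlas d -> overlap c d x ->
    kform c x v w =
    kform d (transition c d x) ('D_v (transition c d) x) ('D_w (transition c d) x) ;
  kform_J : forall c x v w, atlas c -> codom_of c x ->
    kform c x (Jmap v) (Jmap w) = kform c x v w ;
  kform_positive : forall c x v, atlas c -> codom_of c x -> v != 0 ->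
    0 < kform c x v (Jmap v) ;
  kform_closed : forall c x u v w, atlas c -> codom_of c x ->
    'D_u (fun y => kform c y v w) x + 'D_v (fun y => kform c y w u) x
    + 'D_w (fun y => kform c y u v) x = 0 }.

Variable X : closed_kahler.

(* The Borel measure on M given by the volume form w^n/n!. *)
Definition is_kahler_volume
    (mu : {measure set (g_sigma_algebraType (@open M)) -> \bar R}) : Prop :=
  forall c (A : set (g_sigma_algebraType (@open M))),
    atlas X c -> measurable A -> A `<=` dom c ->
    mu A = coord_integral
      (fun x => (\1_(coord c @` A) x * top_power (kform X c x))%:E).

Definition smooth_fun (f : M -> R) : Prop :=
  forall c, atlas X c -> smooth_on (codom_of c) (f \o param c).

(* The C^oo topology on the smooth functions: uniform convergence, on compact
   subsets of charts, of all the iterated derivatives in coordinates. *)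
Definition seminorm_index : Type :=
  (chart * set 'rV[R]_(n + n) * seq 'rV[R]_(n + n))%type.

Definition valid_index (i : seminorm_index) : Prop :=
  [/\ atlas X i.1.1, compact i.1.2 & i.1.2 `<=` codom_of i.1.1].

Definition cinf_seminorm (i : seminorm_index) (f : M -> R) : R :=
  sup [set `|iter_derive i.2 (f \o param i.1.1) x| | x in i.1.2].

Definition cinf_cvg (T : Type) (F : set_system T) (f : T -> M -> R)
    (g : M -> R) : Prop :=
  forall i, valid_index i -> cinf_seminorm i (f x - g) @[x --> F] --> (0 : R).

(* Real analytic curves in C^oo(M): locally, sums of power series with
   coefficients in C^oo(M) converging in the C^oo topology. *)
Definition analytic_curve (I : set R) (u : R -> M -> R) : Prop :=
  forall t, I t -> exists (r : R) (a : nat -> M -> R),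
    [/\ 0 < r, forall k, smooth_fun (a k) &
        forall h, `|h| < r -> I (t + h) ->
          cinf_cvg \oo (fun m => \sum_(k < m) h ^+ k *: a k) (u (t + h))].

(* A cofinal family of continuous seminorms of C^oo(M) x C^oo(M). *)
Definition cinf_seminorm2 : set ((M -> R) * (M -> R) -> R) :=
  [set q | exists (A : R) (m : nat) (i : 'I_m -> seminorm_index),
     [/\ 0 <= A, forall j, valid_index (i j) &
         q = fun h => A * \sum_j (cinf_seminorm (i j) h.1
                                  + cinf_seminorm (i j) h.2)]].

Definition smooth_pair : set ((M -> R) * (M -> R)) :=
  [set h | smooth_fun h.1 /\ smooth_fun h.2].

End Manifold.

(* Real analyticity, relative to S, of a function f on a locally convex space L
   (a linear subspace of E, with topology defined by the directed family Q of
   seminorms): near each point of S, f coincides on S with the sum of a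
   convergent power series, whose k-th term is the restriction to the diagonal
   of a k-linear form, bounded by B * q ^ k. *)
Definition analytic_within (R : realType) (E : lmodType R) (L : set E)
    (Q : set (E -> R)) (S : set E) (f : E -> R) : Prop :=
  forall x, S x -> exists (q : E -> R) (B : R) (P : forall k, ('I_k -> E) -> R),
    [/\ Q q,
        forall k i (h : 'I_k -> E) a y z, (forall j, L (h j)) -> L y -> L z ->
          P k (dfwith h i (a *: y + z)) =
          a * P k (dfwith h i y) + P k (dfwith h i z),
        forall k (h : 'I_k -> E), (forall j, L (h j)) ->
          `|P k h| <= B * \prod_j q (h j) &
        forall h, L h -> q h < 1 -> S (x + h) ->
          series (fun k => P k (fun=> h)) @ \oo --> f (x + h)].

Section Calabi.
Context {R : realType} (n : nat) (M : ptopologicalType)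
  (X : @closed_kahler R n M)
  (mu : {measure set (g_sigma_algebraType (@open M)) -> \bar R}).

Definition vol_integral (f : M -> R) : R := \int[mu]_(p in setT) f p.

Definition Vol : R := vol_integral (fun=> 1).

Definition calabi_space : set (M -> R) :=
  [set u | smooth_fun X u /\ vol_integral (fun p => expR (u p)) = Vol].

Definition calabi_metric (u v w : M -> R) : R :=
  vol_integral (fun p => v p * w p * expR (u p)).

Definition smooth_curve (I : set R) (u : R -> M -> R) : Prop :=
  (forall t, I t -> calabi_space (u t)) /\
  (forall c, atlas X c ->
     smooth_within [set z : R * 'rV[R]_(n + n) | I z.1 /\ codom_of c z.2]
       (fun z => u z.1 (param c z.2))).

(* Time derivative along the interval I (one-sided at its endpoints). *)
Definition velocity (I : set R) (u : R -> M -> R) : R -> M -> R :=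
  fun t p => derive_within I (u ^~ p) t.

(* The Levi-Civita derivative D_t v of the vector field v along the curve u. *)
Definition cov_derive (I : set R) (u v : R -> M -> R) : R -> M -> R :=
  fun t p => velocity I v t p + 2^-1 * (v t p * velocity I u t p)
    + (2 * Vol)^-1 *
      vol_integral (fun q => v t q * velocity I u t q * expR (u t q)).

Definition geodesic (I : set R) (u : R -> M -> R) : Prop :=
  smooth_curve I u /\
  forall t p, I t -> cov_derive I u (velocity I u) t p = 0.

Definition geodesic_joining (a b : R) (u0 u1 : M -> R) (u : R -> M -> R) : Prop :=
  [/\ geodesic `[a, b] u, u a = u0 & u b = u1].

Definition path_length (a b : R) (u : R -> M -> R) : R :=
  \int[@lebesgue_measure R]_(t in `[a, b])
    Num.sqrt (calabi_metric (u t) (velocity `[a, b] u t) (velocity `[a, b] u t)).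

(* C^1 maps from [a, b] to calabi_space, for the C^oo topology. *)
Definition C1_path (a b : R) (u : R -> M -> R) : Prop :=
  (forall t, t \in `[a, b] -> calabi_space (u t)) /\
  exists v : R -> M -> R, forall t, t \in `[a, b] ->
    [/\ smooth_fun X (v t),
        cinf_cvg X (within `[a, b] t^') (fun s => (s - t)^-1 *: (u s - u t)) (v t) &
        cinf_cvg X (within `[a, b] (nbhs t)) v (v t)].

Definition geodesic_lengths (u0 u1 : M -> R) : set R :=
  [set l | exists a b u,
     [/\ a < b, geodesic_joining a b u0 u1 u & l = path_length a b u]].

(* The length of the geodesic joining u0 and u1 (0 if there is none). *)
Definition calabi_dist (u0 u1 : M -> R) : R := xget 0 (geodesic_lengths u0 u1).

(* For all smooth 2-parameter families u(s, t), with X = du/ds, Y = du/dt,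
   <D_s D_t Y - D_t D_s Y, X> = kappa (<X, X><Y, Y> - <X, Y>^2). *)
Definition constant_sectional_curvature (kappa : R) : Prop :=
  forall (O : set (R * R)) (u : R -> R -> M -> R),
    open O ->
    (forall s t, O (s, t) -> calabi_space (u s t)) ->
    (forall c, atlas X c ->
       smooth_within [set z : (R * R) * 'rV[R]_(n + n) | O z.1 /\ codom_of c z.2]
         (fun z => u z.1.1 z.1.2 (param c z.2))) ->
    let us := fun s t => velocity setT (u ^~ t) s in
    let ut := fun s t => velocity setT (u s) t in
    let Ds (v : R -> R -> M -> R) :=
      fun s t => cov_derive setT (u ^~ t) (v ^~ t) s in
    let Dt (v : R -> R -> M -> R) :=
      fun s t => cov_derive setT (u s) (v s) t in
    forall s t, O (s, t) ->
      calabi_metric (u s t) (Ds (Dt ut) s t - Dt (Ds ut) s t) (us s t) =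
      kappa * (calabi_metric (u s t) (us s t) (us s t)
               * calabi_metric (u s t) (ut s t) (ut s t)
               - calabi_metric (u s t) (us s t) (ut s t) ^+ 2).

End Calabi.

(* Main.v *)
(* The map u |-> f = e^(u/2) sends the Calabi space isometrically, up to the
   factor 2, into the sphere of radius sqrt V of L^2(M), where V = Vol.  Along a
   geodesic f'' = - w^2 f with w constant, so that f runs along a great circle;
   since the inner product of two positive functions is positive, endpoints u0
   and u1 are at an angle theta < pi/2, with cos theta = (1/V) int e^((u0+u1)/2),
   and d(u0, u1) = 2 sqrt V theta.  Conversely the great circle arc between two
   positive functions stays positive.  The triangle inequality is that of the
   sphere, and the minimality of geodesics follows from the bound on the
   derivative of acos of the inner product of f(t) with f(a).  Analyticity of an
   arc comes from the Taylor series of 2 ln cos, after writing f as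
   A cos (phase - B); that of d from the power series of acos composed with
   that of cos theta.  Orthonormal functions of mean zero, built from bump
   functions, give a totally geodesic 2-sphere, whose curvature is 1 / (4 V), and
   bump functions with disjoint supports give angles arbitrarily close to pi/2. *)

Require Import Defs.
From HB Require Import structures.
From mathcomp Require Import all_boot all_order all_algebra perm.
From mathcomp Require Import all_classical all_reals all_analysis.
From mathcomp Require Import measurable_realfun ring lra.

Set Implicit Arguments.
Unset Strict Implicit.
Unset Printing Implicit Defensive.

Import Order.TTheory GRing.Theory Num.Theory.
Import numFieldNormedType.Exports.

Local Open Scope classical_set_scope.
Local Open Scope ring_scope.

(** * Smooth functions on open sets *)

Section SmoothCalculus.
Context {R : realType} {V : normedModType R}.
Implicit Types (U : set V).

(** The geodesic equation couples all points of [M] through one integral, the energy. Because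
    velocities have mean zero it is constant in time, and then [f = e^(u/2)] solves one and the same
    linear oscillator equation at every point; uniqueness and the explicit formula come from there.
    Velocities are one-sided at the ends of an interval, so derivatives within the interval are
    used, uniform over [M] by compactness; this uniformity allows differentiation under the
    integral. About [mu] only its densities in charts are known: their positivity, hence that of the
    L^2 product, is linear algebra on alternating sums. Two facts about [acos] shape the estimates.
    Its slope is infinite at 1, where every path starts, so the inner product is multiplied by some
    [k < 1] before [k] tends to 1. Off the diagonal the cosine of the angle is below 1, where [acos]
    has a power series that can be composed with that of the cosine. The constant curvature is a
    hypothesis about [Rad]: one explicit surface forces [Rad ^+ 2 = 4 * Vol mu]. *)

Lemma near_zero_differentiable (W : normedModType R) (f : V -> W) (x : V) :
  (\forall y \near x, f y = 0) -> differentiable f x.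
Proof.
move=> f0.
have fx0 : f x = 0 by exact: (nbhs_singleton f0).
have fo : f \o shift x = cst (f x) + (\0 : {linear V -> W}) +o_ 0 id.
  apply/eqaddoP => e e0; near=> h.
  rewrite !fctE /= fx0 !addr0.
  have -> : f (h + x) = 0.
    by near: h; move: f0; rewrite (near_shift 0 x); apply: filterS => y; rewrite /= subr0.
  by rewrite subr0 normr0 mulr_ge0 // ltW.
have c0 : continuous (\0 : {linear V -> W}) by move=> y; exact: cvg_cst.
apply/diff_locallyP; split; rewrite (diff_unique c0 fo) //.
Unshelve. all: by end_near. Qed.

Lemma near_eq_differentiable (W : normedModType R) (f g : V -> W) (x : V) :
  (\forall y \near x, f y = g y) -> differentiable f x -> differentiable g x.
Proof.
move=> fg df; have -> : g = f + (g - f) by rewrite addrC subrK.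
apply: differentiableD => //; apply: near_zero_differentiable.
by apply: filterS fg => y; rewrite !fctE => ->; rewrite subrr.
Qed.

Lemma iter_derive_rcons (W : normedModType R) s (v : V) (f : V -> W) :
  iter_derive (rcons s v) f = iter_derive s ('D_v f).
Proof. by rewrite /iter_derive foldr_rcons. Qed.

Lemma iter_derive_eq (W : normedModType R) U (f g : V -> W) s : open U ->
  (forall x, U x -> f x = g x) ->
  forall x, U x -> iter_derive s f x = iter_derive s g x.
Proof.
move=> oU fg; elim: s => [//|v s IH] x Ux /=.
by apply: near_eq_derive; apply: filterS (open_nbhs_nbhs (conj oU Ux)) => y; exact: IH.
Qed.

(** [smooth_on] quantifies over all words of directions at once, which leaves nothing to do
    induction on; this filtration by the order supplies it. The count is shifted by one: [Ck 0] is
    plain differentiability. *)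
Definition Ck (W : normedModType R) (k : nat) U (f : V -> W) :=
  forall s, (size s <= k)%N -> forall x, U x -> differentiable (iter_derive s f) x.

Lemma smooth_onP (W : normedModType R) U (f : V -> W) :
  smooth_on U f <-> forall k, Ck k U f.
Proof.
split=> [sf k s _ x Ux|cf s x Ux]; first exact: sf.
exact: (cf (size s)).
Qed.

(** Derivatives are peeled off at the innermost end of the word, hence [rcons]: this exhibits
    ['D_v f] itself as a function of one order less. *)
Lemma CkS (W : normedModType R) k U (f : V -> W) :
  Ck k.+1 U f <->
  (forall x, U x -> differentiable f x) /\ (forall v, Ck k U ('D_v f)).
Proof.
split=> [cf|[df cf] s].
  split=> [x Ux|v s sk x Ux]; first exact: (cf [::]).
  by have := cf (rcons s v); rewrite size_rcons iter_derive_rcons; apply.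
case/lastP: s => [_|s v]; first exact: df.
by rewrite size_rcons iter_derive_rcons; exact: cf.
Qed.

Lemma Ck0 (W : normedModType R) U (f : V -> W) :
  Ck 0 U f <-> (forall x, U x -> differentiable f x).
Proof.
split=> [cf x Ux|df s]; first exact: (cf [::]).
by rewrite leqn0 size_eq0 => /eqP ->.
Qed.

Lemma Ck_le (W : normedModType R) k l U (f : V -> W) :
  (k <= l)%N -> Ck l U f -> Ck k U f.
Proof. by move=> kl cf s sk; apply: cf; exact: leq_trans sk kl. Qed.

Lemma Ck_diff (W : normedModType R) k U (f : V -> W) x :
  Ck k U f -> U x -> differentiable f x.
Proof. by move=> cf; exact: (cf [::]). Qed.

Lemma Ck_eq (W : normedModType R) k U (f g : V -> W) : open U ->
  (forall x, U x -> f x = g x) -> Ck k U f -> Ck k U g.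
Proof.
move=> oU fg cf s sk x Ux; apply: near_eq_differentiable (cf s sk x Ux).
by apply: filterS (open_nbhs_nbhs (conj oU Ux)) => y; exact: iter_derive_eq.
Qed.

Lemma Ck_cst (W : normedModType R) k U (a : W) : Ck k U (cst a).
Proof.
elim: k a => [|k IH] a; first by apply/Ck0 => x _; exact: differentiable_cst.
apply/CkS; split=> [x _|v]; first exact: differentiable_cst.
have -> : 'D_v (cst a : V -> W) = cst 0 by apply/funext => x; rewrite derive_cst.
exact: IH.
Qed.

Lemma CkD (W : normedModType R) k U (f g : V -> W) : open U ->
  Ck k U f -> Ck k U g -> Ck k U (f + g).
Proof.
move=> oU; elim: k f g => [|k IH] f g.
  by move=> /Ck0 cf /Ck0 cg; apply/Ck0 => x Ux; apply: differentiableD; auto.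
move=> /CkS [df cf] /CkS [dg cg]; apply/CkS; split=> [x Ux|v].
  by apply: differentiableD; auto.
apply: Ck_eq (IH _ _ (cf v) (cg v)) => // x Ux.
by rewrite /= deriveD //; apply: diff_derivable; auto.
Qed.

Lemma CkM k U (f g : V -> R) : open U ->
  Ck k U f -> Ck k U g -> Ck k U (f * g).
Proof.
move=> oU; elim: k f g => [|k IH] f g.
  by move=> /Ck0 cf /Ck0 cg; apply/Ck0 => x Ux; apply: differentiableM; auto.
move=> cf0 cg0; move: (cf0) (cg0) => /CkS [df cf] /CkS [dg cg].
apply/CkS; split=> [x Ux|v]; first by apply: differentiableM; auto.
apply: (@Ck_eq _ _ _ (f * 'D_v g + g * 'D_v f)) => //.
  move=> x Ux; rewrite deriveM //; [exact: diff_derivable (df _ Ux) |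
    exact: diff_derivable (dg _ Ux)].
by apply: CkD => //; apply: IH => //; exact: (Ck_le (leqnSn k)).
Qed.

Lemma derive_comp1 (F : R -> R) (F' : R) (g : V -> R) (x v : V) :
  is_derive (g x) 1 F F' -> differentiable g x ->
  differentiable (F \o g) x /\ 'D_v (F \o g) x = F' * 'D_v g x.
Proof.
move=> dF dg; have dF' : differentiable F (g x).
  by apply/derivable1_diffP; exact: ex_derive.
have dFg : differentiable (F \o g) x by exact: differentiable_comp.
split => //; rewrite deriveE // diff_comp //= deriv1E; last exact: ex_derive.
by rewrite derive1E derive_val deriveE //; rewrite /GRing.scale /= mulrC.
Qed.

Lemma Ck_compS k U (F F' : R -> R) (g : V -> R) : open U ->
  (forall x, U x -> is_derive (g x) 1 F (F' (g x))) ->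
  Ck k U (F' \o g) -> Ck k.+1 U g -> Ck k.+1 U (F \o g).
Proof.
move=> oU dF cF' /CkS [dg cg]; apply/CkS; split=> [x Ux|v].
  by case: (derive_comp1 0 (dF _ Ux) (dg _ Ux)).
apply: (@Ck_eq _ _ _ ((F' \o g) * 'D_v g)) => //; last exact: CkM.
by move=> x Ux; case: (derive_comp1 v (dF _ Ux) (dg _ Ux)) => _ ->.
Qed.

Lemma Ck_comp0 U (F F' : R -> R) (g : V -> R) :
  (forall x, U x -> is_derive (g x) 1 F (F' (g x))) ->
  Ck 0 U g -> Ck 0 U (F \o g).
Proof.
move=> dF /Ck0 dg; apply/Ck0 => x Ux.
by case: (derive_comp1 0 (dF _ Ux) (dg _ Ux)).
Qed.

(** The tower [H] of successive derivatives is carried along and the induction starts at an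
    arbitrary level [j]: the chain rule passes from [H j] to [H j.+1] while the order drops by
    one. *)
Lemma smooth_on_comp (I : set R) (H : nat -> R -> R) U (g : V -> R) : open U ->
  (forall k y, I y -> is_derive y 1 (H k) (H k.+1 y)) ->
  (forall x, U x -> I (g x)) -> smooth_on U g ->
  smooth_on U (H 0%N \o g).
Proof.
move=> oU dH gI /smooth_onP sg; apply/smooth_onP => k.
elim: k (0%N) => [|k IH] j.
  by apply: Ck_comp0 => [x Ux|]; [apply: dH; exact: gI | exact: sg].
apply: Ck_compS => [//|x Ux||]; [by apply: dH; exact: gI | exact: IH | exact: sg].
Qed.

Lemma smooth_on_eq (W : normedModType R) U (f g : V -> W) : open U ->
  (forall x, U x -> f x = g x) -> smooth_on U f -> smooth_on U g.
Proof. by move=> oU fg /smooth_onP sf; apply/smooth_onP => k; exact: Ck_eq (sf k). Qed.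

Lemma smooth_on_sub (W : normedModType R) U U' (f : V -> W) : U' `<=` U ->
  smooth_on U f -> smooth_on U' f.
Proof. by move=> UU sf s x /UU; exact: sf. Qed.

Lemma smooth_on_bigcup (W : normedModType R) U (f : V -> W) :
  (forall x, U x -> exists2 U', U' x & smooth_on U' f) -> smooth_on U f.
Proof. by move=> H s x /H[U' U'x /(_ s x)]; exact. Qed.

Lemma smooth_on_cst (W : normedModType R) U (a : W) : smooth_on U (cst a).
Proof. by apply/smooth_onP => k; exact: Ck_cst. Qed.

Lemma smooth_onD (W : normedModType R) U (f g : V -> W) : open U ->
  smooth_on U f -> smooth_on U g -> smooth_on U (f + g).
Proof. by move=> oU /smooth_onP sf /smooth_onP sg; apply/smooth_onP => k; exact: CkD. Qed.

Lemma smooth_onM U (f g : V -> R) : open U ->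
  smooth_on U f -> smooth_on U g -> smooth_on U (f * g).
Proof. by move=> oU /smooth_onP sf /smooth_onP sg; apply/smooth_onP => k; exact: CkM. Qed.

Lemma smooth_onZ U (a : R) (f : V -> R) : open U ->
  smooth_on U f -> smooth_on U (a *: f).
Proof.
move=> oU sf; have -> : a *: f = cst a * f by apply/funext.
by apply: smooth_onM => //; exact: smooth_on_cst.
Qed.

Lemma smooth_onN U (f : V -> R) : open U -> smooth_on U f -> smooth_on U (- f).
Proof. by move=> oU sf; rewrite -scaleN1r; exact: smooth_onZ. Qed.

Lemma smooth_onB U (f g : V -> R) : open U ->
  smooth_on U f -> smooth_on U g -> smooth_on U (f - g).
Proof. by move=> oU sf sg; apply: smooth_onD => //; exact: smooth_onN. Qed.

Lemma smooth_on_sum (J : Type) (r : seq J) (P : pred J) U (f : J -> V -> R) : open U ->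
  (forall j, P j -> smooth_on U (f j)) -> smooth_on U (\sum_(j <- r | P j) f j).
Proof.
move=> oU sf; elim/big_ind: _ => [|g h sg sh|j /sf//].
  exact: (@smooth_on_cst R^o).
exact: smooth_onD.
Qed.

Lemma smooth_on_derive (W : normedModType R) U (f : V -> W) (v : V) :
  smooth_on U f -> smooth_on U ('D_v f).
Proof. by move=> sf s x Ux; rewrite -iter_derive_rcons; exact: sf. Qed.

Lemma smooth_on_continuous (W : normedModType R) U (f : V -> W) (x : V) :
  smooth_on U f -> U x -> {for x, continuous f}.
Proof. by move=> sf Ux; apply: differentiable_continuous; exact: (sf [::]). Qed.

Lemma smooth_on_derivable (W : normedModType R) U (f : V -> W) (x v : V) :
  smooth_on U f -> U x -> derivable f x v.
Proof. by move=> sf Ux; apply: diff_derivable; exact: (sf [::]). Qed.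

End SmoothCalculus.

Section Precomposition.
Context {R : realType} {V V' : normedModType R}.

Lemma derive_precomp (W : normedModType R) (L : {linear V -> V'}) (f : V' -> W) (x v : V) :
  continuous L -> differentiable f (L x) ->
  differentiable (f \o L) x /\ 'D_v (f \o L) x = 'D_(L v) f (L x).
Proof.
move=> cL df; have dL : differentiable L x by exact: linear_differentiable.
have dfL : differentiable (f \o L) x by exact: differentiable_comp.
by split => //; rewrite !deriveE // diff_comp //= diff_lin.
Qed.

Lemma smooth_on_precomp (W : normedModType R) (L : {linear V -> V'}) (U : set V) (U' : set V')
    (f : V' -> W) : continuous L -> open U -> (forall x, U x -> U' (L x)) ->
  smooth_on U' f -> smooth_on U (f \o L).
Proof.
move=> cL oU LU sf0; apply/smooth_onP => k.
elim: k f sf0 => [|k IH] f /[dup] sf0 /smooth_onP sf.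
  by apply/Ck0 => x Ux; case: (derive_precomp 0 cL (Ck_diff (sf 0%N) (LU _ Ux))).
apply/CkS; split=> [x Ux|v].
  by case: (derive_precomp 0 cL (Ck_diff (sf 0%N) (LU _ Ux))).
apply: Ck_eq (IH ('D_(L v) f) _) => //; last exact: smooth_on_derive.
by move=> x Ux; case: (derive_precomp v cL (Ck_diff (sf 0%N) (LU _ Ux))) => _ ->.
Qed.

End Precomposition.

(** * Alternating sums over permutations *)

Section AlternatingSum.
Context {R : realType} {V : lmodType R} (n : nat).
Notation I := ('I_n * bool)%type.
Variable w : V -> V -> R.
Hypothesis w_lin : forall a u u' v, w (a *: u + u') v = a * w u v + w u' v.
Hypothesis w_alt : forall u v, w v u = - w u v.

(** This is [2 ^ n] times the factorial of [n] times the Pfaffian of the matrix of the values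
    [w (v i) (v j)]; summing over all permutations spares a choice of representatives of the
    pairings. *)
Definition pfaffian_sum (v : I -> V) : R :=
  \sum_(s : {perm I}) (-1) ^+ s * \prod_(k < n) w (v (s (k, false))) (v (s (k, true))).

Let w_linr a u u' v : w v (a *: u + u') = a * w v u + w v u'.
Proof. by rewrite w_alt w_lin (w_alt v u) (w_alt v u'); ring. Qed.

Lemma pfaffian_sum_perm (v : I -> V) (t : {perm I}) :
  pfaffian_sum (v \o t) = (-1) ^+ t * pfaffian_sum v.
Proof.
rewrite /pfaffian_sum (reindex_inj (mulIg t^-1%g)) /= big_distrr /=.
apply: eq_bigr => s _; rewrite mulrA; congr (_ * _).
  by rewrite odd_permM odd_permV signr_addb mulrC.
by apply: eq_bigr => k _; rewrite !permM !permKV.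
Qed.

Lemma pfaffian_sum_alternating (v : I -> V) (i j : I) :
  i != j -> v i = v j -> pfaffian_sum v = 0.
Proof.
move=> ij vij; have := pfaffian_sum_perm v (tperm i j).
have -> : v \o tperm i j = v.
  by apply/funext => k /=; case: tpermP => [->|->|//].
rewrite odd_tperm ij expr1 mulN1r => /eqP; rewrite -subr_eq0 opprK -mulr2n.
by rewrite mulrn_eq0 /= => /eqP.
Qed.

Definition upd (v : I -> V) (i : I) (x : V) : I -> V :=
  fun j => if j == i then x else v j.

(** In the term of a permutation [s], the vector of index [i] occurs in exactly one factor, that of
    the pair containing the preimage of [i] by [s]; every other factor is left alone by the
    update. *)
Lemma pfaffian_sum_linear (v : I -> V) (i : I) a x y :
  pfaffian_sum (upd v i (a *: x + y)) =
  a * pfaffian_sum (upd v i x) + pfaffian_sum (upd v i y).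
Proof.
rewrite /pfaffian_sum big_distrr /= -big_split /=; apply: eq_bigr => s _.
rewrite mulrCA -mulrDr; congr (_ * _).
have [[k0 b0] sk0] : exists kb, s kb = i by exists (s^-1%g i); rewrite permKV.
have off x' (k : 'I_n) b : (k, b) != (k0, b0) -> upd v i x' (s (k, b)) = v (s (k, b)).
  by rewrite /upd -(inj_eq (@perm_inj _ s)) sk0 => /negbTE ->.
have on x' : upd v i x' (s (k0, b0)) = x' by rewrite /upd sk0 eqxx.
have prodE x' : \prod_(k < n) w (upd v i x' (s (k, false))) (upd v i x' (s (k, true)))
   = w (upd v i x' (s (k0, false))) (upd v i x' (s (k0, true))) *
     \prod_(k < n | k != k0) w (v (s (k, false))) (v (s (k, true))).
  rewrite (bigD1 k0) //=; congr (_ * _).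
  by apply: eq_bigr => k kk; rewrite !off // xpair_eqE (negbTE kk).
rewrite !prodE mulrA -mulrDl; congr (_ * _).
have nb : (k0, ~~ b0) != (k0, b0) by rewrite xpair_eqE eqxx /=; case: (b0).
have offn x' : upd v i x' (s (k0, ~~ b0)) = v (s (k0, ~~ b0)) by exact: off.
by clear -on offn w_lin w_linr w_alt; case: b0 on offn => /= on offn; rewrite !on !offn ?w_lin ?w_linr.
Qed.

(** As for a determinant: by multilinearity each added multiple of [v p] or [v q] contributes an
    alternating sum with a repeated vector. The coefficients vanish at [p] and [q], so that the two
    pivots themselves stay in place. *)
Lemma pfaffian_sum_shear (p q : I) (v : I -> V) (c d : I -> R) : p != q ->
  c p = 0 -> d p = 0 -> c q = 0 -> d q = 0 ->
  pfaffian_sum (fun i => v i + (c i *: v p + d i *: v q)) = pfaffian_sum v.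
Proof.
move=> pq cp dp cq dq.
(* [vA r] is sheared at the indices of [r] only, so that the indices can be treated one at a
   time. *)
pose vA (r : seq I) i := if i \in r then v i + (c i *: v p + d i *: v q) else v i.
suff H r : pfaffian_sum (vA r) = pfaffian_sum v.
  rewrite -(H (enum {: I})); congr pfaffian_sum; apply/funext => i.
  by rewrite /vA mem_enum.
elim: r => [|i r IH]; first by congr pfaffian_sum; apply/funext.
rewrite -IH; have [ir|nir] := boolP (i \in r).
  congr pfaffian_sum; apply/funext => j; rewrite /vA inE.
  by have [->|] := eqVneq j i; rewrite ?ir.
have vAp r' : vA r' p = v p by rewrite /vA cp dp !scale0r !addr0; case: ifP.
have vAq r' : vA r' q = v q by rewrite /vA cq dq !scale0r !addr0; case: ifP.
have -> : vA (i :: r) = upd (vA r) i (c i *: v p + (d i *: v q + v i)).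
  apply/funext => j; rewrite /upd /vA inE; have [->|//] := eqVneq j i.
  by rewrite /= [RHS]addrA [RHS]addrC.
have updi : upd (vA r) i (v i) = vA r.
  apply/funext => j; rewrite /upd; have [->|//] := eqVneq j i.
  by rewrite /vA (negbTE nir).
(* Either the vector repeats the one already present at the index [k], or [k = i] is a pivot and its
   coefficient is zero. *)
have z (x : R) k : (vA r k = v k) -> (k = i -> x = 0) ->
    x * pfaffian_sum (upd (vA r) i (v k)) = 0.
  move=> vk xi; have [/xi ->|ki] := eqVneq k i; first by rewrite mul0r.
  rewrite (@pfaffian_sum_alternating _ k i) ?mulr0 //.
  by rewrite /upd eqxx (negbTE ki).
rewrite !pfaffian_sum_linear updi.
by rewrite (z _ p) // ?(z _ q) ?add0r // => <-.
Qed.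

(** Orthogonality of distinct pairs kills every permutation that does not map pairs to pairs, and
    each surviving term equals that of the identity: exchanging two pairs is an even permutation,
    and reversing a pair changes both the signature and the sign of one factor. *)
Lemma pfaffian_sum_orthogonal (v : I -> V) :
  (forall k b l c, k != l -> w (v (k, b)) (v (l, c)) = 0) ->
  (forall k, 0 < w (v (k, false)) (v (k, true))) ->
  0 < pfaffian_sum v.
Proof.
move=> ortho pos.
have wself u : w u u = 0.
  by have := w_alt u u => /eqP; rewrite -subr_eq0 opprK -mulr2n mulrn_eq0 => /eqP.
pose term (s : {perm I}) := (-1) ^+ s * \prod_(k < n) w (v (s (k, false))) (v (s (k, true))).
have fE k b : (k, false) == (k, b) :> I = ~~ b by rewrite xpair_eqE eqxx /=; case: b.
pose flip (k : 'I_n) : {perm I} := tperm (k, false) (k, true).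
have flipT k s : term (flip k * s)%g = term s.
  rewrite /term odd_permM odd_tperm xpair_eqE andbF /= signrN.
  rewrite (bigD1 k) //= [in RHS](bigD1 k) //= !permM !tpermL !tpermR w_alt.
  rewrite !(mulN1r, mulNr, mulrN) opprK; congr (_ * (_ * _)).
  apply: eq_bigr => l lk; rewrite !permM !tpermD //; by rewrite xpair_eqE eq_sym (negbTE lk).
pose swap (k l : 'I_n) : {perm I} := (tperm (k, false) (l, false) * tperm (k, true) (l, true))%g.
have swapE k l i b : swap k l (i, b) = (tperm k l i, b).
  rewrite permM; case: b.
    rewrite [tperm (k, false) _ _]tpermD ?xpair_eqE ?andbF //.
    by case: (tpermP k l i) => [->|->|/eqP ki /eqP li]; rewrite ?tpermL ?tpermR ?tpermD //
       xpair_eqE eq_sym ?(negbTE ki) ?(negbTE li).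
  case: (tpermP k l i) => [->|->|/eqP ki /eqP li]; rewrite ?tpermL ?tpermR.
  - by rewrite tpermD // xpair_eqE andbF.
  - by rewrite tpermD // xpair_eqE andbF.
  - by rewrite tpermD ?tpermD // xpair_eqE ?andbF // eq_sym ?(negbTE ki) ?(negbTE li).
have swapT k l s : term (swap k l * s)%g = term s.
  rewrite /term; congr (_ * _).
    rewrite !odd_permM !odd_tperm !xpair_eqE !eqxx !andbT addbA.
    by rewrite addbb addFb.
  rewrite [RHS](reindex_inj (@perm_inj _ (tperm k l))) /=.
  have sE i b : (swap k l * s)%g (i, b) = s (tperm k l i, b) by rewrite permM swapE.
  by apply: eq_bigr => i _; rewrite !sE.
have term1 : term 1%g = \prod_(k < n) w (v (k, false)) (v (k, true)).
  by rewrite /term odd_perm1 expr0 mul1r; apply: eq_bigr => k _; rewrite !perm1.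
have term1_gt0 : 0 < term 1%g by rewrite term1; apply: prodr_gt0.
(* Induction on the number [m] of pairs that [s] may still move; a nonvanishing term is brought to
   the identity without changing its value. *)
have key m : (m <= n)%N -> forall s, term s != 0 ->
    (forall (k : 'I_n) b, (m <= k)%N -> s (k, b) = (k, b)) -> term s = term 1%g.
  elim: m => [|m IH] mn s ts fixs.
    by congr term; apply/permP => -[k b]; rewrite perm1 fixs.
  pose km := Ordinal mn.
  have reduce s' : term s' != 0 -> (forall (k : 'I_n) b, (m.+1 <= k)%N -> s' (k, b) = (k, b)) ->
      s' (km, false) = (km, false) -> term s' = term 1%g.
    move=> ts' fixs' skm; apply: (IH (ltnW mn)) => // k b.
    rewrite leq_eqVlt => /predU1P[mk|/fixs' //].
    have -> : k = km by apply/val_inj.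
    case: b => //.
    have : w (v (s' (km, false))) (v (s' (km, true))) != 0.
      by move: ts'; rewrite /term (bigD1 km) //= !mulf_eq0 !negb_or => /and3P[].
    rewrite skm; case E: (s' (km, true)) => [l c].
    have [->|kl] := eqVneq l km; last by rewrite ortho ?eqxx // eq_sym.
    by case: c E => // E; rewrite wself eqxx.
  (* The pair with an element that [s] sends to [(km, false)] is swapped into position [km], and
     reversed if needed; the nonvanishing factor at [km] then forces [(km, true)] to be fixed
     too. *)
  case E : (s^-1%g (km, false)) => [j c].
  have sj : s (j, c) = (km, false) by rewrite -E permKV.
  have jm : (j <= m)%N.
    rewrite leqNgt; apply/negP => mj.
    by have := fixs j c mj; rewrite sj => -[kj _]; move: mj; rewrite -kj ltnn.
  pose s1 := (swap km j * s)%g.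
  have s1T : term s1 = term s by exact: swapT.
  have s1fix (k : 'I_n) b : (m.+1 <= k)%N -> s1 (k, b) = (k, b).
    move=> mk; rewrite permM swapE tpermD ?fixs //; apply/eqP => kk.
      by move: mk; rewrite -kk ltnn.
    by move: mk; rewrite -kk ltnNge jm.
  have s1k : s1 (km, c) = (km, false) by rewrite permM swapE tpermL.
  case: c s1k {E sj} => s1k; last by rewrite -s1T reduce // s1T.
  have s2T : term (flip km * s1)%g = term s by rewrite flipT.
  rewrite -s2T reduce // ?s2T //; last by rewrite permM tpermL.
  move=> k b mk; rewrite permM tpermD ?s1fix //; rewrite xpair_eqE;
    by have -> : (km == k) = false by apply/eqP => kk; move: mk; rewrite -kk ltnn.
have ge0 (s : {perm I}) : 0 <= term s.
  have [->//|ts] := eqVneq (term s) 0; rewrite (key n (leqnn n)) ?ltW // => k b.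
  by rewrite leqNgt ltn_ord.
rewrite /pfaffian_sum (bigD1 (1%g : {perm I})) //=; apply: ltr_wpDr => //.
by apply: sumr_ge0 => /= s _; apply: (ge0 s).
Qed.

End AlternatingSum.

(** * Taylor expansions of ln cos and acos *)

Section Taylor.
Context {R : realType}.
Implicit Types (f g H : R -> R) (a b x y : R).

Lemma mean_value_ge0 f f' a b : a <= b ->
  (forall x, a <= x <= b -> is_derive x 1 f (f' x)) ->
  (forall x, a <= x <= b -> 0 <= f' x) -> f a <= f b.
Proof.
move=> ab df f'0.
have [x|c|c] := @MVT_segment R f f' a b ab.
- by rewrite in_itv /= => /andP[ax xb]; apply: df; rewrite !ltW.
- apply: derivable_within_continuous => {}x; rewrite in_itv /= => xab.
  by have [] := df _ xab.
rewrite in_itv /= => cab fba.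
by rewrite -subr_ge0 fba mulr_ge0 ?subr_ge0 ?f'0.
Qed.

Lemma is_derive_affine (a b x : R) : is_derive x 1 (cst a + b *: id : R -> R) b.
Proof.
have := is_deriveD (is_derive_cst a x 1) (is_deriveZ b (is_derive_id x 1)).
by rewrite add0r /GRing.scale /= mulr1.
Qed.

(** Induction on the order: the remainder of [G 0] has as derivative the remainder of [G 1] at one
    order less, so that the bound [psi], plus or minus the remainder, is a nondecreasing function
    vanishing at 0. *)
Lemma taylor_bound_unit (G : nat -> R -> R) (N : nat) (B : R) :
  (forall k (s : R), 0 <= s <= 1 -> is_derive s 1 (G k) (G k.+1 s)) ->
  (forall s : R, 0 <= s <= 1 -> `|G N s| <= B) ->
  forall s : R, 0 <= s <= 1 ->
  `|G 0%N s - \sum_(k < N) s ^+ k * G k 0 / k`!%:R| <= B * s ^+ N / N`!%:R.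
Proof.
elim: N G => [|N IH] G dG GB s s01.
  by rewrite big_ord0 subr0 expr0 mulr1 fact0 divr1; exact: GB.
have {}IH := IH (fun k => G k.+1) (fun k => dG k.+1) GB.
pose phi s := G 0%N s - \sum_(k < N.+1) s ^+ k * G k 0 / k`!%:R.
pose phi' s := G 1%N s - \sum_(k < N) s ^+ k * G k.+1 0 / k`!%:R.
have dphi (x : R) : 0 <= x <= 1 -> is_derive x 1 phi (phi' x).
  move=> x01; rewrite /phi /phi'.
  have -> : (fun s => G 0%N s - \sum_(k < N.+1) s ^+ k * G k 0 / k`!%:R) =
     G 0%N - \sum_(k < N.+1) (G k 0 / k`!%:R) *: (id ^+ k : R -> R).
    apply/funext => z; rewrite fctE /= fct_sumE; congr (_ - _).
    by apply: eq_bigr => k _; rewrite /= ?exprfctE [RHS]mulrC mulrA.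
  apply: is_deriveB; first exact: dG.
  apply: is_derive_eq.
  rewrite big_ord_recl /= !mul0r scale0r scaler0 add0r; apply: eq_bigr => k _.
  rewrite /bump /= add1n factS natrM.
  rewrite /GRing.scale /= mulr1.
  have k0 : k.+1%:R != 0 :> R by rewrite pnatr_eq0.
  have f0 : k`!%:R != 0 :> R by rewrite pnatr_eq0 -lt0n fact_gt0.
  by field; rewrite -natr1 in k0; rewrite f0 addrC.
have phi0 : phi 0 = 0.
  rewrite /phi big_ord_recl /= expr0 mul1r fact0 divr1 big1 ?addr0 ?subrr // => k _.
  by rewrite /bump /= add1n expr0n /= !mul0r.
pose psi s := B * s ^+ N.+1 / N.+1`!%:R.
pose psi' s := B * s ^+ N / N`!%:R.
have dpsi (x : R) : is_derive x 1 psi (psi' x).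
  have -> : psi = (B / N.+1`!%:R) *: (id ^+ N.+1 : R -> R).
    by apply/funext => z; rewrite /psi fctE /= ?exprfctE mulrAC.
  apply: is_derive_eq.
  rewrite /psi' /GRing.scale /= mulr1 factS natrM.
  have k0 : N.+1%:R != 0 :> R by rewrite pnatr_eq0.
  have f0 : N`!%:R != 0 :> R by rewrite pnatr_eq0 -lt0n fact_gt0.
  by field; rewrite -natr1 in k0; rewrite f0 addrC.
have psi0 : psi 0 = 0 by rewrite /psi expr0n /= mulr0 mul0r.
have [s0 s1] := andP s01.
have in01 (x : R) : 0 <= x <= s -> 0 <= x <= 1.
  by move=> /andP[x0 xs]; rewrite x0 (le_trans xs).
rewrite -/(phi s) -/(psi s) ler_norml; apply/andP; split.
  have := @mean_value_ge0 (psi + phi) (psi' + phi') 0 s s0.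
  rewrite !fctE phi0 psi0 addr0 -[- psi s]sub0r lerBlDl; apply.
    by move=> x /in01 x01; have d1 := dphi x x01; have d2 := dpsi x; exact: is_deriveD.
  move=> x /in01 x01; have := IH x x01; rewrite -/(phi' x) -/(psi' x) ler_norml => /andP[+ _].
  by rewrite -[- psi' x]sub0r lerBlDl.
have := @mean_value_ge0 (psi - phi) (psi' - phi') 0 s s0.
rewrite !fctE phi0 psi0 subr0 subr_ge0; apply.
  by move=> x /in01 x01; have d1 := dphi x x01; have d2 := dpsi x; exact: is_deriveB.
by move=> x /in01 x01; have := IH x x01; rewrite -/(phi' x) -/(psi' x) ler_norml subr_ge0 => /andP[_ +].
Qed.

(** Restriction to the segment [s |-> y + h * s] reduces to the unit interval, whatever the sign of
    [h]. *)
Lemma taylor_bound (H : nat -> R -> R) (N : nat) (B y h : R) :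
  (forall k (z : R), `|z - y| <= `|h| -> is_derive z 1 (H k) (H k.+1 z)) ->
  (forall z, `|z - y| <= `|h| -> `|H N z| <= B) ->
  `|H 0%N (y + h) - \sum_(k < N) h ^+ k * H k y / k`!%:R| <= B * `|h| ^+ N / N`!%:R.
Proof.
move=> dH HB; pose G k s := h ^+ k * H k (y + h * s).
have seg (s : R) : 0 <= s <= 1 -> `|y + h * s - y| <= `|h|.
  move=> /andP[s0 s1]; rewrite addrAC subrr add0r normrM (ger0_norm s0).
  by rewrite ler_piMr.
have dG k (s : R) : 0 <= s <= 1 -> is_derive s 1 (G k) (G k.+1 s).
  move=> /seg s01; have dk := dH k _ s01.
  have dl := is_derive_affine y h s.
  have dc := is_derive1_comp (dk : is_derive ((cst y + h *: id : R -> R) s) 1 (H k) _) dl.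
  have d3 := is_deriveZ (h ^+ k) dc.
  apply: (@is_derive_eq _ _ _ _ _ _ _ _ d3).
  by rewrite /G exprS /GRing.scale /=; ring.
have GB (s : R) : 0 <= s <= 1 -> `|G N s| <= `|h| ^+ N * B.
  by move=> /seg s01; rewrite /G normrM normrX ler_wpM2l ?exprn_ge0 // HB.
have := taylor_bound_unit dG GB (s := 1).
rewrite ler01 lexx /= => /(_ isT).
rewrite expr1n mulr1 [X in _ <= X / _]mulrC /G expr0 mul1r mulr1.
have -> // : \sum_(k < N) 1 ^+ k * (h ^+ k * H k (y + h * 0)) / k`!%:R =
   \sum_(k < N) h ^+ k * H k y / k`!%:R.
by apply: eq_bigr => k _; rewrite expr1n mul1r mulr0 addr0.
Qed.

(** The Leibniz rule for Taylor coefficients: with the inverse factorial put inside [a k],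
    differentiation multiplies by [k + 1] and the binomial coefficients disappear. *)
Lemma is_derive_conv (a b : nat -> R -> R) (y : R) :
  (forall k, is_derive y 1 (a k) (k.+1%:R * a k.+1 y)) ->
  (forall k, is_derive y 1 (b k) (k.+1%:R * b k.+1 y)) ->
  forall k, is_derive y 1 (fun x => \sum_(j < k.+1) a j x * b (k - j)%N x)
    (k.+1%:R * \sum_(j < k.+2) a j y * b (k.+1 - j)%N y).
Proof.
move=> da db k.
have -> : (fun x => \sum_(j < k.+1) a j x * b (k - j)%N x) =
   \sum_(j < k.+1) (a j * b (k - j)%N).
  by apply/funext => x; rewrite fct_sumE.
apply: is_derive_eq => /=.
rewrite /GRing.scale /= big_split /= mulr_sumr.
have E1 : \sum_(j < k.+1) b (k - j)%N y * (j.+1%:R * a j.+1 y) =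
   \sum_(j < k.+2) j%:R * (a j y * b (k.+1 - j)%N y).
  rewrite [RHS]big_ord_recl /= mul0r add0r; apply: eq_bigr => j _.
  by rewrite /bump /= add1n subSS; ring.
have E2 : \sum_(j < k.+1) a j y * ((k - j).+1%:R * b (k - j).+1 y) =
   \sum_(j < k.+2) (k.+1 - j)%N%:R * (a j y * b (k.+1 - j)%N y).
  rewrite [RHS]big_ord_recr /= subnn mul0r addr0; apply: eq_bigr => j _.
  by rewrite subSn -1?ltnS //; ring.
rewrite E1 E2 -big_split /=; apply: eq_bigr => j _.
by rewrite -mulrDl -natrD subnK // -ltnS.
Qed.

End Taylor.

Section LogCos.
Context {R : realType}.

(** At [tan y] this is the [k]-th derivative of [tan] at [y] divided by the factorial of [k]: the
    derivative of [tan] being [1 + tan ^ 2], everything stays polynomial in [tan]. *)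
Fixpoint tan_poly (k : nat) : {poly R} :=
  if k is k'.+1 then k'.+1%:R^-1 *: ((1 + 'X ^+ 2) * (tan_poly k')^`()) else 'X.

Definition tan_taylor k (y : R) := (tan_poly k).[tan y].

Lemma is_derive_horner (p : {poly R}) (x : R) : is_derive x 1 (horner p) p^`().[x].
Proof.
elim/poly_ind: p => [|p c IH].
  have -> : horner (0 : {poly R}) = cst 0 by apply/funext => z; rewrite horner0.
  by rewrite deriv0 horner0; exact: is_derive_cst.
have -> : horner (p * 'X + c%:P) = horner p * id + cst c.
  by apply/funext => z; rewrite hornerMXaddC.
apply: is_derive_eq.
by rewrite derivD derivC addr0 derivM derivX !hornerE /GRing.scale /=; ring.
Qed.

Lemma tan_taylor_derive k (y : R) : cos y != 0 ->
  is_derive y 1 (tan_taylor k) (k.+1%:R * tan_taylor k.+1 y).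
Proof.
move=> cy; have d1 := is_derive_tan cy.
have d2 := is_derive_horner (tan_poly k) (tan y).
rewrite /tan_taylor -/(horner (tan_poly k) \o tan); apply: is_derive_eq.
rewrite /= hornerZ hornerM mulrA divff ?pnatr_eq0 // mul1r cos2_tan2 //.
by rewrite !hornerE expr2 mulrC.
Qed.

(** This is the equation [tan' = 1 + tan ^ 2] differentiated [k] times, in terms of Taylor
    coefficients. *)
Lemma tan_taylor_conv k (y : R) : cos y != 0 ->
  k.+1%:R * tan_taylor k.+1 y =
  (k == 0)%:R + \sum_(j < k.+1) tan_taylor j y * tan_taylor (k - j) y.
Proof.
move: y; elim: k => [|k IH] y cy.
  rewrite big_ord_recl big_ord0 addr0 subnn mul1r eqxx /tan_taylor /=.
  by rewrite invr1 scale1r derivX mulr1 hornerD hornerC hornerXn hornerX expr2.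
(* The identity at order [k] holds on a neighbourhood of [y], where [cos] does not vanish, so both
   sides may be differentiated. *)
have near0 : \forall z \near y, cos z != 0.
  have : {for y, continuous (@cos R)} by apply: continuous_cos.
  by move=> /cvgr_neq0; apply.
have d1 : is_derive y 1 (fun x => k.+1%:R * tan_taylor k.+1 x)
    (k.+1%:R * (k.+2%:R * tan_taylor k.+2 y)).
  by have := tan_taylor_derive k.+1 cy => ?; apply: is_deriveZ.
have d2 : is_derive y 1 (fun x => (k == 0)%:R + \sum_(j < k.+1) tan_taylor j x * tan_taylor (k - j) x)
    (0 + k.+1%:R * \sum_(j < k.+2) tan_taylor j y * tan_taylor (k.+1 - j) y).
  have := is_derive_conv (fun k => tan_taylor_derive k cy) (fun k => tan_taylor_derive k cy) k => ?.
  exact: (is_deriveD (f := cst _)).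
have : k.+1%:R * (k.+2%:R * tan_taylor k.+2 y) =
   0 + k.+1%:R * \sum_(j < k.+2) tan_taylor j y * tan_taylor (k.+1 - j) y.
  rewrite -(@derive_val _ _ _ _ _ _ _ d1) -(@derive_val _ _ _ _ _ _ _ d2).
  by apply: near_eq_derive; apply: filterS near0 => z; exact: IH.
rewrite !add0r => /mulfI; apply; by rewrite pnatr_eq0.
Qed.

(** The recursion has [k + 1] terms on the right and the factor [k + 1] on the left, so the bound
    grows only geometrically; this is what gives a positive radius of convergence. *)
Lemma tan_taylor_bound k (y rho : R) : cos y != 0 -> 0 <= rho ->
  1 + tan y ^+ 2 <= rho ^+ 2 -> `|tan_taylor k y| <= rho ^+ k.+1.
Proof.
move=> cy rho0 hrho; elim/ltn_ind: k => -[|k] IH.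
  rewrite /tan_taylor hornerX -(@ler_pXn2r _ 2) // ?nnegrE ?expr_ge0 //.
  by rewrite real_normK ?num_real // (le_trans _ hrho) // lerDr.
have conv : `|\sum_(j < k.+1) tan_taylor j y * tan_taylor (k - j) y| <= k.+1%:R * rho ^+ k.+2.
  apply: le_trans (ler_norm_sum _ _ _) _.
  apply: (@le_trans _ _ (\sum_(j < k.+1) rho ^+ k.+2)); last by rewrite sumr_const card_ord mulr_natl.
  apply: ler_sum => j _; rewrite normrM.
  have -> : k.+2 = (j.+1 + (k - j).+1)%N by rewrite addSn addnS subnKC // -ltnS.
  rewrite exprD; apply: ler_pM => //; apply: IH => //.
  by rewrite ltnS leq_subr.
have k0 : 0 < k.+1%:R :> R by rewrite ltr0n.
rewrite -(ler_pM2l k0) -[X in X * _ <= _](ger0_norm (ltW k0)) -normrM tan_taylor_conv //.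
case: k => [|k] in IH conv k0 *; last by rewrite add0r.
move: conv k0 IH => _ _ _.
rewrite big_ord_recl big_ord0 addr0 subnn eqxx /tan_taylor /= hornerX -expr2.
by rewrite ger0_norm ?mul1r // addr_ge0 // sqr_ge0.
Qed.

(* The successive derivatives of [2 * ln (cos y)]. *)
Definition log_cos k (y : R) : R :=
  if k is k'.+1 then (-2 * k'`!%:R) * tan_taylor k' y else 2 * ln (cos y).

Lemma log_cos_derive k (y : R) : 0 < cos y ->
  is_derive y 1 (log_cos k) (log_cos k.+1 y).
Proof.
move=> cy; case: k => [|k] /=.
  have d := is_derive1_ln cy.
  have d2 : is_derive y 1 (@ln R \o cos) ((cos y)^-1 * - sin y) by apply: is_derive1_comp.
  have d3 : is_derive y 1 (2 *: (@ln R \o cos : R -> R)) (2 *: ((cos y)^-1 * - sin y)).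
    exact: is_deriveZ.
  apply: (@is_derive_eq _ _ _ _ _ _ _ _ d3).
  by rewrite /tan_taylor /= hornerX /tan fact0 /GRing.scale /=; field; rewrite gt_eqF.
have d := tan_taylor_derive k (negbT (gt_eqF cy)).
have d3 : is_derive y 1 ((-2 * k`!%:R : R) *: tan_taylor k)
   ((-2 * k`!%:R) *: (k.+1%:R * tan_taylor k.+1 y)) by exact: is_deriveZ.
apply: (@is_derive_eq _ _ _ _ _ _ _ _ d3).
by rewrite factS natrM /GRing.scale /=; ring.
Qed.

(** [cos eta] is a lower bound of [cos y] and [1 + tan ^ 2] is the inverse of [cos ^ 2], hence
    [tan_taylor_bound] applies with [rho] the inverse of [cos eta]. *)
Lemma log_cos_bound k (y eta : R) : (0 < k)%N -> `|y| <= eta -> eta < pi / 2 ->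
  `|log_cos k y| <= 2 * k`!%:R * ((cos eta)^-1) ^+ k.
Proof.
case: k => // k _ ye e2.
have e0 : 0 <= eta by exact: le_trans ye.
have pi0 : 0 < (pi : R) by exact: pi_gt0.
have ce : 0 < cos eta by apply: cos_gt0_pihalf; rewrite e2 andbT; lra.
have cye : cos eta <= cos y.
  have epi : eta <= pi by lra.
  have ypi : `|y| <= pi by exact: le_trans epi.
  by rewrite -[cos y]cos_norm leNgt ltr_cos ?in_itv /= ?normr_ge0 ?e0 ?epi ?ypi // -leNgt.
have cy : 0 < cos y by exact: lt_le_trans ce cye.
rewrite /= normrM -mulrA.
have -> : `|-2 * k`!%:R : R| = 2 * k`!%:R by rewrite normrM normrN !ger0_norm.
have b : `|tan_taylor k y| <= ((cos eta)^-1) ^+ k.+1.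
  apply: tan_taylor_bound; [by rewrite gt_eqF | by rewrite invr_ge0 ltW |].
  rewrite -(cos2_tan2 (negbT (gt_eqF cy))) exprVn lef_pV2 ?posrE ?exprn_gt0 //.
  by rewrite ler_pXn2r // nnegrE ltW.
rewrite -[leLHS]mulrA ler_pM2l // factS natrM -[leRHS]mulrA.
rewrite -[leLHS]mul1r; apply: ler_pM; rewrite ?ler1n //.
by rewrite ler_wpM2l.
Qed.

End LogCos.

Section Arccos.
Context {R : realType}.

(** The absolute value of the binomial coefficient of -1/2 over [k]. *)
Fixpoint binom_half (k : nat) : R :=
  if k is k'.+1 then binom_half k' * (k'%:R + 2^-1) / k'.+1%:R else 1.

Lemma binom_half_bound k : 0 <= binom_half k <= 1.
Proof.
elim: k => [|k /andP[b0 b1]] /=; first by rewrite ler01 lexx.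
apply/andP; split; first by rewrite divr_ge0 // mulr_ge0 // addr_ge0.
rewrite ler_pdivrMr ?ltr0n // mul1r -[k.+1%:R]natr1 -[leRHS]mul1r.
by apply: ler_pM; rewrite ?addr_ge0 ?b0 ?b1 ?lerD2l //; lra.
Qed.

(** The [k]-th Taylor coefficient at [x] of the power -1/2 of [1 + e * x]; the values [e = 1] and
    [e = -1] give the two factors of the derivative of [acos]. *)
Definition rsqrt_taylor (e : R) (k : nat) (x : R) : R :=
  binom_half k * (- e) ^+ k * ((Num.sqrt (1 + e * x))^-1 * (1 + e * x)^-1 ^+ k).

Lemma rsqrt_taylor_derive (e : R) k (x : R) : 0 < 1 + e * x ->
  is_derive x 1 (rsqrt_taylor e k) (k.+1%:R * rsqrt_taylor e k.+1 x).
Proof.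
move=> ex; set g := (cst 1 + e *: id : R -> R).
have gE z : g z = 1 + e * z by [].
have dg : is_derive x 1 g e by exact: is_derive_affine.
have ex' : 0 < g x by [].
set r := (Num.sqrt (g x))^-1; set gi := (g x)^-1.
have ds : is_derive x 1 (Num.sqrt \o g) ((2 * Num.sqrt (g x))^-1 * e).
  by apply: is_derive1_comp; exact: is_derive1_sqrt.
have s0 : (Num.sqrt \o g) x != 0 by rewrite /= gt_eqF // sqrtr_gt0.
have drs : is_derive x 1 (fun z => (Num.sqrt (g z))^-1) (- (2^-1 * e * (r * gi))).
  apply: (@is_derive_eq _ _ _ _ _ _ _ _ (is_deriveV s0 ds)).
  have -> : gi = r ^+ 2 by rewrite /gi /r exprVn sqr_sqrtr // ltW.
  have -> : (Num.sqrt \o g) x ^- 2 = r ^+ 2 by rewrite /r exprVn.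
  have -> : (2 * Num.sqrt (g x))^-1 = 2^-1 * r by rewrite invfM.
  by rewrite /GRing.scale /=; ring.
have dgi : is_derive x 1 (fun z => (g z)^-1) (- (e * gi ^+ 2)).
  apply: (@is_derive_eq _ _ _ _ _ _ _ _ (is_deriveV (negbT (gt_eqF ex')) dg)).
  by rewrite /GRing.scale /= -exprVn -/gi; ring.
have dgik := is_deriveX k dgi.
have d3 := is_deriveZ (binom_half k * (- e) ^+ k) (is_deriveM drs dgik).
have -> : rsqrt_taylor e k = (binom_half k * (- e) ^+ k) *:
   ((fun z => (Num.sqrt (g z))^-1) * (fun z => (g z)^-1) ^+ k).
  by apply/funext => z; rewrite !fctE /= ?exprfctE.
apply: (@is_derive_eq _ _ _ _ _ _ _ _ d3).
rewrite !fctE /= ?exprfctE /rsqrt_taylor -!gE -/r -/gi /GRing.scale /=.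
have k0 : k.+1%:R != 0 :> R by rewrite pnatr_eq0.
rewrite mulrA [X in X * _ = _]mulrC.
case: k k0 {dgik d3} => [|k] k0.
  by rewrite /= !expr0 !expr1; field.
rewrite [k.+1.-1]/=.
have -> : k.+2%:R * (binom_half k.+2 * (- e) ^+ k.+2 * (r * gi ^+ k.+2)) =
   (k.+1%:R + 2^-1) * (binom_half k.+1 * (- e) ^+ k.+2 * (r * gi ^+ k.+2)).
  have -> : binom_half k.+2 = binom_half k.+1 * (k.+1%:R + 2^-1) / k.+2%:R by [].
  have : k.+2%:R != 0 :> R by rewrite pnatr_eq0.
  by move: (k.+2%:R : R) => c c0; field.
by rewrite !exprS; set b := binom_half _; set q := (- e) ^+ k; set p := gi ^+ k; field.
Qed.

(* The successive derivatives of [acos]. *)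
Definition acos_diff k (x : R) : R :=
  if k is k'.+1 then - (k'`!%:R * \sum_(j < k'.+1) rsqrt_taylor 1 j x * rsqrt_taylor (-1) (k' - j) x)
  else acos x.

Lemma acos_diff_derive k (x : R) : -1 < x < 1 ->
  is_derive x 1 (acos_diff k) (acos_diff k.+1 x).
Proof.
move=> x1; have p1 : 0 < 1 + 1 * x by lra.
have p2 : 0 < 1 + -1 * x by lra.
case: k => [|k] /=.
  apply: (@is_derive_eq _ _ _ _ _ _ _ _ (is_derive1_acos x1)).
  rewrite big_ord_recl big_ord0 addr0 fact0 /rsqrt_taylor /= !expr0 !mul1r !mulr1.
  rewrite -invfM -sqrtrM; last by rewrite -[x]mul1r ltW.
  by congr (- (Num.sqrt _)^-1); ring.
have d := is_derive_conv (fun k => rsqrt_taylor_derive k p1) (fun k => rsqrt_taylor_derive k p2) k.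
have d3 := is_deriveZ (- k`!%:R) d.
have -> : acos_diff k.+1 =
   (- k`!%:R : R) *: (fun x => \sum_(j < k.+1) rsqrt_taylor 1 j x * rsqrt_taylor (-1) (k - j) x).
  by apply/funext => z; rewrite /= fctE /GRing.scale /= mulNr.
apply: (@is_derive_eq _ _ _ _ _ _ _ _ d3).
by rewrite factS natrM /GRing.scale /=; ring.
Qed.

(** With [K] the inverse of [1 - x1], each coefficient of index [j] is at most [K ^ (j + 1)]: the
    square root costs at most one further [K] because [K >= 1]. The [k] terms of the Cauchy product
    turn the factorial of [k - 1] into that of [k]. *)
Lemma acos_diff_bound k (x x1 : R) : (0 < k)%N -> `|x| <= x1 -> x1 < 1 ->
  `|acos_diff k x| <= k`!%:R * ((1 - x1)^-1) ^+ k.+1.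
Proof.
case: k => // k _ xx1 x11; set K := (1 - x1)^-1.
have K1 : 1 <= K.
  rewrite invr_ge1 ?unitfE ?subr_eq0 ?gt_eqF //; first by rewrite lerBlDr lerDl (le_trans _ xx1).
  by rewrite subr_gt0.
have K0 : 0 <= K by exact: le_trans K1.
have rb e j : `|e| = 1 -> `|rsqrt_taylor e j x| <= K ^+ j.+1.
  move=> e1; have exK : 1 - x1 <= 1 + e * x.
    by rewrite lerD2l lerNl -mulNr (le_trans (ler_norm _)) // normrM normrN e1 mul1r.
  have ex0 : 0 < 1 + e * x by apply: lt_le_trans exK; rewrite subr_gt0.
  have iK : (1 + e * x)^-1 <= K by rewrite lef_pV2 ?posrE ?subr_gt0.
  have /andP[b0 b1] := binom_half_bound j.
  rewrite /rsqrt_taylor normrM normrM normrX normrN e1 expr1n mulr1 (ger0_norm b0).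
  rewrite -[leRHS]mul1r ler_pM // normrM exprS ger0_norm ?invr_ge0 ?sqrtr_ge0 //.
  rewrite ger0_norm; last by rewrite exprn_ge0 // invr_ge0 ltW.
  apply: ler_pM; rewrite ?invr_ge0 ?sqrtr_ge0 ?exprn_ge0 ?invr_ge0 ?(ltW ex0) //; last first.
    by rewrite lerXn2r // nnegrE // invr_ge0 ltW.
  rewrite lef_pV2 ?posrE ?sqrtr_gt0 ?subr_gt0 //.
  have x0 : 0 <= 1 - x1 by rewrite subr_ge0 ltW.
  rewrite -[1 - x1]ger0_norm // -sqrtr_sqr ler_wsqrtr // (le_trans _ exK) //.
  by rewrite expr2 ler_piMl // lerBlDr lerDl (le_trans _ xx1).
have -> : acos_diff k.+1 x =
  - (k`!%:R * \sum_(j < k.+1) rsqrt_taylor 1 j x * rsqrt_taylor (-1) (k - j) x) by [].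
rewrite normrN normrM ger0_norm // factS natrM [k.+1%:R * _]mulrC -mulrA ler_wpM2l //.
apply: le_trans (ler_norm_sum _ _ _) _.
apply: (@le_trans _ _ (\sum_(j < k.+1) K ^+ k.+2)); last by rewrite sumr_const card_ord mulr_natl.
apply: ler_sum => j _; rewrite normrM.
have -> : k.+2 = (j.+1 + (k - j).+1)%N by rewrite addSn addnS subnKC // -ltnS.
by rewrite exprD; apply: ler_pM => //; apply: rb; rewrite ?normrN normr1.
Qed.

End Arccos.

Section SphericalTriangle.
Context {R : realType}.

(** The hypothesis is the nonnegativity of the Gram determinant of three unit vectors at mutual
    angles [a], [b], [c]. It yields [cos (a + b) <= cos c], and [cos] decreases on the interval from
    0 to [pi], which contains [a + b]. *)
Lemma spherical_triangle (a b c : R) :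
  0 <= a < pi / 2 -> 0 <= b < pi / 2 -> 0 <= c < pi / 2 ->
  (cos c - cos a * cos b) ^+ 2 <= (1 - cos a ^+ 2) * (1 - cos b ^+ 2) ->
  c <= a + b.
Proof.
move=> /andP[a0 a1] /andP[b0 b1] /andP[c0 c1] cs.
have pi0 : 0 < (pi : R) by exact: pi_gt0.
have sa : 0 <= sin a by apply: sin_ge0_pi; apply/andP; split; lra.
have sb : 0 <= sin b by apply: sin_ge0_pi; apply/andP; split; lra.
have cc : cos (a + b) <= cos c.
  have h : `|cos c - cos a * cos b| <= sin a * sin b.
    rewrite -(ler_pXn2r (ltn0Sn 1)) ?nnegrE ?mulr_ge0 // real_normK ?num_real //.
    by apply: le_trans cs _; rewrite exprMn !sin2cos2.
  by rewrite cosD lerBlDr -lerBlDl -opprB (le_trans (ler_norm _)) // normrN.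
have abI : a + b \in `[0, pi] by rewrite in_itv /=; apply/andP; split; lra.
have cI : c \in `[0, pi] by rewrite in_itv /=; apply/andP; split; lra.
by rewrite leNgt -ltr_cos // -leNgt.
Qed.

End SphericalTriangle.

Section SmoothFunctions.
Context {R : realType} {V : normedModType R}.
Implicit Types (U : set V) (f g : V -> R).

Lemma smooth_on_from_derivative U (F F' : R -> R) g : open U ->
  (forall x, U x -> is_derive (g x) 1 F (F' (g x))) ->
  smooth_on U (F' \o g) -> smooth_on U g -> smooth_on U (F \o g).
Proof.
move=> oU dF /smooth_onP sF /smooth_onP sg; apply/smooth_onP => -[|k].
  by apply: Ck_comp0 dF _; exact: sg.
exact: Ck_compS dF _ _.
Qed.

Lemma smooth_on_expR U g : open U -> smooth_on U g -> smooth_on U (expR \o g).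
Proof.
by move=> oU; apply: (@smooth_on_comp _ _ setT (fun=> expR)) => // k y _; exact: is_derive_expR.
Qed.

(** The derivative of the inverse is a polynomial in the inverse, so the induction on the order
    closes on itself. *)
Lemma smooth_on_inv U g : open U -> (forall x, U x -> g x != 0) ->
  smooth_on U g -> smooth_on U (fun x => (g x)^-1).
Proof.
move=> oU g0 /smooth_onP sg; apply/smooth_onP.
have dinv x : U x -> is_derive (g x) 1 (@GRing.inv R) (- (g x) ^- 2).
  move=> /g0 gx; have := @is_deriveV R id (g x) 1 1 gx (is_derive_id _ _).
  by rewrite /GRing.scale /= mulr1.
elim=> [|k IH]; first by apply: (@Ck_comp0 _ _ U GRing.inv (fun y => - y ^- 2)).
apply: (@Ck_compS _ _ k U GRing.inv (fun y => - y ^- 2)) => //.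
have -> : (fun y => - y ^- 2) \o g = cst (-1) * ((fun x => (g x)^-1) * (fun x => (g x)^-1)).
  by apply/funext => x /=; rewrite !fctE /= mulN1r -invfM -expr2.
by apply: CkM => //; [exact: (@Ck_cst _ _ R^o) | exact: CkM].
Qed.

Lemma smooth_on_ln U g : open U -> (forall x, U x -> 0 < g x) ->
  smooth_on U g -> smooth_on U (@ln R \o g).
Proof.
move=> oU g0 sg.
have dF x : U x -> is_derive (g x) 1 (@ln R) (GRing.inv (g x)).
  by move=> /g0; exact: is_derive1_ln.
apply: (smooth_on_from_derivative (F' := GRing.inv) oU dF _ sg).
by apply: smooth_on_inv => // x /g0 /lt0r_neq0.
Qed.

Lemma smooth_on_atan U g : open U -> smooth_on U g -> smooth_on U (@atan R \o g).
Proof.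
move=> oU sg; apply: (@smooth_on_from_derivative U atan (fun y => (1 + y ^+ 2)^-1)) => //.
have -> : (fun y => (1 + y ^+ 2)^-1) \o g = fun x => ((cst 1 + g * g) x)^-1.
  by apply/funext => x; rewrite fctE /= expr2.
apply: smooth_on_inv => //.
  by move=> x _; rewrite gt_eqF // fctE /= ltr_pwDl // -expr2 sqr_ge0.
by apply: smooth_onD => //; [exact: (@smooth_on_cst _ _ R^o) | exact: smooth_onM].
Qed.

Lemma smooth_on_cos_sin U g : open U -> smooth_on U g ->
  smooth_on U (@cos R \o g) /\ smooth_on U (@sin R \o g).
Proof.
move=> oU /smooth_onP sg.
suff H k : Ck k U (@cos R \o g) /\ Ck k U (@sin R \o g).
  by split; apply/smooth_onP => k; case: (H k).
have dcos x : is_derive (g x) 1 (@cos R) (- sin (g x)) by exact: is_derive_cos.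
have dsin x : is_derive (g x) 1 (@sin R) (cos (g x)) by exact: is_derive_sin.
elim: k => [|k [IHc IHs]]; split.
- by apply: (@Ck_comp0 _ _ U cos (fun y => - sin y)).
- by apply: (@Ck_comp0 _ _ U sin cos).
- apply: (@Ck_compS _ _ k U cos (fun y => - sin y)) => //.
  have -> : (fun y => - sin y) \o g = cst (-1) * (@sin R \o g).
    by apply/funext => x; rewrite !fctE /= mulN1r.
  by apply: CkM => //; exact: (@Ck_cst _ _ R^o).
- exact: (@Ck_compS _ _ k U sin cos).
Qed.

End SmoothFunctions.

(** * A flat smooth function, for bumps *)

Section FlatFunction.
Context {R : realType}.

(* All the derivatives of [exp (-1/x)], extended by 0 to [x <= 0], are of this form. *)
Definition flat_exp (p : {poly R}) (x : R) : R :=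
  if 0 < x then p.[x^-1] * expR (- x^-1) else 0.

(** Term by term, [y ^ i] is dominated by [expR y] times the factorial of [i + 1]. This is what
    makes the flat function tend to 0 at 0 faster than every power. *)
Lemma horner_expRN_bounded (p : {poly R}) : exists2 C : R, 0 <= C &
  forall y, 0 < y -> `|p.[y] * expR (- y)| <= C.
Proof.
exists (\sum_(i < size p) `|p`_i| * i.+1`!%:R + `|p`_0|).
  by rewrite addr_ge0 // sumr_ge0 // => i _; rewrite mulr_ge0.
move=> y y0; rewrite horner_coef normrM (ger0_norm (expR_ge0 _)).
apply: le_trans (_ : \sum_(i < size p) `|p`_i| * (y ^+ i * expR (- y)) <= _).
  apply: le_trans (_ : _ <= (\sum_(i < size p) `|p`_i * y ^+ i|) * expR (- y)) _.
    by rewrite ler_wpM2r ?expR_ge0 // ler_norm_sum.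
  rewrite mulr_suml; apply: ler_sum => i _.
  by rewrite normrM normrX (gtr0_norm y0) mulrA.
apply: le_trans (_ : _ <= \sum_(i < size p) `|p`_i| * i.+1`!%:R) _; last by rewrite lerDl.
apply: ler_sum => i _; rewrite ler_wpM2l //.
have f0 (k : nat) : 0 < k`!%:R :> R by rewrite ltr0n fact_gt0.
rewrite expRN ler_pdivrMr ?expR_gt0 //.
case: (i : nat) => [|k].
  by rewrite expr0 (_ : 1`! = 1)%N // mul1r (le_trans _ (expR_ge1Dx _)) // lerDl ltW.
have := expR_ge1Dxn k (ltW y0) => /(le_trans _) H.
apply: (@le_trans _ _ (k.+1`!%:R * expR y)).
  by rewrite mulrC -ler_pdivrMr // H // lerDr ler01.
by rewrite ler_wpM2r ?expR_ge0 // ler_nat factS leq_pmull.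
Qed.

(** From the derivative of [p (1/x)] times [exp (-1/x)]: both factors yield the inverse square of
    [x], which is ['X ^+ 2] at [1/x]. *)
Definition flat_deriv (p : {poly R}) : {poly R} := 'X ^+ 2 * (p - p^`()).

Lemma is_derive_flat_exp (p : {poly R}) (x : R) :
  is_derive x 1 (flat_exp p) (flat_exp (flat_deriv p) x).
Proof.
have [x0|x0] := ltP 0 x.
  pose f z := p.[z^-1] * expR (- z^-1).
  have dinv : is_derive x 1 (@GRing.inv R) (- x ^- 2).
    have := @is_deriveV R id x 1 1 (lt0r_neq0 x0) (is_derive_id _ _).
    by rewrite /GRing.scale /= mulr1.
  have dninv : is_derive x 1 (fun z : R => - z^-1) (x ^- 2).
    by have := is_deriveN dinv; rewrite opprK.
  have d1 : is_derive x 1 (horner p \o GRing.inv) (p^`().[x^-1] * - x ^- 2).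
    by apply: is_derive1_comp.
  have d2 : is_derive x 1 (expR \o (fun z : R => - z^-1)) (expR (- x^-1) * x ^- 2).
    by apply: is_derive1_comp.
  have d3 := is_deriveM d1 d2.
  apply: (@near_eq_is_derive _ _ _ ((horner p \o GRing.inv) * (expR \o (fun z : R => - z^-1)))).
    by near=> z; rewrite /flat_exp ifT //; near: z; exact: lt_nbhsr.
  apply: (@is_derive_eq _ _ _ _ _ _ _ _ d3).
  rewrite /flat_exp x0 /flat_deriv !hornerE /GRing.scale /= exprVn; ring.
have -> : flat_exp (flat_deriv p) x = 0 by rewrite /flat_exp ltNge x0.
have [x0'|x0'] := boolP (x < 0).
  apply: (@near_eq_is_derive _ _ _ (cst 0)).
  near=> z; rewrite /flat_exp ltNge ifF //; apply/negbF/ltW; near: z.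
  exact: lt_nbhsl.
have {x0 x0'}-> : x = 0 by apply/eqP; rewrite eq_le x0 leNgt.
(* Two more powers than in [p] are bounded: the value at [h > 0] is then at most [C * h ^ 2] in
   absolute value, and the difference quotient at most [C * h]. *)
have [C C0 HC] := horner_expRN_bounded ('X ^+ 2 * p).
have lim0 : h^-1 *: (flat_exp p (h *: 1 + 0) - flat_exp p 0) @[h --> 0^'] --> (0 : R).
  apply/cvgr0Pnorm_lt => e e0; near=> h.
  have -> : flat_exp p 0 = 0 by rewrite /flat_exp ltxx.
  rewrite addr0 subr0 /flat_exp [h *: 1]mulr1.
  have [h0|] := ifP; last by rewrite scaler0 normr0.
  have hi : 0 < h^-1 by rewrite invr_gt0.
  have := HC _ hi; rewrite hornerM hornerXn /GRing.scale /=.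
  have -> : h^-1 ^+ 2 * p.[h^-1] * expR (- h^-1) = h^-1 * (h^-1 * (p.[h^-1] * expR (- h^-1))).
    by rewrite expr2 !mulrA.
  rewrite normrM (gtr0_norm hi) ler_pdivrMl // => /le_lt_trans; apply.
  apply: (@le_lt_trans _ _ (h * (C + 1))); first by rewrite ler_pM2l // lerDl.
  rewrite -ltr_pdivlMr ?ltr_wpDl //.
  apply: le_lt_trans (ler_norm _) _; near: h; apply: dnbhs0_lt.
  by rewrite divr_gt0 // ltr_wpDl.
split; first by apply/cvg_ex; exists 0.
exact: cvg_lim.
Unshelve. all: by end_near. Qed.

Lemma smooth_on_flat_exp (V : normedModType R) (U : set V) (p : {poly R}) g : open U ->
  smooth_on U g -> smooth_on U (flat_exp p \o g).
Proof.
move=> oU sg.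
apply: (@smooth_on_comp _ _ setT (fun k => flat_exp (iter k flat_deriv p))) => //.
by move=> k y _; exact: is_derive_flat_exp.
Qed.

Definition flat_bump (x : R) : R := flat_exp 1 x.

Lemma flat_bump_gt0 x : (0 < flat_bump x) = (0 < x).
Proof.
by rewrite /flat_bump /flat_exp; case: ifP => x0; rewrite ?ltxx // hornerC mul1r expR_gt0.
Qed.

Lemma flat_bump_ge0 x : 0 <= flat_bump x.
Proof. by rewrite /flat_bump /flat_exp; case: ifP => // _; rewrite hornerC mul1r expR_ge0. Qed.

End FlatFunction.

(** * Positivity of the volume form *)

Section TopPower.
Context {R : realType} (n : nat).
Local Notation E := 'rV[R]_(n + n).
Local Notation I := ('I_n * bool)%type.
Implicit Types (u v : E).

Lemma Jmap_linear a u v : Jmap (a *: u + v) = a *: Jmap u + Jmap v.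
Proof.
by rewrite /Jmap !linearP /= scale_row_mx add_row_mx scalerN.
Qed.

Lemma JmapK u : Jmap (Jmap u) = - u.
Proof. by rewrite /Jmap row_mxKl row_mxKr -[in RHS](hsubmxK u) opp_row_mx. Qed.

Definition complex_coord u (k : 'I_n) (b : bool) : R :=
  u 0 (if b then rshift n k else lshift n k).

Lemma Jmap_coord u k b :
  complex_coord (Jmap u) k b = (-1) ^+ (~~ b) * complex_coord u k (~~ b).
Proof.
rewrite /complex_coord /Jmap; case: b => /=.
  by rewrite row_mxEr !mxE expr0 mul1r.
by rewrite row_mxEl !mxE expr1 mulN1r.
Qed.

Lemma Jmap_basis_vec (k : 'I_n) : Jmap (basis_vec (k, false)) = basis_vec (k, true) :> E.
Proof.
apply/rowP => j; rewrite -(splitK j) /Jmap /basis_vec /=.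
case: (fintype.split j) => i /=.
  by rewrite row_mxEl !mxE /= eq_lrshift eq_rlshift oppr0.
by rewrite row_mxEr !mxE /= !eq_shift.
Qed.

Variable w : E -> E -> R.
Hypothesis w_lin : forall a u u' v, w (a *: u + u') v = a * w u v + w u' v.
Hypothesis w_alt : forall u v, w v u = - w u v.
Hypothesis w_J : forall u v, w (Jmap u) (Jmap v) = w u v.
Hypothesis w_pos : forall v, v != 0 -> 0 < w v (Jmap v).

Let wJ u v : w (Jmap u) v = - w u (Jmap v).
Proof.
have w0 z : w 0 z = 0.
  have := w_lin 1 0 0 z; rewrite scale1r addr0 mul1r => e.
  by apply: (addrI (w 0 z)); rewrite addr0 -e.
rewrite -(w_J u) JmapK (w_alt (- v)) opprK.
by rewrite -[- v]addr0 -scaleN1r w_lin w0 addr0 mulN1r -w_alt.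
Qed.

Let pairs (x : 'I_n -> E) (i : I) : E := if i.2 then Jmap (x i.1) else x i.1.

(** An invariant of the elimination whose use is that no [x k] vanishes, so that each can serve as a
    pivot with [w (x k) (Jmap (x k))] positive. *)
Let triangular (x : 'I_n -> E) := forall k : 'I_n,
  complex_coord (x k) k false = 1 /\
  forall (l : 'I_n) b, (k < l)%N -> complex_coord (x k) l b = 0.

Let orthogonal_upto m (x : 'I_n -> E) := forall (j k : 'I_n), (j < m)%N -> (j < k)%N ->
  w (x k) (x j) = 0 /\ w (x k) (Jmap (x j)) = 0.

(* Hermitian Gram-Schmidt, by shears that do not change the alternating sum. *)
Let gram_schmidt m : (m <= n)%N -> exists x, [/\ triangular x, orthogonal_upto m x &
  pfaffian_sum w (pairs x) = pfaffian_sum w (@basis_vec R n)].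
Proof.
elim: m => [_|m IH mn].
  exists (fun k => basis_vec (k, false)); split=> //.
    move=> k; split; first by rewrite /complex_coord /basis_vec !mxE !eqxx.
    move=> l b kl; rewrite /complex_coord /basis_vec /= !mxE eqxx /=.
    case: b; rewrite ?eq_rlshift // eq_lshift.
    by case: eqP kl => // ->; rewrite ltnn.
  congr pfaffian_sum; apply/funext => -[k []] //; rewrite /pairs /=.
  exact: Jmap_basis_vec.
have [x [xt xo xp]] := IH (ltnW mn).
pose p := Ordinal mn; pose lam := w (x p) (Jmap (x p)).
have xp0 : x p != 0.
  apply/eqP => x0; have [+ _] := xt p.
  by rewrite x0 /complex_coord mxE => /eqP; rewrite eq_sym oner_eq0.
have lam0 : lam != 0 by rewrite gt_eqF // w_pos.
have wself u : w u u = 0.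
  by have := w_alt u u => /eqP; rewrite -subr_eq0 opprK -mulr2n mulrn_eq0 => /eqP.
(* [ca] and [cb] solve [w (y k) (Jmap (x p)) = 0] and [w (y k) (x p) = 0], a diagonal system since
   [w (x p) (x p) = 0] and [w (x p) (Jmap (x p)) = lam]. *)
pose ca (k : 'I_n) := if (m < k)%N then - (w (x k) (Jmap (x p)) / lam) else 0.
pose cb (k : 'I_n) := if (m < k)%N then w (x k) (x p) / lam else 0.
pose y k := x k + (ca k *: x p + cb k *: Jmap (x p)).
have wy k v : w (y k) v = w (x k) v + (ca k * w (x p) v + cb k * w (Jmap (x p)) v).
  have -> : y k = ca k *: x p + (cb k *: Jmap (x p) + x k) by rewrite /y addrC addrA.
  by rewrite !w_lin addrA addrC.
have ylow (k : 'I_n) : (k <= m)%N -> y k = x k.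
  by move=> km; rewrite /y /ca /cb ltnNge km /= !scale0r !addr0.
exists y; split.
- move=> k; have ycoord l b : complex_coord (y k) l b = complex_coord (x k) l b
    + (ca k * complex_coord (x p) l b + cb k * complex_coord (Jmap (x p)) l b).
    by rewrite /complex_coord !mxE.
  have [x1 x2] := xt k; have [_ z2] := xt p.
  split=> [|l b kl]; rewrite ycoord ?x1 ?x2 // Jmap_coord.
    have [mk|mk] := ltnP m k; first by rewrite !z2 // !mulr0 !addr0.
    by rewrite /ca /cb ltnNge mk /= !mul0r !addr0.
  have [mk|mk] := ltnP m k.
    by rewrite !z2 ?(ltn_trans mk kl) // !mulr0 !addr0.
  by rewrite /ca /cb ltnNge mk /= !mul0r !addr0.
- move=> j k jm jk; rewrite !wy (ylow j) //; move: jm; rewrite ltnS leq_eqVlt.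
  case/predU1P => [jm|jm].
    have -> : j = p by apply/val_inj.
    have mk : (m < k)%N by rewrite -jm.
    rewrite wself w_J wself !mulr0 add0r addr0 (w_alt (x p) (Jmap (x p))) -/lam.
    by rewrite /ca /cb mk; split; field.
  have [h1 h2] := xo _ _ jm jk; have [h3 h4] := xo _ p jm jm.
  have h5 : w (Jmap (x p)) (x j) = 0 by rewrite wJ h4 oppr0.
  have h6 : w (Jmap (x p)) (Jmap (x j)) = 0 by rewrite w_J.
  by rewrite h1 h2 h3 h4 h5 h6 !mulr0 !addr0.
- rewrite -xp.
  (* [Jmap (y k)] is [Jmap (x k)] plus [ca k] times [Jmap (x p)] minus [cb k] times [x p], so
     replacing [x] by [y] shears the whole family of pairs by the two pivots [x p] and
     [Jmap (x p)]. *)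
  rewrite -(@pfaffian_sum_shear R E n w w_lin w_alt (p, false) (p, true) (pairs x)
    (fun i => if i.2 then - cb i.1 else ca i.1) (fun i => if i.2 then ca i.1 else cb i.1)) //=;
    rewrite /ca /cb /= ?ltnn ?oppr0 //.
  congr pfaffian_sum; apply/funext => -[k b]; rewrite /pairs /=; case: b => //=.
  have -> : y k = ca k *: x p + (cb k *: Jmap (x p) + x k) by rewrite /y addrC addrA.
  rewrite !Jmap_linear JmapK [LHS]addrA [LHS]addrC; congr (_ + _).
    by rewrite addrC scalerN scaleNr.
by rewrite xpair_eqE andbF.
Qed.

(** Gram-Schmidt replaces the coordinate basis by orthogonal complex lines, on which [w] is block
    diagonal with positive blocks. *)
Lemma top_power_gt0 : 0 < top_power w.
Proof.
rewrite /top_power mulr_gt0 ?invr_gt0 ?ltr0n ?muln_gt0 ?expn_gt0 ?fact_gt0 //.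
have [x [xt xo]] := gram_schmidt (leqnn n).
rewrite -[X in _ -> 0 < X]/(pfaffian_sum w (@basis_vec R n)) => <-.
have x0 k : x k != 0.
  apply/eqP => x0; have [+ _] := xt k.
  by rewrite x0 /complex_coord mxE => /eqP; rewrite eq_sym oner_eq0.
apply: (pfaffian_sum_orthogonal w_alt) => /=; last by move=> k; exact: (w_pos (x0 k)).
have H (j k : 'I_n) b c : (j < k)%N -> w (pairs x (k, b)) (pairs x (j, c)) = 0.
  move=> jk; have [h1 h2] := xo j k (ltn_ord j) jk; rewrite /pairs /=.
  by case: b; case: c; rewrite /= ?w_J ?wJ ?h1 ?h2 ?oppr0.
move=> k b l c kl; case: (ltngtP k l) => [lt|lt|/val_inj e].
- by rewrite w_alt H ?oppr0.
- exact: H.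
- by rewrite e eqxx in kl.
Qed.

End TopPower.

(** * Integration on the manifold *)

(** A finite subcover, then induction along its list. It carries local facts about the volume and
    the charts over to the whole of [M]. *)
Lemma compact_induction (M : ptopologicalType) (Q : set M -> Prop) :
  compact [set: M] -> Q set0 ->
  (forall A B, A `<=` B -> Q B -> Q A) ->
  (forall A B, Q A -> Q B -> Q (A `|` B)) ->
  (forall p, exists A, [/\ open A, A p & Q A]) -> Q [set: M].
Proof.
move=> cM Q0 Qsub QU Qloc.
have [A HA] := choice Qloc.
move: cM; rewrite compact_cover => /(_ M [set: M] A).
case=> [p _|p _|D _ cov]; [by have [] := HA p | by exists p => //; have [] := HA p |].
have H (s : seq M) : Q [set x | exists2 p, p \in s & A p x].
  elim: s => [|p s IH]; first by apply: Qsub Q0 => x [].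
  have [_ _ Qp] := HA p; apply: Qsub (QU _ _ Qp IH) => x [q].
  by rewrite inE => /predU1P[->|qs Aq]; [left | right; exists q].
have QD := H (finmap.enum_fset D).
by refine (Qsub _ _ _ QD) => x /cov [p /= pD Ap]; exists p.
Qed.

Section CoordIntegral.
Context {R : realType}.
Local Open Scope ereal_scope.

(** Read off the definition of the integral of a nonnegative function as a supremum over the simple
    functions below it. It thus covers iterated integrals, whose inner integrals are not known to be
    measurable in the outer variable. *)
Lemma ge0_le_integral_any d (T : measurableType d) (mu : {measure set T -> \bar R})
    (D : set T) (f g : T -> \bar R) :
  (forall x, D x -> 0 <= f x) -> (forall x, D x -> f x <= g x) ->
  \int[mu]_(x in D) f x <= \int[mu]_(x in D) g x.
Proof.
move=> f0 fg; have g0 x : D x -> 0 <= g x by move=> Dx; exact: le_trans (f0 _ Dx) (fg _ Dx).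
rewrite !ge0_integralE //; apply: le_ereal_sup => _ [h /= hf <-]; exists h => //= x.
apply: le_trans (hf x) _; rewrite /patch; case: ifPn => // /set_mem; exact: fg.
Qed.

Lemma coord_integral_ge0 n (f : 'rV[R]_n -> \bar R) :
  (forall x, 0 <= f x) -> 0 <= coord_integral f.
Proof.
elim: n f => [|n IH] f f0 /=; first exact: f0.
by apply: integral_ge0 => t _; apply: IH => z; exact: f0.
Qed.

Lemma le_coord_integral n (f g : 'rV[R]_n -> \bar R) :
  (forall x, 0 <= f x) -> (forall x, f x <= g x) ->
  coord_integral f <= coord_integral g.
Proof.
elim: n f g => [|n IH] f g f0 fg /=; first exact: fg.
apply: ge0_le_integral_any => t _; first by apply: coord_integral_ge0 => z; exact: f0.
by apply: IH => z; [exact: f0 | exact: fg].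
Qed.

Definition box n (y : 'rV[R]_n) (r : R) : set 'rV[R]_n :=
  [set z | forall i, (`|z ord0 i - y ord0 i| < r)%R].

(** Boxes are products, so the indicator splits off the first coordinate; the constant [k] is
    carried along because the outer integrand is again a constant times an indicator. *)
Lemma coord_integral_box n (y : 'rV[R]_n) (r k : R) : (0 < r)%R -> (0 <= k)%R ->
  coord_integral (fun x => (\1_(box y r) x * k)%:E) = ((2 * r) ^+ n * k)%:E.
Proof.
move=> r0; elim: n y k => [|n IH] y k k0.
  rewrite /= expr0 mul1r indicE mem_set ?mul1r // => -[].
  by case.
rewrite [LHS]/=.
pose y' : 'rV[R]_n := rsubmx (y : 'rV[R]_(1 + n)).
have boxE t (z : 'rV[R]_n) : box y r (row_mx (t%:M : 'rV[R]_1) z : 'rV[R]_n.+1) <->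
    ball (y ord0 ord0) r t /\ box y' r z.
  have e0 : (row_mx (t%:M : 'rV[R]_1) z : 'rV[R]_n.+1) ord0 ord0 = t.
    have := row_mxEl (t%:M : 'M[R]_1) z ord0 ord0; rewrite [X in _ = X]mxE eqxx mulr1n => e; rewrite -[RHS]e.
    by congr (row_mx _ _ _ _); apply/val_inj.
  have eS i : (row_mx (t%:M : 'rV[R]_1) z : 'rV[R]_n.+1) ord0 (lift ord0 i) = z ord0 i.
    have := row_mxEr (t%:M : 'M[R]_1) z ord0 i => <-.
    by congr (row_mx _ _ _ _); apply/val_inj.
  have yS i : y' ord0 i = y ord0 (lift ord0 i).
    by rewrite /y' mxE; congr (y _ _); apply/val_inj.
  split=> [H|[H0 H] i].
    split=> [|i]; first by have := H ord0; rewrite e0 /ball /= distrC.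
    by have := H (lift ord0 i); rewrite eS yS.
  case: (unliftP ord0 i) => [j ->|->]; first by rewrite eS -yS; exact: H.
  by rewrite e0 distrC.
have E t : coord_integral (fun z : 'rV[R]_n =>
     (\1_(box y r) (row_mx (t%:M : 'rV[R]_1) z : 'rV[R]_n.+1) * k)%:E) =
   ((2 * r) ^+ n * k)%:E * (\1_(ball (y ord0 ord0) r) t)%:E.
  rewrite -EFinM; have [bt|nbt] := pselect (ball (y ord0 ord0) r t).
    rewrite indicE mem_set // mulr1 -(IH y' k k0); congr coord_integral.
    apply/funext => z; rewrite !indicE; congr ((_ * _)%R%:E); congr (nat_of_bool _)%:R.
    by apply/idP/idP => /set_mem H; apply/mem_set; [case/boxE: H | apply/boxE].
  rewrite indicE memNset // mulr0.
  (* Off the interval the slice is empty; its integral 0 is read as the induction hypothesis with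
     [k = 0]. *)
  have -> : 0%R%:E = ((2 * r) ^+ n * 0)%:E :> \bar R by rewrite mulr0.
  rewrite -(IH y' 0%R (lexx _)); congr coord_integral; apply/funext => z.
  by rewrite mulr0 indicE memNset ?mul0r // => /boxE[].
have mball : measurable (ball (y ord0 ord0) r : set (measurableTypeR R)).
  by rewrite ball_itv; exact: measurable_itv.
under eq_integral do rewrite E.
rewrite ge0_integralZl_EFin ?mulr_ge0 ?exprn_ge0 ?mulr_ge0 ?(ltW r0) //; last first.
  by apply/measurable_EFinP; apply: measurable_indic; exact: mball.
rewrite (integral_indic _ _ mball) ?setIT //.
rewrite [X in _ * X](lebesgue_measure_ball _ (ltW r0)) -EFinM exprS; congr EFin.
by rewrite -mulr_natl; ring.
Qed.

End CoordIntegral.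

Section KahlerVolume.
Context {R : realType} (n : nat) (M : ptopologicalType)
  (X : @closed_kahler R n M)
  (mu : {measure set (g_sigma_algebraType (@open M)) -> \bar R}).
Hypothesis hmu : is_kahler_volume X mu.
Local Notation E := 'rV[R]_(n + n).

Local Notation coord := Defs.coord.
Local Notation chartM := (@chart R n M).

Lemma nbhs_box (x : E) (A : set E) : nbhs x A -> exists2 r, 0 < r & box x r `<=` A.
Proof.
move=> /nbhs_ballP[r /= r0 rA]; exists r => // z H; apply: rA; split=> [//|i j].
by rewrite ord1 /ball /= distrC; exact: H.
Qed.

Lemma box_nbhs (x : E) (r : R) : 0 < r -> nbhs x (box x r).
Proof.
move=> r0; apply/nbhs_ballP; exists r => // z [_ H] i.
by have := H ord0 i; rewrite /ball /= distrC.
Qed.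

Lemma chart_open (c : chartM) : atlas X c -> open (dom c).
Proof. by move=> ac; have [] := atlas_chart ac. Qed.

Lemma chart_continuous (c : chartM) p : atlas X c -> dom c p -> {for p, continuous (coord c)}.
Proof.
move=> ac dp; have [od _ cc _ _] := atlas_chart ac.
by move: cc; rewrite continuous_open_subspace // => /(_ p (mem_set dp)).
Qed.

Lemma param_continuous (c : chartM) x : atlas X c -> codom_of c x -> {for x, continuous (param c)}.
Proof.
move=> ac dx; have [_ od _ cc _] := atlas_chart ac.
by move: cc; rewrite continuous_open_subspace // => /(_ x (mem_set dx)).
Qed.

Lemma codom_open (c : chartM) : atlas X c -> open (codom_of c).
Proof. by move=> ac; have [] := atlas_chart ac. Qed.

Lemma coordK (c : chartM) p : atlas X c -> dom c p -> param c (coord c p) = p.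
Proof. by move=> ac; have [_ _ _ _] := atlas_chart ac; exact. Qed.

Lemma paramK (c : chartM) x : atlas X c -> codom_of c x ->
  dom c (param c x) /\ coord c (param c x) = x.
Proof. by move=> ac [p dp <-]; rewrite coordK. Qed.

Lemma coord_preimage_open (c : chartM) (A : set E) : atlas X c -> open A ->
  open (dom c `&` coord c @^-1` A).
Proof.
move=> ac oA; rewrite openE => p [dp Ap]; apply: filterI.
  by apply: open_nbhs_nbhs; split => //; exact: chart_open.
by apply: chart_continuous => //; apply: open_nbhs_nbhs.
Qed.

Lemma coord_preimage_image (c : chartM) (A : set E) : atlas X c -> A `<=` codom_of c ->
  coord c @` (dom c `&` coord c @^-1` A) = A.
Proof.
move=> ac AC; apply/seteqP; split => [_ [p [dp Ap] <-]//|x Ax].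
have [dx cx] := paramK ac (AC _ Ax); exists (param c x) => //.
by split => //=; rewrite cx.
Qed.

Lemma smooth_top_power (c : chartM) : atlas X c ->
  smooth_on (codom_of c) (fun x => top_power (kform X c x)).
Proof.
move=> ac; have oc := codom_open ac.
have -> : (fun x => top_power (kform X c x)) = ((2 ^ n * n`!)%:R)^-1 *:
   \sum_(s : {perm ('I_n * bool)}) (-1) ^+ s *: \prod_(k < n)
     (fun x => kform X c x (basis_vec (s (k, false))) (basis_vec (s (k, true)))).
  apply/funext => x; rewrite /top_power fctE fct_sumE /GRing.scale /=; congr (_ * _).
  apply: eq_bigr => s _; rewrite /GRing.scale /=; congr (_ * _).
  by elim/big_rec2: _ => // k y f _ ->.
apply: smooth_onZ => //; apply: smooth_on_sum => // s _; apply: smooth_onZ => //.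
elim/big_ind: _ => [|f g sf sg|k _]; first exact: (@smooth_on_cst _ _ R^o).
  exact: smooth_onM.
exact: kform_smooth.
Qed.

Lemma top_power_kform_gt0 (c : chartM) x : atlas X c -> codom_of c x ->
  0 < top_power (kform X c x).
Proof.
move=> ac cx; apply: top_power_gt0 => *.
- exact: kform_linear.
- exact: kform_alternating.
- exact: kform_J.
- exact: kform_positive.
Qed.

(** In a chart the density is continuous and positive, hence between two positive constants on a
    small box, and the volume is compared with that of boxes. *)
Lemma kahler_volume_nbhs (p : M) (O : set M) : open O -> O p ->
  exists A, [/\ open A, A p, A `<=` O & (0 < mu A < +oo)%E].
Proof.
move=> oO Op; have [c ac dp] := atlas_cover X p.
pose x := coord c p; have cx : codom_of c x by exists p.
have oc := codom_open ac.
pose h x := top_power (kform X c x); have hx0 : 0 < h x by exact: top_power_kform_gt0.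
have ch : {for x, continuous h} by exact: smooth_on_continuous (smooth_top_power ac) cx.
have px : param c x = p by exact: coordK.
have N1 : nbhs x (codom_of c) by exact: open_nbhs_nbhs.
have N2 : nbhs x (param c @^-1` O).
  by apply: param_continuous => //; rewrite px; exact: open_nbhs_nbhs.
have N3 : \forall z \near x, h x / 2 < h z < h x + 1.
  have h1 : h x / 2 < h x by rewrite ltr_pdivrMr // ltr_pMr // ltr1n.
  have h2 : h x < h x + 1 by rewrite ltrDl.
  near=> z; apply/andP; split; near: z.
    by apply: (cvgr_gt (h x)).
  by apply: (cvgr_lt (h x)).
have [r r0 rB] := nbhs_box (filterI (filterI N1 N2) N3).
(* The interior makes [A] open, hence Borel; the smaller box of radius [r'] inside it gives the
   lower bound. *)
pose B : set E := (box x r)^°; have oB : open B by exact: open_interior.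
have BS : B `<=` box x r by exact: interior_subset.
have [r' r'0 rB'] := nbhs_box (nbhs_interior (box_nbhs x r0)).
pose A := dom c `&` coord c @^-1` B.
have BC : B `<=` codom_of c by move=> z /BS /rB[[]].
have oA : open A by exact: coord_preimage_open.
have muA : mu A = coord_integral (fun z => (\1_B z * h z)%:E).
  rewrite (hmu ac) ?coord_preimage_image //; last by move=> ? [].
  by apply: sub_sigma_algebra.
have hB z : B z -> h x / 2 < h z < h x + 1 by move=> /BS /rB [].
have ind01 (S : set E) z : 0 <= \1_S z :> R by rewrite indicE ler0n.
exists A; split => //.
- by split => //=; exact: box_nbhs.
- by move=> q [dq Bq]; have [[_]] := rB _ (BS _ Bq); rewrite /= coordK.
apply/andP; split.
  apply: (@lt_le_trans _ _ (coord_integral (fun z => (\1_(box x r') z * (h x / 2))%:E))).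
    by rewrite coord_integral_box ?divr_ge0 ?ltW // lte_fin mulr_gt0 ?divr_gt0 // exprn_gt0 // mulr_gt0.
  rewrite muA; apply: le_coord_integral => z.
    by rewrite lee_fin mulr_ge0 // divr_ge0 // ltW.
  rewrite lee_fin !indicE; have [zr|zr] := boolP (z \in box x r').
    have Bz : B z by apply: rB'; exact: set_mem.
    by rewrite (mem_set Bz) !mul1r ltW //; case/andP: (hB _ Bz).
  rewrite mul0r; have [/set_mem/hB/andP[h1 _]|_] := boolP (z \in B); last by rewrite mul0r.
  by rewrite mul1r ltW // (lt_trans _ h1) // divr_gt0.
rewrite muA.
apply: (@le_lt_trans _ _ (coord_integral (fun z => (\1_(box x r) z * (h x + 1))%:E))).
  apply: le_coord_integral => z; rewrite lee_fin !indicE.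
    have [/set_mem/hB/andP[h1 _]|_] := boolP (z \in B); last by rewrite mul0r.
    by rewrite mul1r ltW // (lt_trans _ h1) // divr_gt0.
  have [/set_mem Bz|_] := boolP (z \in B); last by rewrite mul0r mulr_ge0 // addr_ge0 ?ltW.
  by rewrite (mem_set (BS _ Bz)) !mul1r ltW //; case/andP: (hB _ Bz).
by rewrite coord_integral_box ?ltry // addr_ge0 ?ltW.
Unshelve. all: by end_near. Qed.

Lemma kahler_volume_open_gt0 (O : set M) : open O -> O !=set0 -> (0 < mu O)%E.
Proof.
move=> oO [p Op]; have [A [oA Ap AO /andP[A0 _]]] := kahler_volume_nbhs oO Op.
apply: lt_le_trans A0 _; apply: le_measure => //; rewrite inE; exact: sub_sigma_algebra.
Qed.

Lemma kahler_volume_finite : (mu setT < +oo)%E.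
Proof.
(* Being contained in a Borel set of finite volume passes to arbitrary subsets, Borel or not, as
   [compact_induction] demands. *)
have := @compact_induction M (fun A => exists B, [/\ measurable (B : set (g_sigma_algebraType (@open M))), A `<=` B & (mu B < +oo)%E]) (manifold_compact X).
case.
- by exists set0; split=> //; rewrite measure0 ltry.
- by move=> A B AB [C [mC BC muC]]; exists C; split => //; exact: subset_trans BC.
- move=> A B [A' [mA AA muA]] [B' [mB BB muB]]; exists (A' `|` B'); split.
  + exact: measurableU.
  + exact: setUSS.
  + by apply: le_lt_trans (measureU2 mu mA mB) _; exact: lte_add_pinfty.
- move=> p; have [A [oA Ap _ /andP[_ muA]]] := kahler_volume_nbhs openT (I : setT p).
  by exists A; split => //; exists A; split => //; exact: sub_sigma_algebra.
move=> B [mB BT muB]; have -> // : setT = B by apply/seteqP; split.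
Qed.

End KahlerVolume.

(** * Continuous functions and their integrals *)

Section Continuity.
Context {R : realType} {M : topologicalType}.
Implicit Types (f g : M -> R).

Lemma contD f g : continuous f -> continuous g -> continuous (fun p => f p + g p).
Proof. by move=> cf cg p; apply: cvgD; [exact: cf | exact: cg]. Qed.

Lemma contB f g : continuous f -> continuous g -> continuous (fun p => f p - g p).
Proof. by move=> cf cg p; apply: cvgB; [exact: cf | exact: cg]. Qed.

Lemma contM f g : continuous f -> continuous g -> continuous (fun p => f p * g p).
Proof. by move=> cf cg p; apply: cvgM; [exact: cf | exact: cg]. Qed.

Lemma cont_cst (a : R) : continuous (fun _ : M => a).
Proof. by move=> p; exact: cvg_cst. Qed.

Lemma contX f k : continuous f -> continuous (fun p => f p ^+ k).
Proof.
move=> cf; elim: k => [|k IH]; first by under eq_fun do rewrite expr0; exact: cont_cst.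
by under eq_fun do rewrite exprS; exact: contM.
Qed.

Lemma contN f : continuous f -> continuous (fun p => - f p).
Proof. by move=> cf p; apply: cvgN; exact: cf. Qed.

Lemma cont_comp (F : R -> R) f : continuous F -> continuous f -> continuous (fun p => F (f p)).
Proof. by move=> cF cf p; apply: (continuous_comp (cf p)); exact: cF. Qed.

Lemma cont_expR f : continuous f -> continuous (fun p => expR (f p)).
Proof. by apply: cont_comp; exact: continuous_expR. Qed.

Lemma cont_norm f : continuous f -> continuous (fun p => `|f p|).
Proof. by apply: cont_comp; exact: norm_continuous. Qed.

End Continuity.

Ltac cont := repeat first [ match goal with
    | |- continuous (fun _ => ?a) => exact: cont_cst
    | |- continuous (fun p => - @?f p) => apply: contN
    | |- continuous (fun p => @?f p - @?g p) => apply: contB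
    | |- continuous (fun p => @?f p + @?g p) => apply: contD
    | |- continuous (fun p => @?f p * @?g p) => apply: contM
    | |- continuous (fun p => @?f p ^+ ?k) => apply: contX
    | |- continuous (fun p => expR (@?f p)) => apply: cont_expR
    | |- continuous (fun p => `|@?f p|) => apply: cont_norm
    | H : continuous ?f |- continuous ?f => exact H
    end ].

Section Integrals.
Context {R : realType} (n : nat) (M : ptopologicalType)
  (X : @closed_kahler R n M)
  (mu : {measure set (g_sigma_algebraType (@open M)) -> \bar R}).
Hypothesis hmu : is_kahler_volume X mu.
Local Notation E := 'rV[R]_(n + n).
Local Notation coord := Defs.coord.
Local Notation chartM := (@chart R n M).
Local Notation T := (g_sigma_algebraType (@open M)).
Local Notation VI := (vol_integral mu).
Implicit Types (f g : M -> R).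

Lemma continuous_bounded f : continuous f -> exists2 B, 0 < B & forall p, `|f p| <= B.
Proof.
move=> cf.
have cM := manifold_compact X.
have [B [_ HB]] : bounded_set (f @` [set: M]).
  apply: compact_bounded; apply: continuous_compact => //.
  exact: continuous_subspaceT.
exists (`|B| + 1) => [|p]; first by rewrite ltr_pwDr.
by apply: (HB (`|B| + 1)); [rewrite (le_lt_trans (ler_norm _)) // ltrDl | exists p].
Qed.

Lemma continuous_measurable f : continuous f -> measurable_fun [set: T] (f : T -> R).
Proof.
move=> /continuousP cf; apply: (measurability (@RGenOpens.G R)) => //.
  exact: RGenOpens.measurableE.
move=> _ [_ [x [y ->]] <-]; rewrite setTI; apply: sub_sigma_algebra; apply: cf.
exact: interval_open.
Qed.

Lemma continuous_integrable f : continuous f -> mu.-integrable [set: T] (EFin \o f : T -> \bar R).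
Proof.
move=> cf; have [B B0 fB] := continuous_bounded cf.
apply: (@le_integrable _ _ _ _ _ _ _ (EFin \o cst B)) => //.
- by apply/measurable_EFinP; exact: continuous_measurable.
- by move=> p _ /=; rewrite lee_fin (ger0_norm (ltW B0)); exact: fB.
- apply/integrableP; split; first by apply/measurable_EFinP; exact: measurable_cst.
  rewrite /= integral_cst // lte_mul_pinfty // ?ltry //; exact: kahler_volume_finite hmu.
Qed.

Lemma VID f g : continuous f -> continuous g ->
  VI (fun p => f p + g p) = VI f + VI g.
Proof. by move=> cf cg; apply: RintegralD => //; exact: continuous_integrable. Qed.

Lemma VIB f g : continuous f -> continuous g ->
  VI (fun p => f p - g p) = VI f - VI g.
Proof. by move=> cf cg; apply: RintegralB => //; exact: continuous_integrable. Qed.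

Lemma VIZ (a : R) f : continuous f -> VI (fun p => a * f p) = a * VI f.
Proof. by move=> cf; apply: RintegralZl => //; exact: continuous_integrable. Qed.

Lemma VI_lin2 a b f g : continuous f -> continuous g ->
  a * VI f + b * VI g = VI (fun p => a * f p + b * g p).
Proof. by move=> cf cg; rewrite VID ?VIZ //; cont. Qed.

Lemma VI_lin4 a b c d f g h k :
  continuous f -> continuous g -> continuous h -> continuous k ->
  a * VI f + b * VI g + (c * VI h + d * VI k) =
  VI (fun p => a * f p + b * g p + (c * h p + d * k p)).
Proof. by move=> cf cg ch ck; rewrite !VI_lin2 // -VID //; cont. Qed.

Lemma le_VI f g : continuous f -> continuous g -> (forall p, f p <= g p) -> VI f <= VI g.
Proof. by move=> cf cg fg; apply: le_Rintegral => //; exact: continuous_integrable. Qed.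

Lemma eq_VI f g : (forall p, f p = g p) -> VI f = VI g.
Proof. by move=> fg; congr vol_integral; apply/funext. Qed.

Lemma VI_ge0 f : (forall p, 0 <= f p) -> 0 <= VI f.
Proof. by move=> f0; apply: Rintegral_ge0. Qed.

Lemma VI_norm f : continuous f -> `|VI f| <= VI (fun p => `|f p|).
Proof. by move=> cf; apply: le_normr_Rintegral => //; exact: continuous_integrable. Qed.

Lemma VI_cst (a : R) : VI (fun=> a) = a * Vol mu.
Proof.
by rewrite /Vol /vol_integral !Rintegral_cst // mul1r.
Qed.

Lemma VI_bound f (B : R) : continuous f -> (forall p, `|f p| <= B) -> `|VI f| <= B * Vol mu.
Proof.
move=> cf fB; apply: le_trans (VI_norm cf) _; rewrite -VI_cst; apply: le_VI => //.
- by move=> p; apply: continuous_comp; [exact: cf | exact: norm_continuous].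
- by move=> p; exact: cst_continuous.
Qed.

(** [f] exceeds half of [f p] on an open set around [p], and nonempty open sets have positive
    volume. The positivity of cosines and the definiteness of the L^2 norm rest on this. *)
Lemma VI_gt0 f p : continuous f -> (forall q, 0 <= f q) -> 0 < f p -> 0 < VI f.
Proof.
move=> cf f0 fp; pose O := [set q | f p / 2 < f q].
have oO : open O.
  by move/continuousP: (cf) => /(_ [set y | f p / 2 < y]); apply; exact: open_gt.
have Op : O p by rewrite /O /= ltr_pdivrMr // ltr_pMr // ltr1n.
have mO : measurable (O : set T) by exact: sub_sigma_algebra.
have muO : (0 < mu O)%E by apply: (kahler_volume_open_gt0 hmu oO); exists p.
have muOf : (mu O < +oo)%E.
  apply: le_lt_trans (kahler_volume_finite hmu).
  by apply: le_measure => //; rewrite inE.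
rewrite /vol_integral /Rintegral fine_gt0 //; apply/andP; split; last first.
  have /integrableP[_ h] := continuous_integrable cf.
  apply: le_lt_trans h; apply: ge0_le_integral_any => q _; rewrite lee_fin ?f0 //.
  exact: ler_norm.
have H : (0 < \int[mu]_(q in [set: T]) ((f p / 2) * \1_(O : set T) q)%:E)%E.
  under eq_integral do rewrite EFinM.
  rewrite ge0_integralZl_EFin //; last 2 first.
    by apply/measurable_EFinP; exact: measurable_indic.
    by rewrite divr_ge0 // ltW.
  rewrite (integral_indic _ _ mO) // setIT mule_gt0 // lte_fin divr_gt0 //.
apply: (lt_le_trans H).
apply: ge0_le_integral_any => q _; rewrite lee_fin; first by rewrite mulr_ge0 ?divr_ge0 ?(ltW fp).
rewrite indicE; have [/set_mem|_] := boolP (q \in O); last by rewrite mulr0.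
by rewrite mulr1 => /ltW.
Qed.

Lemma Vol_gt0 : 0 < Vol mu.
Proof.
apply: (@VI_gt0 (fun=> 1) point) => // p; exact: cst_continuous.
Qed.

Lemma VI_eq0 f : continuous f -> (forall q, 0 <= f q) -> VI f = 0 -> forall p, f p = 0.
Proof.
move=> cf f0 If p; apply/eqP; rewrite eq_le f0 andbT leNgt; apply/negP => fp.
by have := VI_gt0 cf f0 fp; rewrite If ltxx.
Qed.

Lemma VI_cauchy_schwarz f g : continuous f -> continuous g ->
  VI (fun p => f p * g p) ^+ 2 <= VI (fun p => f p ^+ 2) * VI (fun p => g p ^+ 2).
Proof.
move=> cf cg.
have cff : continuous (fun p => f p ^+ 2) by cont.
have cgg : continuous (fun p => g p ^+ 2) by cont.
have cfg : continuous (fun p => f p * g p) by cont.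
set a := VI (fun p => f p ^+ 2); set b := VI (fun p => f p * g p); set c := VI (fun p => g p ^+ 2).
have quad x y : 0 <= x ^+ 2 * a + (2 * x * y) * b + y ^+ 2 * c.
  rewrite -!VIZ // -!VID; try by cont.
  apply: VI_ge0 => p; have -> : x ^+ 2 * f p ^+ 2 + 2 * x * y * (f p * g p) + y ^+ 2 * g p ^+ 2 =
      (x * f p + y * g p) ^+ 2 by ring.
  exact: sqr_ge0.
have a0 : 0 <= a by apply: VI_ge0 => p; exact: sqr_ge0.
have [a00|an0] := eqVneq a 0.
  have b0 : b = 0.
    (* With [a = 0] the form is [2 * x * y * b + y ^ 2 * c]; at these points it equals
       [- (c + 2) * b ^ 2], which forces [b = 0]. *)
    have q1 := quad (- (c + 1)) b; have q2 := quad (c + 1) (- b).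
    have c0 : 0 <= c by apply: VI_ge0 => p; exact: sqr_ge0.
    rewrite a00 in q1 q2; have b2 : b ^+ 2 <= 0 by nra.
    by apply/eqP; rewrite -sqrf_eq0 eq_le b2 sqr_ge0.
  by rewrite b0 a00 expr0n mul0r.
have := quad (- b) a.
have -> : (- b) ^+ 2 * a + 2 * - b * a * b + a ^+ 2 * c = a * (a * c - b ^+ 2) by ring.
by rewrite pmulr_rge0 ?subr_ge0 // lt_neqAle eq_sym an0 a0.
Qed.

End Integrals.

(** * Smooth functions on the manifold and their seminorms *)

Section SmoothOnManifold.
Context {R : realType} (n : nat) (M : ptopologicalType)
  (X : @closed_kahler R n M).
Local Notation E := 'rV[R]_(n + n).
Local Notation coord := Defs.coord.
Local Notation chartM := (@chart R n M).
Implicit Types (f g : M -> R).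

Lemma smooth_fun_continuous f : smooth_fun X f -> continuous f.
Proof.
move=> sf p; have [c ac dp] := atlas_cover X p.
have cx : codom_of c (coord c p) by exists p.
have pE : param c (coord c p) = p by exact: (coordK ac dp).
have c1 : {for coord c p, continuous (f \o param c)}.
  exact: smooth_on_continuous (sf _ ac) cx.
have c2 : {for p, continuous ((f \o param c) \o coord c)}.
  by apply: continuous_comp c1; exact: (chart_continuous ac dp).
have near_eq : \forall q \near p, ((f \o param c) \o coord c) q = f q.
  have := open_nbhs_nbhs (conj (chart_open ac) dp); apply: filterS => q dq /=.
  by rewrite (coordK ac dq).
rewrite /continuous_at -{2}pE; apply: cvg_trans c2.
by apply: near_eq_cvg; apply: filterS near_eq => q ->.
Qed.

Lemma smooth_fun_cst (a : R) : smooth_fun X (fun=> a).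
Proof. by move=> c ac; exact: (@smooth_on_cst _ _ R^o). Qed.

Lemma smooth_funD f g : smooth_fun X f -> smooth_fun X g -> smooth_fun X (fun p => f p + g p).
Proof.
by move=> sf sg c ac; apply: (smooth_onD (codom_open ac) (sf _ ac) (sg _ ac)).
Qed.

Lemma smooth_funM f g : smooth_fun X f -> smooth_fun X g -> smooth_fun X (fun p => f p * g p).
Proof.
by move=> sf sg c ac; apply: (smooth_onM (codom_open ac) (sf _ ac) (sg _ ac)).
Qed.

Lemma smooth_funN f : smooth_fun X f -> smooth_fun X (fun p => - f p).
Proof. by move=> sf c ac; apply: (smooth_onN (codom_open ac) (sf _ ac)). Qed.

Lemma smooth_funB f g : smooth_fun X f -> smooth_fun X g -> smooth_fun X (fun p => f p - g p).
Proof. by move=> sf sg; apply: smooth_funD => //; exact: smooth_funN. Qed.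

Lemma smooth_funX f k : smooth_fun X f -> smooth_fun X (fun p => f p ^+ k).
Proof.
move=> sf; elim: k => [|k IH]; first by under eq_fun do rewrite expr0; exact: smooth_fun_cst.
by under eq_fun do rewrite exprS; exact: smooth_funM.
Qed.

Lemma smooth_fun_expR f : smooth_fun X f -> smooth_fun X (fun p => expR (f p)).
Proof. by move=> sf c ac; apply: (smooth_on_expR (codom_open ac) (sf _ ac)). Qed.

Lemma smooth_fun_ln f : smooth_fun X f -> (forall p, 0 < f p) -> smooth_fun X (fun p => ln (f p)).
Proof. by move=> sf f0 c ac; apply: (smooth_on_ln (codom_open ac) _ (sf _ ac)) => x _; exact: f0. Qed.

Lemma smooth_fun_inv f : smooth_fun X f -> (forall p, f p != 0) -> smooth_fun X (fun p => (f p)^-1).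
Proof. by move=> sf f0 c ac; apply: (smooth_on_inv (codom_open ac) _ (sf _ ac)) => x _; exact: f0. Qed.

Lemma smooth_fun_atan f : smooth_fun X f -> smooth_fun X (fun p => atan (f p)).
Proof. by move=> sf c ac; apply: (smooth_on_atan (codom_open ac) (sf _ ac)). Qed.

Lemma seminorm_bounded (i : seminorm_index n M) f : valid_index X i -> smooth_fun X f ->
  exists B, forall x, i.1.2 x -> `|iter_derive i.2 (f \o param i.1.1) x| <= B.
Proof.
move=> [ac cK KC] sf.
have [B [_ HB]] : bounded_set (iter_derive i.2 (f \o param i.1.1) @` i.1.2).
  apply: compact_bounded; apply: continuous_compact => //.
  apply: continuous_in_subspaceT => x /set_mem Kx.
  by apply: differentiable_continuous; apply: (sf _ ac); exact: KC.
exists (`|B| + 1) => x Kx.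
by apply: (HB (`|B| + 1)); [rewrite (le_lt_trans (ler_norm _)) // ltrDl | exists x].
Qed.

(** [sup] only bounds a set that has a supremum; compactness and the continuity of the iterated
    derivative provide it. *)
Lemma seminorm_ub (i : seminorm_index n M) f x : valid_index X i -> smooth_fun X f ->
  i.1.2 x -> `|iter_derive i.2 (f \o param i.1.1) x| <= cinf_seminorm i f.
Proof.
move=> vi sf Kx; apply: sup_upper_bound; last by exists x.
split; first by exists (`|iter_derive i.2 (f \o param i.1.1) x|), x.
by have [B HB] := seminorm_bounded vi sf; exists B => _ [y Ky <-]; exact: HB.
Qed.

Lemma seminorm_le (i : seminorm_index n M) f B : 0 <= B ->
  (forall x, i.1.2 x -> `|iter_derive i.2 (f \o param i.1.1) x| <= B) ->
  cinf_seminorm i f <= B.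
Proof.
move=> B0 HB; rewrite /cinf_seminorm; set S := image _ _.
have [->|/set0P S0] := eqVneq S set0; first by rewrite sup0.
by apply: ge_sup => // _ [x Kx <-]; exact: HB.
Qed.

(** An empty or unbounded set of values has the default supremum 0. *)
Lemma seminorm_ge0 (i : seminorm_index n M) f : 0 <= cinf_seminorm i f.
Proof.
rewrite /cinf_seminorm; set S := image _ _.
have [->|/set0P S0] := eqVneq S set0; first by rewrite sup0.
have [hs|/sup_out -> //] := pselect (has_sup S).
have [y Sy] := S0; apply: le_trans (_ : y <= _); last exact: sup_upper_bound.
by move: Sy => [x _ <-].
Qed.

Lemma finite_chart_cover : exists m (i : 'I_m -> seminorm_index n M),
  [/\ forall j, valid_index X (i j), forall j, (i j).2 = [::] &
      forall p, exists j x, (i j).1.2 x /\ param (i j).1.1 x = p].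
Proof.
pose Q (A : set M) := exists m (i : 'I_m -> seminorm_index n M),
  [/\ forall j, valid_index X (i j), forall j, (i j).2 = [::] &
      forall p, A p -> exists j x, (i j).1.2 x /\ param (i j).1.1 x = p].
suff [m [i [h1 h2 h3]]] : Q setT by exists m, i; split => // p; exact: h3.
apply: compact_induction (manifold_compact X) _ _ _ _.
- have f0 (j : 'I_0) : @seminorm_index R n M by case: j.
  by exists 0%N, f0; split => [[]|[]|].
- by move=> A B AB [m [i [h1 h2 h3]]]; exists m, i; split => // p /AB; exact: h3.
- move=> A B [m [i [h1 h2 h3]]] [m' [i' [h1' h2' h3']]].
  exists (m + m')%N, (fun j => match fintype.split j with inl a => i a | inr b => i' b end).
  split=> [j|j|p]; [by case: fintype.split | by case: fintype.split |].
  case=> [/h3 [j [x hx]]|/h3' [j [x hx]]].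
    by exists (lshift m' j), x; rewrite (unsplitK (inl j)).
  by exists (rshift m j), x; rewrite (unsplitK (inr j)).
- move=> p; have [c ac dp] := atlas_cover X p; pose x := coord c p.
  have cx : codom_of c x by exists p.
  have [r r0 rB] := nbhs_box (open_nbhs_nbhs (conj (codom_open ac) cx)).
  have r20 : 0 < r / 2 by rewrite divr_gt0.
  pose K : set E := [set z | forall i, `[x ord0 i - r / 2, x ord0 i + r / 2]%classic (z ord0 i)].
  have KC : K `<=` codom_of c.
    move=> z Kz; apply: rB => i; have := Kz i; rewrite /= in_itv /= -ler_distl => /le_lt_trans; apply.
    by rewrite ltr_pdivrMr // ltr_pMr // ltr1n.
  have cK : compact K.
    apply: (@rV_compact R _ (fun i => `[x ord0 i - r / 2, x ord0 i + r / 2]%classic)) => i.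
    exact: segment_compact.
  pose B : set E := (box x (r / 2))^°.
  exists (dom c `&` coord c @^-1` B); split.
  + by apply: (coord_preimage_open ac); exact: open_interior.
  + by split => //=; exact: box_nbhs.
  + exists 1%N, (fun=> (c, K, [::])); split => // q [dq Bq].
    exists ord0, (coord c q); split; last exact: (coordK ac dq).
    by move=> i; rewrite /= in_itv /= -ler_distl ltW //; exact: (interior_subset Bq).
Qed.

(** The compact cubes of a finite cover give seminorms of order zero whose sum dominates the uniform
    norm; this is how convergence in the C^oo topology becomes uniform convergence. *)
Lemma sup_norm_seminorm : exists m (i : 'I_m -> seminorm_index n M),
  (forall j, valid_index X (i j)) /\
  (forall f p, smooth_fun X f -> `|f p| <= \sum_j cinf_seminorm (i j) f).
Proof.
have [m [i [h1 h2 h3]]] := finite_chart_cover; exists m, i; split => // f p sf.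
have [j [x [Kx <-]]] := h3 p.
have := seminorm_ub (h1 j) sf Kx; rewrite h2 /= => /le_trans; apply.
by rewrite (bigD1 j) //= lerDl sumr_ge0 // => k _; exact: seminorm_ge0.
Qed.

End SmoothOnManifold.

Ltac smooth := repeat first [ match goal with
    | |- smooth_fun _ (fun _ => ?a) => exact: smooth_fun_cst
    | |- smooth_fun _ (fun p => - @?f p) => apply: smooth_funN
    | |- smooth_fun _ (fun p => @?f p - @?g p) => apply: smooth_funB
    | |- smooth_fun _ (fun p => @?f p + @?g p) => apply: smooth_funD
    | |- smooth_fun _ (fun p => @?f p * @?g p) => apply: smooth_funM
    | |- smooth_fun _ (fun p => @?f p ^+ ?k) => apply: smooth_funX
    | |- smooth_fun _ (fun p => expR (@?f p)) => apply: smooth_fun_expR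
    | |- smooth_fun _ (fun p => atan (@?f p)) => apply: smooth_fun_atan
    | H : smooth_fun _ ?f |- smooth_fun _ ?f => exact H
    end ].

(** * The sphere of half-densities *)

Section Sphere.
Context {R : realType} (n : nat) (M : ptopologicalType)
  (X : @closed_kahler R n M)
  (mu : {measure set (g_sigma_algebraType (@open M)) -> \bar R}).
Hypothesis hmu : is_kahler_volume X mu.
Local Notation VI := (vol_integral mu).
Local Notation V := (Vol mu).
Local Notation C := (calabi_space X mu).
Implicit Types (u : M -> R).
#[local] Opaque expR vol_integral.

(* The map u |-> exp (u / 2) sends the Calabi space into the sphere of radius
   sqrt Vol of L^2(M); [cosang] and [ang] are the cosine and the value of the
   spherical angle between the images. *)
Definition half_exp u : M -> R := fun p => expR (u p / 2).

Definition cosang u0 u1 : R := VI (fun p => expR ((u0 p + u1 p) / 2)) / V.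

Definition ang u0 u1 : R := acos (cosang u0 u1).

Lemma calabi_continuous u : C u -> continuous u.
Proof. by move=> [su _]; exact: (smooth_fun_continuous su). Qed.

Lemma half_expE u p : half_exp u p = expR (u p / 2).
Proof. by []. Qed.

Lemma half_exp_gt0 u p : 0 < half_exp u p.
Proof. exact: expR_gt0. Qed.

Lemma half_exp_continuous u : continuous u -> continuous (half_exp u).
Proof. by move=> cu; rewrite /half_exp; cont. Qed.

Lemma half_exp_sqr u p : half_exp u p ^+ 2 = expR (u p).
Proof. by rewrite -expRM_natl mulrC divfK. Qed.

Lemma half_expM u0 u1 p : half_exp u0 p * half_exp u1 p = expR ((u0 p + u1 p) / 2).
Proof. by rewrite -expRD -mulrDl. Qed.

Lemma half_exp_inj u0 u1 p : half_exp u0 p = half_exp u1 p -> u0 p = u1 p.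
Proof. by move=> /expR_inj /divIf; apply. Qed.

Lemma VI_half_exp_sqr u : C u -> VI (fun p => half_exp u p ^+ 2) = V.
Proof. by move=> [_ <-]; apply: eq_VI => p; rewrite half_exp_sqr. Qed.

Lemma VI_half_expM u0 u1 : VI (fun p => half_exp u0 p * half_exp u1 p) = V * cosang u0 u1.
Proof.
rewrite /cosang mulrC divfK ?gt_eqF ?(Vol_gt0 hmu) //.
by apply: eq_VI => p; rewrite half_expM.
Qed.

Lemma angE u0 u1 : ang u0 u1 = acos (cosang u0 u1).
Proof. by []. Qed.

Lemma cosangC u0 u1 : cosang u0 u1 = cosang u1 u0.
Proof. rewrite /cosang; have -> // : (fun p => expR ((u0 p + u1 p) / 2)) = (fun p => expR ((u1 p + u0 p) / 2)).
by apply/funext => p; rewrite addrC. Qed.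

Lemma cosang_gt0 u0 u1 : C u0 -> C u1 -> 0 < cosang u0 u1.
Proof.
move=> /calabi_continuous c0 /calabi_continuous c1.
rewrite divr_gt0 ?(Vol_gt0 hmu) //.
by apply: (VI_gt0 hmu (p := point)) => [|q|]; rewrite ?expR_ge0 ?expR_gt0 //; cont.
Qed.

#[local] Opaque half_exp.

(** The squared chord between two points of the sphere; both [cosang <= 1] and its equality case are
    read off from it. *)
Lemma VI_half_exp_sub_sqr u0 u1 : C u0 -> C u1 ->
  VI (fun p => (half_exp u0 p - half_exp u1 p) ^+ 2) = 2 * V * (1 - cosang u0 u1).
Proof.
move=> C0 C1; have c0 := half_exp_continuous (calabi_continuous C0).
have c1 := half_exp_continuous (calabi_continuous C1).
have -> : VI (fun p => (half_exp u0 p - half_exp u1 p) ^+ 2) =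
    1 * VI (fun p => half_exp u0 p ^+ 2) + 1 * VI (fun p => half_exp u1 p ^+ 2) +
    ((-2) * VI (fun p => half_exp u0 p * half_exp u1 p) + 0 * VI (fun p => half_exp u0 p * half_exp u1 p)).
  by rewrite (VI_lin4 hmu); try by cont; apply: eq_VI => p; ring.
by rewrite !VI_half_exp_sqr // VI_half_expM; ring.
Qed.

Lemma cosang_le1 u0 u1 : C u0 -> C u1 -> cosang u0 u1 <= 1.
Proof.
move=> C0 C1; have V0 := Vol_gt0 hmu.
have : 0 <= VI (fun p => (half_exp u0 p - half_exp u1 p) ^+ 2) by apply: VI_ge0 => p; exact: sqr_ge0.
by rewrite VI_half_exp_sub_sqr // pmulr_rge0 ?subr_ge0 // mulr_gt0.
Qed.

Lemma cosang_eq1 u0 u1 : C u0 -> C u1 -> cosang u0 u1 = 1 -> u0 = u1.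
Proof.
move=> C0 C1 e; have := VI_half_exp_sub_sqr C0 C1; rewrite e subrr mulr0 => I0.
have c0 := half_exp_continuous (calabi_continuous C0).
have c1 := half_exp_continuous (calabi_continuous C1).
apply/funext => p; apply: half_exp_inj; apply/eqP; rewrite -subr_eq0 -sqrf_eq0; apply/eqP.
apply: (VI_eq0 hmu _ _ I0) => [|q]; last exact: sqr_ge0.
by cont.
Qed.

Lemma cosangxx u : C u -> cosang u u = 1.
Proof.
move=> [_ Cu]; rewrite /cosang; have V0 := Vol_gt0 hmu.
rewrite (_ : VI _ = V) ?divff ?gt_eqF // -Cu; apply: eq_VI => p.
by rewrite -mulr2n -[_ *+ 2]mulr_natr mulfK.
Qed.

Lemma cosang_itv u0 u1 : C u0 -> C u1 -> -1 <= cosang u0 u1 <= 1.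
Proof.
move=> C0 C1; by rewrite cosang_le1 // andbT (le_trans _ (ltW (cosang_gt0 C0 C1))) // lerN10.
Qed.

Lemma cos_ang u0 u1 : C u0 -> C u1 -> cos (ang u0 u1) = cosang u0 u1.
Proof. by move=> C0 C1; rewrite acosK // in_itv /= cosang_itv. Qed.

Lemma angC u0 u1 : ang u0 u1 = ang u1 u0.
Proof. by rewrite /ang cosangC. Qed.

Lemma angxx u : C u -> ang u u = 0.
Proof. by move=> Cu; rewrite /ang cosangxx // acos1. Qed.

Lemma ang_itv u0 u1 : C u0 -> C u1 -> 0 <= ang u0 u1 < pi / 2.
Proof.
move=> C0 C1; have ci := cosang_itv C0 C1; have c0 := cosang_gt0 C0 C1.
have a0 : 0 <= ang u0 u1 by exact: acos_ge0.
have ap : ang u0 u1 <= pi by exact: acos_lepi.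
have pi0 : 0 < (pi : R) by exact: pi_gt0.
rewrite a0 /= -ltr_cos ?in_itv /= ?a0 ?ap ?cos_pihalf ?cos_ang //.
by apply/andP; split; lra.
Qed.

Lemma ang_gt0 u0 u1 : C u0 -> C u1 -> u0 <> u1 -> 0 < ang u0 u1.
Proof.
move=> C0 C1 ne; have /andP[a0 _] := ang_itv C0 C1.
rewrite lt_neqAle a0 andbT eq_sym; apply/eqP => e; apply: ne.
by apply: cosang_eq1 => //; rewrite -cos_ang // e cos0.
Qed.

#[local] Opaque cosang ang.

Lemma VI_gram a b c d u0 u1 u2 u3 : C u0 -> C u1 -> C u2 -> C u3 ->
  VI (fun p => (a * half_exp u0 p + b * half_exp u1 p) * (c * half_exp u2 p + d * half_exp u3 p)) =
  V * (a * c * cosang u0 u2 + a * d * cosang u0 u3 + (b * c * cosang u1 u2 + b * d * cosang u1 u3)).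
Proof.
move=> C0 C1 C2 C3.
have c0 := half_exp_continuous (calabi_continuous C0).
have c1 := half_exp_continuous (calabi_continuous C1).
have c2 := half_exp_continuous (calabi_continuous C2).
have c3 := half_exp_continuous (calabi_continuous C3).
have -> : VI (fun p => (a * half_exp u0 p + b * half_exp u1 p) * (c * half_exp u2 p + d * half_exp u3 p)) =
  (a * c) * VI (fun p => half_exp u0 p * half_exp u2 p) + (a * d) * VI (fun p => half_exp u0 p * half_exp u3 p)
  + ((b * c) * VI (fun p => half_exp u1 p * half_exp u2 p) + (b * d) * VI (fun p => half_exp u1 p * half_exp u3 p)).
  by rewrite (VI_lin4 hmu); try by cont; apply: eq_VI => p; ring.
rewrite !VI_half_expM.
by move: (cosang u0 u2) (cosang u0 u3) (cosang u1 u2) (cosang u1 u3) V => *; ring.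
Qed.

(** Cauchy-Schwarz for the components of the outer two points orthogonal to the middle one: their
    product is [V * (z - x * y)] and their squared norms are [V * (1 - x ^ 2)] and
    [V * (1 - y ^ 2)], which is the hypothesis of [spherical_triangle]. *)
Lemma ang_triangle u0 u1 u2 : C u0 -> C u1 -> C u2 -> ang u0 u2 <= ang u0 u1 + ang u1 u2.
Proof.
move=> C0 C1 C2; have V0 := Vol_gt0 hmu.
have c0 := half_exp_continuous (calabi_continuous C0).
have c1 := half_exp_continuous (calabi_continuous C1).
have c2 := half_exp_continuous (calabi_continuous C2).
apply: spherical_triangle; [exact: ang_itv | exact: ang_itv | exact: ang_itv |].
rewrite (cos_ang C0 C1) (cos_ang C1 C2) (cos_ang C0 C2).
move E01 : (cosang u0 u1) => x; move E12 : (cosang u1 u2) => y; move E02 : (cosang u0 u2) => z.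
have cF : continuous (fun p => 1 * half_exp u0 p + (- x) * half_exp u1 p) by cont.
have cG : continuous (fun p => 1 * half_exp u2 p + (- y) * half_exp u1 p) by cont.
have := VI_cauchy_schwarz hmu cF cG; rewrite VI_gram //.
have -> : VI (fun p => (1 * half_exp u0 p + (- x) * half_exp u1 p) ^+ 2) =
   V * (1 * 1 * cosang u0 u0 + 1 * (- x) * cosang u0 u1 + (- x * 1 * cosang u1 u0 + - x * - x * cosang u1 u1)).
  exact: VI_gram.
have -> : VI (fun p => (1 * half_exp u2 p + (- y) * half_exp u1 p) ^+ 2) =
   V * (1 * 1 * cosang u2 u2 + 1 * (- y) * cosang u2 u1 + (- y * 1 * cosang u1 u2 + - y * - y * cosang u1 u1)).
  exact: VI_gram.
rewrite !cosangxx // (cosangC u1 u0) (cosangC u2 u1) E01 E12 E02.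
move: V0; move: (V) => v v0.
have -> : (v * (1 * 1 * z + 1 * - y * x + (- x * 1 * y + - x * - y * 1))) ^+ 2 = v ^+ 2 * (z - x * y) ^+ 2 by ring.
have -> : v * (1 * 1 * 1 + 1 * - x * x + (- x * 1 * x + - x * - x * 1)) *
   (v * (1 * 1 * 1 + 1 * - y * y + (- y * 1 * y + - y * - y * 1))) = v ^+ 2 * ((1 - x ^+ 2) * (1 - y ^+ 2)) by ring.
by rewrite ler_pM2l ?exprn_gt0.
Qed.

End Sphere.

#[global] Opaque half_exp cosang ang Vol.

(** * Curves of functions and geodesics *)

Section UniformDerivative.
Context {R : realType}.
Implicit Types (I : set R) (f : R -> R) (a b t l : R).

(* Derivative at t within I of a curve of functions on P, uniformly on P. *)
Definition udiff (P : Type) I (F : R -> P -> R) (t : R) (L : P -> R) : Prop :=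
  (exists B, forall p, `|F t p| <= B /\ `|L p| <= B) /\
  forall e, 0 < e -> exists2 d, 0 < d &
    forall s, I s -> `|s - t| < d ->
    forall p, `|F s p - F t p - (s - t) * L p| <= e * `|s - t|.

(** [udiff] over a one-point set, so that the rules proved for [udiff] serve for scalar functions as
    well. *)
Definition wderiv I (f : R -> R) (t l : R) : Prop :=
  udiff I (fun s (_ : unit) => f s) t (fun=> l).

Lemma udiff_wderiv (P : Type) I (F : R -> P -> R) t L p :
  udiff I F t L -> wderiv I (F ^~ p) t (L p).
Proof.
move=> [[B HB] H]; split; first by exists B => _; exact: HB.
by move=> e /H[d d0 Hd]; exists d => // s Is st _; exact: Hd.
Qed.

Lemma wderivP I f t l : wderiv I f t l <->
  (forall e, 0 < e -> exists2 d, 0 < d &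
    forall s, I s -> `|s - t| < d -> `|f s - f t - (s - t) * l| <= e * `|s - t|).
Proof.
split=> [[_ H] e /H[d d0 Hd]|H]; first by exists d => // s Is st; exact: (Hd s Is st tt).
split; first by exists (`|f t| + `|l|) => _; split; rewrite ?lerDl ?lerDr.
by move=> e /H[d d0 Hd]; exists d => // s Is st _; exact: Hd.
Qed.

Lemma udiff_cst (P : Type) I (f : P -> R) t : (exists B, forall p, `|f p| <= B) ->
  udiff I (fun=> f) t (fun=> 0).
Proof.
move=> [B HB]; split; first by exists B => p; rewrite normr0; split => //; apply: le_trans (HB p).
by move=> e e0; exists 1 => // s _ _ p; rewrite subrr mulr0 subrr normr0 mulr_ge0 // ltW.
Qed.

Lemma udiffD (P : Type) I (F G : R -> P -> R) t L K :
  udiff I F t L -> udiff I G t K ->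
  udiff I (fun s p => F s p + G s p) t (fun p => L p + K p).
Proof.
move=> [[B HB] HF] [[B' HB'] HG]; split.
  exists (B + B') => p; have [h1 h2] := HB p; have [h3 h4] := HB' p.
  by split; apply: le_trans (ler_normD _ _) _; exact: lerD.
move=> e e0; have e2 : 0 < e / 2 by rewrite divr_gt0.
have [d d0 Hd] := HF _ e2; have [d' d'0 Hd'] := HG _ e2.
exists (Num.min d d') => [|s Is]; first by rewrite lt_min d0.
rewrite lt_min => /andP[/(Hd _ Is) h1 /(Hd' _ Is) h2] p.
have -> : F s p + G s p - (F t p + G t p) - (s - t) * (L p + K p) =
  (F s p - F t p - (s - t) * L p) + (G s p - G t p - (s - t) * K p) by ring.
apply: le_trans (ler_normD _ _) _.
have -> : e * `|s - t| = e / 2 * `|s - t| + e / 2 * `|s - t| by rewrite -mulrDl -splitr.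
exact: lerD.
Qed.

Lemma udiffM (P : Type) I (F G : R -> P -> R) t L K :
  udiff I F t L -> udiff I G t K ->
  udiff I (fun s p => F s p * G s p) t (fun p => L p * G t p + F t p * K p).
Proof.
move=> [[B0 HB0] HF] [[B' HB'] HG].
pose B := `|B0| + `|B'| + 1.
have B1 : 1 <= B by rewrite lerDr addr_ge0.
have bnd p : [/\ `|F t p| <= B, `|L p| <= B, `|G t p| <= B & `|K p| <= B].
  have [h1 h2] := HB0 p; have [h3 h4] := HB' p.
  have b0 := ler_norm B0; have b' := ler_norm B'.
  have n0 := normr_ge0 B0; have n' := normr_ge0 B'.
  rewrite /B; split; lra.
split.
  exists (2 * B ^+ 2) => p; have [h1 h2 h3 h4] := bnd p; split.
    rewrite normrM; apply: (@le_trans _ _ (B * B)); first exact: ler_pM.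
    by rewrite -expr2 ler_peMl ?sqr_ge0 // ler1n.
  apply: le_trans (ler_normD _ _) _; rewrite !normrM mulr_natl mulr2n expr2.
  by apply: lerD; exact: ler_pM.
move=> e e0.
pose e1 := Num.min 1 (e / (16 * B)).
have B0' : 0 < B by exact: lt_le_trans B1.
have e10 : 0 < e1 by rewrite lt_min ltr01 divr_gt0 // mulr_gt0.
have [d d0 Hd] := HF _ e10; have [d' d'0 Hd'] := HG _ e10.
pose d1 := Num.min 1 (e / (2 * B ^+ 2)).
have d10 : 0 < d1 by rewrite lt_min ltr01 divr_gt0 // mulr_gt0 // exprn_gt0.
exists (Num.min d (Num.min d' d1)) => [|s Is]; first by rewrite lt_min d0 lt_min d'0 d10.
rewrite !lt_min => /and3P[/(Hd _ Is) h1 /(Hd' _ Is) h2 hd] p.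
move: hd => /andP[/ltW s1 /ltW s2].
have {}h1 := h1 p; have {}h2 := h2 p; have [b1 b2 b3 b4] := bnd p.
move: h1 h2; set r := _ - _ - _ * L p; set r' := _ - _ - _ * K p => h1 h2.
(* The remainder splits into four parts, bounded by [e / 2], [e / 8], [e / 8] and [e / 16] times
   [|s - t|]; [d1] controls the quadratic part, [e1] those that contain [r] or [r']. *)
have -> : F s p * G s p - F t p * G t p - (s - t) * (L p * G t p + F t p * K p) =
  (s - t) * (s - t) * (L p * K p) + r * (G t p + (s - t) * K p) + r' * (F t p + (s - t) * L p) + r * r'.
  by rewrite /r /r'; ring.
move: s1 s2 h1 h2; set h := `|s - t| => s1 s2 h1 h2.
have h0 : 0 <= h by exact: normr_ge0.
have q1 : `|(s - t) * (s - t) * (L p * K p)| <= h * (e / 2).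
  rewrite !normrM -/h -mulrA ler_wpM2l //.
  apply: le_trans (_ : h * (B * B) <= _); first by rewrite ler_wpM2l //; exact: ler_pM.
  rewrite -expr2; move: s2; rewrite ler_pdivlMr ?mulr_gt0 ?exprn_gt0 // => s2.
  by rewrite ler_pdivlMr //; have -> : h * B ^+ 2 * 2 = h * (2 * B ^+ 2) by ring.
have aff (x y : R) : `|x| <= B -> `|y| <= B -> `|x + (s - t) * y| <= 2 * B.
  move=> hx hy; apply: le_trans (ler_normD _ _) _; rewrite mulr_natl mulr2n lerD // normrM -/h.
  by rewrite -[leRHS]mul1r ler_pM.
have e1h : e1 * h <= h * (e / (16 * B)) by rewrite mulrC ler_wpM2l // ge_min lexx orbT.
have e1h1 : e1 * h <= h by rewrite ler_piMl // ge_min lexx.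
have eB : h * (e / (16 * B)) * (2 * B) = h * (e / 8).
  have -> : (16 * B : R) = 8 * (2 * B) by ring.
  by field; rewrite gt_eqF.
have q2 (x y z : R) : `|z| <= e1 * h -> `|x| <= B -> `|y| <= B -> `|z * (x + (s - t) * y)| <= h * (e / 8).
  move=> hz hx hy; rewrite normrM -eB; apply: ler_pM => //; last exact: aff.
  exact: le_trans e1h.
have q3 : `|r * r'| <= h * (e / 16).
  rewrite normrM; apply: le_trans (_ : (e1 * h) * 1 <= _).
    apply: ler_pM => //; apply: le_trans h2 _; apply: le_trans e1h1 _; exact: s1.
  rewrite mulr1; apply: le_trans e1h _; rewrite ler_wpM2l //.
  by rewrite ler_wpM2l ?(ltW e0) // lef_pV2 ?posrE ?mulr_gt0 // ler_peMr.
have q2a := q2 _ _ _ h1 b3 b4; have q2b := q2 _ _ _ h2 b1 b2.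
apply: le_trans (ler_normD _ _) _; apply: le_trans (lerD (le_trans (ler_normD _ _) (lerD (le_trans (ler_normD _ _) (lerD q1 q2a)) q2b)) q3) _.
have -> : h * (e / 2) + h * (e / 8) + h * (e / 8) + h * (e / 16) = h * e * (13 / 16) by field.
by rewrite [leRHS]mulrC ler_piMr ?mulr_ge0 ?(ltW e0) //; lra.
Qed.

(** The hypothesis on [phi] is a second-order Taylor estimate uniform on bounded sets; since the
    values [F t p] are bounded in [p], one constant [K] serves for the whole family. *)
Lemma udiff_comp (P : Type) I (F : R -> P -> R) t L (phi phi' : R -> R) :
  (forall B, exists K, forall y d, `|y| <= B -> `|d| <= 1 ->
    [/\ `|phi (y + d) - phi y - d * phi' y| <= K * `|d| ^+ 2, `|phi y| <= K & `|phi' y| <= K]) ->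
  udiff I F t L -> udiff I (fun s p => phi (F s p)) t (fun p => phi' (F t p) * L p).
Proof.
move=> Hphi [[B0 HB0] HF]; pose B := `|B0| + 1.
have B1 : 1 <= B by rewrite lerDr.
have Bg0 : 0 < B by exact: lt_le_trans B1.
have bnd p : `|F t p| <= B /\ `|L p| <= B.
  have [h1 h2] := HB0 p; have b0 := ler_norm B0; rewrite /B; split; lra.
have [K0 HK0] := Hphi B; pose K := `|K0| + 1.
have K1 : 1 <= K by rewrite lerDr.
have Kg0 : 0 < K by exact: lt_le_trans K1.
have KK : K0 <= K by rewrite /K; have := ler_norm K0; lra.
have HK y d : `|y| <= B -> `|d| <= 1 ->
    [/\ `|phi (y + d) - phi y - d * phi' y| <= K * `|d| ^+ 2, `|phi y| <= K & `|phi' y| <= K].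
  move=> hy hd; have [h1 h2 h3] := HK0 _ _ hy hd; split.
  - by apply: le_trans h1 _; rewrite ler_wpM2r ?exprn_ge0.
  - exact: le_trans h2 _.
  - exact: le_trans h3 _.
split.
  exists (K * B) => p; have [h1 h2] := bnd p.
  have [_ k1 k2] := HK (F t p) 0 h1 ltac:(by rewrite normr0).
  split; last by rewrite normrM; exact: ler_pM.
  by rewrite -[leLHS]mulr1 ler_pM.
move=> e e0.
pose e1 := Num.min 1 (e / (2 * K)).
have e10 : 0 < e1 by rewrite lt_min ltr01 divr_gt0 // mulr_gt0.
have [d d0 Hd] := HF _ e10.
pose d1 := Num.min (B + 1)^-1 (e / (2 * K * (B + 1) ^+ 2)).
have BB0 : 0 < B + 1 by rewrite addr_gt0.
have d10 : 0 < d1 by rewrite lt_min invr_gt0 BB0 divr_gt0 // !mulr_gt0 // exprn_gt0.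
exists (Num.min d d1) => [|s Is]; first by rewrite lt_min d0.
rewrite !lt_min => /and3P[/(Hd _ Is) h1 /ltW s1 /ltW s2] p.
have {}h1 := h1 p; have [b1 b2] := bnd p.
set h := `|s - t| in s1 s2 h1 *; have h0 : 0 <= h by exact: normr_ge0.
set D := F s p - F t p; set r := D - (s - t) * L p.
have rh : `|r| <= e1 * h by exact: h1.
have rh1 : `|r| <= h by apply: le_trans rh _; rewrite ler_piMl // ge_min lexx.
have Dh : `|D| <= (B + 1) * h.
  have -> : D = (s - t) * L p + r by rewrite /r; ring.
  apply: le_trans (ler_normD _ _) _; rewrite [leRHS]mulrDl mul1r lerD // normrM -/h mulrC.
  exact: ler_wpM2r.
have D1 : `|D| <= 1.
  apply: le_trans Dh _; move: s1; rewrite -[X in _ <= X]mul1r ler_pdivlMr //.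
  by rewrite mulrC.
have [k1 _ k3] := HK _ _ b1 D1.
have -> : phi (F s p) - phi (F t p) - (s - t) * (phi' (F t p) * L p) =
  (phi (F t p + D) - phi (F t p) - D * phi' (F t p)) + r * phi' (F t p).
  have -> : F t p + D = F s p by rewrite /D addrC subrK.
  by rewrite /r; ring.
apply: le_trans (ler_normD _ _) _.
have q1 : K * `|D| ^+ 2 <= h * (e / 2).
  apply: le_trans (_ : K * ((B + 1) * h) ^+ 2 <= _).
    by rewrite ler_pM2l // ler_pXn2r // ?nnegrE // mulr_ge0 // ltW.
  have -> : K * ((B + 1) * h) ^+ 2 = h * (h * (K * (B + 1) ^+ 2)) by ring.
  rewrite ler_wpM2l // -ler_pdivlMr ?mulr_gt0 ?exprn_gt0 //.
  by move: s2; rewrite -[2 * K * _]mulrA invfM mulrA.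
have q2 : `|r * phi' (F t p)| <= h * (e / 2).
  rewrite normrM; apply: le_trans (ler_pM _ _ rh k3) _ => //.
  rewrite mulrAC mulrC ler_wpM2l // -ler_pdivlMr // ge_min; apply/orP; right.
  by rewrite invfM mulrA.
apply: le_trans (lerD (le_trans k1 q1) q2) _.
by rewrite -mulrDr -splitr mulrC.
Qed.

Lemma udiff_expR (P : Type) I (F : R -> P -> R) t L :
  udiff I F t L -> udiff I (fun s p => expR (F s p)) t (fun p => expR (F t p) * L p).
Proof.
apply: udiff_comp => B; exists (expR (B + 1)) => y d yB d1.
have yB' := le_trans (ler_norm y) yB.
have e1 : `|expR y| <= expR (B + 1) by rewrite ger0_norm ?expR_ge0 // ler_expR; lra.
split => //.
have := @taylor_bound R (fun=> expR) 2 (expR (B + 1)) y d (fun _ z _ => is_derive_expR z).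
rewrite !big_ord_recl big_ord0 /= expr0 mul1r fact0 divr1 addr0 expr1 (_ : (bump 0 0)`! = 1)%N // divr1.
rewrite opprD addrA => H; apply: le_trans (H _) _.
  move=> z zy; rewrite ger0_norm ?expR_ge0 // ler_expR.
  have : z - y <= 1 by apply: le_trans (ler_norm _) _; exact: le_trans zy d1.
  lra.
rewrite ler_pdivrMr ?ltr0n // ler_peMr ?mulr_ge0 ?expR_ge0 ?exprn_ge0 //.
by rewrite ler1n.
Qed.

(** At such points the punctured filter within [I] is proper, which makes the [lim] of
    [derive_within] meaningful and the derivative unique. *)
Definition accum I (t : R) := forall d, 0 < d -> exists s, [/\ I s, s != t & `|s - t| < d].

Lemma accum_proper I t : accum I t -> ProperFilter (within I t^').
Proof.
move=> aI; apply: Build_ProperFilter_ex => A.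
rewrite /within /= => /nbhs_ballP[d /= d0 Hd].
have [s [Is st sd]] := aI _ d0; exists s; apply: (Hd s) => //.
by rewrite /ball /= distrC.
Qed.

Lemma accum_itv a b t : a < b -> a <= t <= b -> accum `[a, b] t.
Proof.
move=> ab /andP[at_ tb] d d0.
have [tb'|bt] := ltP t b.
  pose h := Num.min (b - t) (d / 2).
  have h0 : 0 < h by rewrite lt_min subr_gt0 tb' divr_gt0.
  have hb : h <= b - t by rewrite ge_min lexx.
  have hd : h <= d / 2 by rewrite ge_min lexx orbT.
  exists (t + h); split; rewrite /= ?in_itv /=.
  - by apply/andP; split; lra.
  - by rewrite gt_eqF // ltrDl.
  - by rewrite addrC addKr gtr0_norm //; lra.
have tb' : t = b by apply/eqP; rewrite eq_le tb bt.
pose h := Num.min (b - a) (d / 2).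
have h0 : 0 < h by rewrite lt_min subr_gt0 ab divr_gt0.
have hb : h <= b - a by rewrite ge_min lexx.
have hd : h <= d / 2 by rewrite ge_min lexx orbT.
exists (t - h); split; rewrite /= ?in_itv /=.
- by rewrite tb'; apply/andP; split; lra.
- by rewrite lt_eqF // ltrBlDr ltrDl.
- by rewrite addrAC subrr add0r normrN gtr0_norm //; lra.
Qed.

Lemma accum_setT t : accum setT t.
Proof.
move=> d d0; exists (t + d / 2); split => //.
  by rewrite gt_eqF // ltrDl divr_gt0.
by rewrite addrC addKr gtr0_norm ?divr_gt0 //; lra.
Qed.

Lemma wderiv_cvg I f t l : wderiv I f t l ->
  (s - t)^-1 * (f s - f t) @[s --> within I t^'] --> l.
Proof.
move=> /wderivP H; apply/cvgrPdist_le => e e0; have [d d0 Hd] := H _ e0.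
rewrite !near_withinE; apply/nbhs_ballP; exists d => //= s sd st Is.
have st0 : s - t != 0 by rewrite subr_eq0.
have sd' : `|s - t| < d by rewrite distrC.
have := Hd s Is sd'.
rewrite -ler_pdivrMr ?normr_gt0 // -normfV -normrM => hs.
have -> : l - (s - t)^-1 * (f s - f t) = - ((f s - f t - (s - t) * l) / (s - t)) by field.
by rewrite normrN.
Qed.

Lemma wderiv_derive_within I f t l : accum I t -> wderiv I f t l -> derive_within I f t = l.
Proof.
move=> /accum_proper pI /wderiv_cvg H; exact: (@cvg_lim _ _ _ _ pI).
Qed.

Lemma wderiv_unique I f t l l' : accum I t -> wderiv I f t l -> wderiv I f t l' -> l = l'.
Proof. by move=> aI /(wderiv_derive_within aI) <- /(wderiv_derive_within aI) <-. Qed.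

Lemma wderiv_is_derive a b f t l : a < t < b -> wderiv `[a, b] f t l -> is_derive t 1 f l.
Proof.
move=> /andP[at_ tb] /wderivP H.
have cv : h^-1 *: (f (h *: 1 + t) - f t) @[h --> 0^'] --> l.
  apply/cvgrPdist_le => e e0; have [d d0 Hd] := H _ e0.
  near=> h.
  have h0 : h != 0 by near: h; exact: nbhs_dnbhs_neq.
  have hd : `|h| < d by near: h; exact: dnbhs0_lt.
  have hta : `|h| < t - a by near: h; apply: dnbhs0_lt; rewrite subr_gt0.
  have hbt : `|h| < b - t by near: h; apply: dnbhs0_lt; rewrite subr_gt0.
  have := Hd (h + t); rewrite addrK => /(_ _ hd).
  have Is : `[a, b]%classic (h + t).
    have n1 := ler_norm h; have n2 := ler_norm (- h); rewrite normrN in n2.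
    by rewrite /= in_itv /=; apply/andP; split; lra.
  move=> /(_ Is); rewrite -ler_pdivrMr ?normr_gt0 // -normfV -normrM => hs.
  rewrite [h *: 1]mulr1 /GRing.scale /=.
  have -> : l - h^-1 * (f (h + t) - f t) = - ((f (h + t) - f t - h * l) / h) by field.
  by rewrite normrN.
by split; [apply/cvg_ex; exists l | exact: cvg_lim].
Unshelve. all: by end_near. Qed.

Lemma is_derive_wderiv I (f : R -> R) (t l : R) : is_derive t 1 f l -> wderiv I f t l.
Proof.
move=> [df dl]; apply/wderivP => e e0.
have : h^-1 *: (f (h *: 1 + t) - f t) @[h --> 0^'] --> l by rewrite -dl; exact: df.
move=> /cvgrPdist_le /(_ _ e0) /nbhs_ballP[d /= d0 Hd].
exists d => // s _ sd; have [->|st] := eqVneq s t.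
  by rewrite !subrr mul0r subr0 normr0 mulr0.
have st0 : s - t != 0 by rewrite subr_eq0.
have := Hd (s - t); rewrite /ball /= sub0r normrN => /(_ sd st0).
rewrite [(s - t) *: 1]mulr1 subrK /GRing.scale /=.
have -> : l - (s - t)^-1 * (f s - f t) = - ((f s - f t - (s - t) * l) / (s - t)) by field.
by rewrite normrN normrM normfV ler_pdivrMr ?normr_gt0.
Qed.

Lemma wderiv_continuous a b f :
  (forall t, a <= t <= b -> exists l, wderiv `[a, b] f t l) ->
  {within `[a, b], continuous f}.
Proof.
move=> H; apply/subspace_continuousP => t; rewrite /= in_itv /= => tab.
have [l /wderivP Hl] := H _ tab; have [d d0 Hd] := Hl 1 ltr01.
apply/cvgrPdist_le => e e0; apply/nbhs_ballP.
have L0 : 0 < 1 + `|l| by rewrite ltr_pwDl.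
exists (Num.min d (e / (1 + `|l|))); first by rewrite /= lt_min d0 divr_gt0.
move=> s; rewrite /ball /= lt_min distrC => /andP[sd se] Is.
have := Hd s Is sd; rewrite mul1r => h; rewrite distrC.
have -> : f s - f t = (f s - f t - (s - t) * l) + (s - t) * l by rewrite subrK.
apply: le_trans (ler_normD _ _) _; rewrite normrM.
apply: le_trans (lerD h (lexx _)) _; rewrite -[X in X + _]mulr1 -mulrDr.
by rewrite -ler_pdivlMr // ltW.
Qed.

Lemma wderiv0_cst a b f : (forall t, a <= t <= b -> wderiv `[a, b] f t 0) ->
  forall t, a <= t <= b -> f t = f a.
Proof.
move=> H t /andP[at_ tb]; apply/eqP; rewrite -subr_eq0; apply/eqP.
have c0 : {within `[a, b], continuous f} by apply: wderiv_continuous => s sab; exists 0; exact: H.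
have c1 : {within `[a, t], continuous f}.
  apply: continuous_subspaceW c0 => s; rewrite /= !in_itv /= => /andP[-> st].
  exact: le_trans tb.
have [s|//|c _ ->] := @MVT_segment R f (fun=> 0) a t at_; last by rewrite mul0r.
rewrite in_itv /= => /andP[as_ st]; apply: (@wderiv_is_derive a b).
  by rewrite as_ (lt_le_trans st).
by apply: H; rewrite (ltW as_) (le_trans (ltW st)).
Qed.

Lemma wderiv_near I f g t l d : 0 < d -> I t ->
  (forall s, I s -> `|s - t| < d -> f s = g s) -> wderiv I f t l -> wderiv I g t l.
Proof.
move=> d0 It fg /wderivP H; apply/wderivP => e /H[d' d'0 Hd'].
exists (Num.min d d') => [|s Is]; first by rewrite lt_min d0.
rewrite lt_min => /andP[sd sd']; rewrite -!fg ?subrr ?normr0 //; exact: Hd'.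
Qed.

Lemma segment_derive_bound (f f' : R -> R) (s t l e : R) :
  (forall r, `|r - t| <= `|s - t| -> is_derive r 1 f (f' r)) ->
  (forall r, `|r - t| <= `|s - t| -> `|f' r - l| <= e) ->
  `|f s - f t - (s - t) * l| <= e * `|s - t|.
Proof.
move=> df f'l.
have key a b : a <= b -> (forall r, a <= r <= b -> `|r - t| <= `|s - t|) ->
    `|f b - f a - (b - a) * l| <= e * (b - a).
  move=> ab H.
  have [r|r|c] := @MVT_segment R f f' a b ab.
  - by rewrite in_itv /= => /andP[ar rb]; apply: df; apply: H; rewrite !ltW.
  - apply: derivable_within_continuous => {}r; rewrite in_itv /= => /H h.
    by have [] := df _ h.
  rewrite in_itv /= => /H h ->; rewrite [f' c * _]mulrC -mulrBr normrM mulrC [X in _ * X]ger0_norm ?subr_ge0 //.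
  by rewrite ler_wpM2r ?subr_ge0 //; exact: f'l.
have [ts|st] := leP t s.
  rewrite (ger0_norm (_ : 0 <= s - t)) ?subr_ge0 //; apply: key => // r /andP[tr rs].
  by rewrite !ger0_norm ?subr_ge0 // lerB.
rewrite (ltr0_norm (_ : s - t < 0)) ?subr_lt0 // opprB -normrN.
have -> : - (f s - f t - (s - t) * l) = f t - f s - (t - s) * l by ring.
apply: key; first exact: ltW.
move=> r /andP[sr rt]; have r0 : r - t <= 0 by rewrite subr_le0.
have s0 : s - t <= 0 by rewrite subr_le0 ltW.
by rewrite !ler0_norm // lerN2 lerB.
Qed.

End UniformDerivative.

(** * Smooth families of functions on the manifold *)

Section Families.
Context {R : realType} (n : nat) (M : ptopologicalType)
  (X : @closed_kahler R n M)
  (mu : {measure set (g_sigma_algebraType (@open M)) -> \bar R}).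
Hypothesis hmu : is_kahler_volume X mu.
Local Notation VI := (vol_integral mu).
Local Notation E := 'rV[R]_(n + n).
Local Notation coord := Defs.coord.
Implicit Types (I : set R) (U : R -> M -> R).

(** Differentiation under the integral: a remainder that is uniform in [p] integrates to at most
    [Vol mu] times its bound, whence [e / Vol mu]. *)
Lemma wderiv_VI I U t L : I t -> udiff I U t L ->
  (forall s, I s -> continuous (U s)) -> continuous L ->
  wderiv I (fun s => VI (U s)) t (VI L).
Proof.
move=> It [_ H] cU cL; apply/wderivP => e e0; have V0 := Vol_gt0 hmu.
have eV : 0 < e / Vol mu by rewrite divr_gt0.
have [d d0 Hd] := H _ eV; exists d => // s Is st.
have cs := cU _ Is; have ct := cU _ It.
have -> : VI (U s) - VI (U t) - (s - t) * VI L = VI (fun p => U s p - U t p - (s - t) * L p).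
  by rewrite (VIB hmu) ?(VIB hmu) ?(VIZ hmu) //; cont.
apply: le_trans (VI_bound hmu (B := e / Vol mu * `|s - t|) _ _) _; first by cont.
  by move=> p; exact: Hd.
by rewrite mulrAC divfK // gt_eqF.
Qed.

Definition smooth_family I U := forall c, atlas X c ->
  smooth_within [set z : R * E | I z.1 /\ codom_of c z.2] (fun z => U z.1 (param c z.2)).

Lemma partial_is_derive (g : R * E -> R) s y : differentiable g (s, y) ->
  is_derive s 1 (fun s => g (s, y)) ('D_(1, 0) g (s, y)).
Proof.
move=> dg; have := @diff_derivable _ _ _ g (s, y) (1, 0) dg; rewrite /derivable /derive.
have -> : (fun h => h^-1 *: ((g \o shift (s, y)) (h *: (1, 0)) - g (s, y))) =
   (fun h : R => h^-1 *: (((fun s => g (s, y)) \o shift s) (h *: 1) - g (s, y))) :> (R -> R).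
  apply/funext => h /=; congr (_ *: (g _ - _)).
  by congr pair; rewrite /= scaler0 add0r.
by move=> dv; split.
Qed.

(** A smooth family has local smooth extensions [g] beyond [I], but its velocity is computed from
    points of [I] alone; since these accumulate at the time considered, it is the partial derivative
    of any extension. *)
Lemma family_velocity I U c (N : set (R * E)) (g : R * E -> R) :
  (forall t, I t -> accum I t) ->
  open N -> smooth_on N g ->
  (forall z, N z -> I z.1 -> codom_of c z.2 -> g z = U z.1 (param c z.2)) ->
  forall z, N z -> I z.1 -> codom_of c z.2 ->
  velocity I U z.1 (param c z.2) = 'D_(1, 0) g z.
Proof.
move=> aI oN sg gU [s y] Nz /= Is cy.
have := open_nbhs_nbhs (conj oN Nz) => /nbhs_ballP[r /= r0 rN].
apply: wderiv_derive_within; first exact: aI.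
apply: (@wderiv_near _ _ (fun s => g (s, y)) _ _ _ r) => //.
  move=> s' Is' ss; apply: gU => //; apply: rN; split; last exact: ballxx.
  by rewrite /ball /= distrC.
by apply: is_derive_wderiv; apply: partial_is_derive; apply: (sg [::]).
Qed.

Lemma smooth_family_velocity I U : (forall t, I t -> accum I t) ->
  smooth_family I U -> smooth_family I (velocity I U).
Proof.
move=> aI sU c ac z Sz; have [N [g [oN Nz sg gU]]] := sU c ac z Sz.
exists N, ('D_(1, 0) g); split => //; first exact: smooth_on_derive.
move=> y Ny [Iy cy]; rewrite (family_velocity (U := U) (c := c) aI oN sg) //.
by move=> y' Ny' Iy' cy'; exact: gU.
Qed.

Lemma smooth_family_continuous I U t : smooth_family I U -> I t -> continuous (U t).
Proof.
move=> sU It p; have [c ac dp] := atlas_cover X p; pose x := coord c p.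
have cx : codom_of c x by exists p.
have [N [g [oN Nz sg gU]]] := sU c ac (t, x) (conj It cx).
have cg : {for (t, x), continuous g} by exact: smooth_on_continuous sg Nz.
have := open_nbhs_nbhs (conj oN Nz) => /nbhs_ballP[r /= r0 rN].
have cc := chart_continuous ac dp.
have pE : param c x = p by exact: (coordK ac dp).
have c1 : {for p, continuous (fun q => (t, coord c q) : R * E)}.
  by move=> A HA; exact: (cvg_pair (cvg_cst t) cc HA).
have c2 : {for p, continuous (g \o (fun q => (t, coord c q)))} by exact: continuous_comp c1 cg.
have near_eq : \forall q \near p, (g \o (fun q => (t, coord c q))) q = U t q.
  have n1 := open_nbhs_nbhs (conj (chart_open ac) dp).
  have n2 : \forall q \near p, ball x r (coord c q) by apply: cc; exact: nbhsx_ballx.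
  near=> q; rewrite /= gU ?(coordK ac) //; try by near: q.
    by apply: rN; split; [exact: ballxx | near: q].
  by split => //; exists q => //; near: q.
rewrite /continuous_at -(nbhs_singleton near_eq); apply: cvg_trans c2.
by apply: near_eq_cvg; apply: filterS near_eq => q ->.
Unshelve. all: by end_near. Qed.

(** Near each point the mean value theorem and the continuity of the time derivative of a local
    extension bound the remainder; compactness of [M] makes the neighbourhood of [t] common to all
    points. *)
Lemma smooth_family_udiff I U t : (forall t, I t -> accum I t) ->
  smooth_family I U -> I t -> udiff I U t (velocity I U t).
Proof.
move=> aI sU It.
have sW := smooth_family_velocity aI sU.
split.
  have [B _ HB] := continuous_bounded X (smooth_family_continuous sU It).
  have [B' _ HB'] := continuous_bounded X (smooth_family_continuous sW It).
  exists (Num.max B B') => p; rewrite !le_max HB HB' orbT //.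
move=> e e0.
have cM := manifold_compact X.
pose P s q := `|U s q - U t q - (s - t) * velocity I U t q| <= e * `|s - t|.
suff : \forall s \near within I (nbhs t), [set: M] `<=` P s.
  rewrite near_withinE => /nbhs_ballP[d /= d0 Hd]; exists d => // s Is sd p.
  by apply: (Hd s) => //; rewrite /ball /= distrC.
move: cM => /compact_near_coveringP; apply => p _.
have [c ac dp] := atlas_cover X p; pose x := coord c p.
have cx : codom_of c x by exists p.
have [N [g [oN Nz sg gU]]] := sU c ac (t, x) (conj It cx).
have cg : {for (t, x), continuous ('D_(1, 0) g)}.
  exact: smooth_on_continuous (smooth_on_derive _ sg) Nz.
have e2 : 0 < e / 2 by rewrite divr_gt0.
have n1 : \forall z \near (t, x), `|'D_(1, 0) g (t, x) - 'D_(1, 0) g z| < e / 2.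
  by move: cg => /cvgrPdist_lt /(_ _ e2).
have nN : nbhs ((t, x) : R * E) (N `&` [set z | `|'D_(1, 0) g (t, x) - 'D_(1, 0) g z| < e / 2]).
  by apply: filterI => //; exact: open_nbhs_nbhs.
move: nN => /nbhs_ballP[r /= r0 rN].
have cc := chart_continuous ac dp.
exists ([set q | dom c q /\ ball x r (coord c q)], [set s | I s /\ ball t r s]) => /=.
  split; last by apply: filterI; [exact: withinT | apply: cvg_within; exact: nbhsx_ballx].
  by apply: filterI; [exact: open_nbhs_nbhs (conj (chart_open ac) dp) | apply: cc; exact: nbhsx_ballx].
move=> [q s] /= [[dq bq] [Is bs]]; rewrite /P.
pose y := coord c q; have cy : codom_of c y by exists q.
have pq : param c y = q by exact: (coordK ac dq).
have inN s' : `|s' - t| <= `|s - t| -> N (s', y) /\ `|'D_(1, 0) g (t, x) - 'D_(1, 0) g (s', y)| < e / 2.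
  move=> ss; apply: rN; split => //=; rewrite /ball /= distrC; apply: le_lt_trans ss _.
  by rewrite distrC.
have nt : `|t - t| <= `|s - t| by rewrite subrr normr0.
have [Nty Lty] := inN _ nt; have [Nsy Lsy] := inN _ (lexx _).
have vE : velocity I U t q = 'D_(1, 0) g (t, y).
  by rewrite -pq -(family_velocity (U := U) (c := c) aI oN sg) // => z' Nz' Iz' cz'; exact: gU.
have UE s' : I s' -> N (s', y) -> U s' q = g (s', y).
  by move=> Is' Ns'; rewrite gU //= pq.
rewrite vE !UE //.
apply: (@segment_derive_bound _ (fun s => g (s, y)) (fun s => 'D_(1, 0) g (s, y))) => s' /inN[Ns' Ls'].
  by apply: partial_is_derive; exact: (sg [::]).
have -> : 'D_(1, 0) g (s', y) - 'D_(1, 0) g (t, y) =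
  ('D_(1, 0) g (t, x) - 'D_(1, 0) g (t, y)) - ('D_(1, 0) g (t, x) - 'D_(1, 0) g (s', y)) by ring.
apply: le_trans (ler_normB _ _) _; rewrite [e]splitr; apply: lerD; exact: ltW.
Qed.

End Families.

(** * Geodesics run along great circles *)

Section Geodesics.
Context {R : realType} (n : nat) (M : ptopologicalType)
  (X : @closed_kahler R n M)
  (mu : {measure set (g_sigma_algebraType (@open M)) -> \bar R}).
Hypothesis hmu : is_kahler_volume X mu.
Local Notation VI := (vol_integral mu).
Local Notation V := (Vol mu).
Local Notation C := (calabi_space X mu).
#[local] Opaque expR vol_integral cos sin.

Lemma wderivD I (f g : R -> R) t l k : wderiv I f t l -> wderiv I g t k ->
  wderiv I (fun s => f s + g s) t (l + k).
Proof. exact: udiffD. Qed.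

Lemma wderivM I (f g : R -> R) t l k : wderiv I f t l -> wderiv I g t k ->
  wderiv I (fun s => f s * g s) t (l * g t + f t * k).
Proof. exact: udiffM. Qed.

Lemma wderiv_cst I (c t : R) : wderiv I (fun=> c) t 0.
Proof. by apply: udiff_cst; exists `|c|. Qed.

Lemma wderivZ I (c : R) (f : R -> R) t l : wderiv I f t l -> wderiv I (fun s => c * f s) t (c * l).
Proof.
by move=> df; have := wderivM (wderiv_cst I c t) df; rewrite mul0r add0r.
Qed.

Lemma is_derive_phase (om a t : R) : is_derive t 1 (fun s => om * (s - a)) om.
Proof.
have := is_derive_affine (- (om * a)) om t.
have -> // : (cst (- (om * a)) + om *: id : R -> R) = (fun s => om * (s - a)).
by apply/funext => s; rewrite !fctE /= mulrBr addrC.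
Qed.

Lemma is_derive_cos_phase (om a t : R) :
  is_derive t 1 (fun s => cos (om * (s - a))) (- (om * sin (om * (t - a)))).
Proof.
have h := @is_derive1_comp _ (@cos R) _ _ _ _ (is_derive_cos _) (is_derive_phase om a t).
by apply: (@is_derive_eq _ _ _ _ _ _ _ _ h); rewrite mulNr mulrC.
Qed.

Lemma is_derive_sin_phase (om a t : R) :
  is_derive t 1 (fun s => sin (om * (s - a))) (om * cos (om * (t - a))).
Proof.
have h := @is_derive1_comp _ (@sin R) _ _ _ _ (is_derive_sin _) (is_derive_phase om a t).
by apply: (@is_derive_eq _ _ _ _ _ _ _ _ h); rewrite mulrC.
Qed.

(* Solutions of the oscillator equation, by variation of constants. *)
Lemma oscillator (a b om : R) (f g : R -> R) : om != 0 ->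
  (forall t, a <= t <= b -> wderiv `[a, b] f t (g t)) ->
  (forall t, a <= t <= b -> wderiv `[a, b] g t (- om ^+ 2 * f t)) ->
  forall t, a <= t <= b -> f t = f a * cos (om * (t - a)) + g a / om * sin (om * (t - a)).
Proof.
move=> om0 df dg.
pose c s := cos (om * (s - a)); pose d s := sin (om * (s - a)).
have dc t : wderiv `[a, b] c t (- (om * d t)) by apply: is_derive_wderiv; exact: is_derive_cos_phase.
have dd t : wderiv `[a, b] d t (om * c t) by apply: is_derive_wderiv; exact: is_derive_sin_phase.
(* The point [(f, g / om)] turned back by the phase: its two coordinates [A] and [B] have derivative
   zero. *)
pose A s := f s * c s + (- om^-1) * (g s * d s); pose B s := f s * d s + om^-1 * (g s * c s).
have A0 t : a <= t <= b -> A t = A a.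
  apply: wderiv0_cst => {}t tab.
  have := wderivD (wderivM (df _ tab) (dc t)) (wderivZ (- om^-1) (wderivM (dg _ tab) (dd t))).
  by rewrite (_ : _ + _ = 0) //; field.
have B0 t : a <= t <= b -> B t = B a.
  apply: wderiv0_cst => {}t tab.
  have := wderivD (wderivM (df _ tab) (dd t)) (wderivZ om^-1 (wderivM (dg _ tab) (dc t))).
  by rewrite (_ : _ + _ = 0) //; field.
move=> t tab.
have cd : c t ^+ 2 + d t ^+ 2 = 1 by rewrite cos2Dsin2.
have ca : c a = 1 by rewrite /c subrr mulr0 cos0.
have da : d a = 0 by rewrite /d subrr mulr0 sin0.
have eA := A0 _ tab; have eB := B0 _ tab.
rewrite /A /B ca da !mulr0 !mulr1 addr0 add0r in eA eB.
rewrite -/(c t) -/(d t) -[LHS]mulr1 -cd -eA [g a / om]mulrC -eB; ring.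
Qed.

Section Geodesic.
Variables (a b : R) (u : R -> M -> R).
Hypothesis ab : a < b.
Hypothesis gu : geodesic X mu `[a, b] u.
Let I : set R := `[a, b]%classic.
Let w := velocity I u.

Let inI t : I t = (a <= t <= b).
Proof. by rewrite /I /= in_itv. Qed.

Let aI t : I t -> accum I t.
Proof. by rewrite inI; exact: accum_itv. Qed.

Let Cu t : I t -> C (u t).
Proof. by move: gu => [[h _] _]; exact: h. Qed.

Let sU : smooth_family X I u.
Proof. by move: gu => [[_ h] _]. Qed.

Let sW : smooth_family X I w.
Proof. exact: smooth_family_velocity. Qed.

Let cu t : I t -> continuous (u t).
Proof. exact: (smooth_family_continuous sU). Qed.

Let cw t : I t -> continuous (w t).
Proof. exact: (smooth_family_continuous sW). Qed.

Let du t : I t -> udiff I u t (w t).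
Proof. exact: (smooth_family_udiff aI sU). Qed.

Let dw t : I t -> udiff I w t (velocity I w t).
Proof. exact: (smooth_family_udiff aI sW). Qed.

Let cw' t : I t -> continuous (velocity I w t).
Proof. exact: (smooth_family_continuous (smooth_family_velocity aI sW)). Qed.

Let e t := VI (fun p => w t p * w t p * expR (u t p)).

Let geq t p : I t -> velocity I w t p + 2^-1 * (w t p * w t p) = - ((2 * V)^-1 * e t).
Proof. by move: gu => [_ H] /(H t p) /eqP; rewrite addr_eq0 => /eqP. Qed.

Let tangent t : I t -> VI (fun p => expR (u t p) * w t p) = 0.
Proof.
move=> It; have ct := cu It; have cwt := cw It.
have h : wderiv I (fun s => VI (fun p => expR (u s p))) t (VI (fun p => expR (u t p) * w t p)).
  apply: (wderiv_VI hmu It (udiff_expR (du It))); last by cont.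
  by move=> s Is; have cs := cu Is; cont.
apply: wderiv_unique (aI It) h _.
apply: (@wderiv_near _ _ (fun=> V) _ _ _ 1) => //; last exact: wderiv_cst.
by move=> s Is _; case: (Cu Is).
Qed.

(** The derivative of the energy is the integral of [(2 w w' + w ^ 3) e^u]; the geodesic equation
    turns it into [- e / V] times the integral of [w e^u], which vanishes by [tangent]. The integral
    term of the equation is thereby the same constant at all times and points. *)
Let energy_cst t : I t -> e t = e a.
Proof.
rewrite inI; apply: wderiv0_cst => {}t; rewrite -inI => It.
have ct := cu It; have cwt := cw It; have cwt' := cw' It.
have h := wderiv_VI hmu It (udiffM (udiffM (dw It) (dw It)) (udiff_expR (du It))).
have {}h : wderiv I e t _ := h ltac:(by move=> s Is; have cs := cu Is; have cws := cw Is; cont) ltac:(by cont).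
move: h; rewrite (_ : VI _ = 0) // -[RHS](mulr0 (- (e t / V))) -(tangent It) -(VIZ hmu); last by cont.
apply: eq_VI => p; have := geq p It; move: (velocity I w t p) => x gx.
have -> : x = - ((2 * V)^-1 * e t) - 2^-1 * (w t p * w t p) by rewrite -gx addrK.
by field; rewrite gt_eqF // (Vol_gt0 hmu).
Qed.

(** The derivative of the half-density has squared norm [e a / 4], and angular speed [om] on the
    sphere of squared radius [V] makes it [om ^ 2 * V]. *)
Let om := Num.sqrt (e a / (4 * V)).

Let V0 : 0 < V.
Proof. exact: Vol_gt0 hmu. Qed.

Let e0 t : 0 <= e t.
Proof. by apply: VI_ge0 => p; rewrite mulr_ge0 ?expR_ge0 // -expr2 sqr_ge0. Qed.

Let om2 : om ^+ 2 = e a / (4 * V).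
Proof. by rewrite sqr_sqrtr // divr_ge0 // mulr_ge0 // ltW. Qed.

Let Ia : I a.
Proof. by rewrite inI lexx ltW. Qed.

Let Ib : I b.
Proof. by rewrite inI lexx ltW. Qed.

Let f t p := half_exp (u t) p.
Let g t p := 2^-1 * (w t p * f t p).

Let df t p : I t -> wderiv I (f ^~ p) t (g t p).
Proof.
move=> It; have h := udiff_wderiv p (du It).
have h1 := udiff_expR (wderivZ 2^-1 h).
have -> : f ^~ p = (fun s => expR (2^-1 * u s p)).
  by apply/funext => s; rewrite /f half_expE mulrC.
have -> // : g t p = expR (2^-1 * u t p) * (2^-1 * w t p).
by rewrite /g /f half_expE [u t p / 2]mulrC; ring.
Qed.

Let dg t p : I t -> wderiv I (g ^~ p) t (- om ^+ 2 * f t p).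
Proof.
move=> It; have h := wderivZ 2^-1 (wderivM (udiff_wderiv p (dw It)) (df p It)).
rewrite (_ : - _ * _ = 2^-1 * (velocity I w t p * f t p + w t p * g t p)) //.
have := geq p It; rewrite (energy_cst It) om2 /g => hh.
have -> : 2^-1 * (velocity I w t p * f t p + w t p * (2^-1 * (w t p * f t p))) =
  2^-1 * f t p * (velocity I w t p + 2^-1 * (w t p * w t p)) by ring.
by rewrite hh; field; rewrite gt_eqF.
Qed.

(** Zero speed is treated apart, since the oscillator solution divides by [om]. *)
Let stationary : om = 0 -> forall t, I t -> u t = u a.
Proof.
move=> om_0; have ea0 : e a = 0.
  by move: om2; rewrite om_0 expr0n /= => /esym/eqP; rewrite mulf_eq0 invr_eq0 mulf_eq0
    [V == 0]gt_eqF // orbF pnatr_eq0 orbF => /eqP.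
have w0 t p : I t -> w t p = 0.
  move=> It; have := energy_cst It; rewrite ea0 => et.
  have ct := cu It; have cwt := cw It.
  have := VI_eq0 hmu _ _ et p => /(_ ltac:(by cont)).
  move=> /(_ (fun q => mulr_ge0 (sqr_ge0 (w t q)) (expR_ge0 _))) /eqP.
  by rewrite !mulf_eq0 orbb [expR _ == 0]gt_eqF ?expR_gt0 // orbF => /eqP.
move=> t It; apply/funext => p.
apply: (@wderiv0_cst _ a b (u ^~ p)); last by rewrite -inI.
move=> s; rewrite -inI => Is; have := udiff_wderiv p (du Is).
by rewrite w0.
Qed.

Let fsol t p : om != 0 -> I t ->
  f t p = f a p * cos (om * (t - a)) + g a p / om * sin (om * (t - a)).
Proof.
rewrite inI => om0; apply: (@oscillator a b om (f ^~ p) (g ^~ p)) => // s; rewrite -inI => Is.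
  exact: df.
exact: dg.
Qed.

(** The oscillator solution is integrated against its initial value: the sine term drops out because
    the initial velocity is tangent to the sphere. *)
Let cosang_geodesic t : I t -> cosang mu (u a) (u t) = cos (om * (t - a)).
Proof.
move=> It; have [om_0|om0] := eqVneq om 0.
  by rewrite (stationary om_0 It) (cosangxx hmu (Cu Ia)) om_0 mul0r cos0.
have cfa : continuous (f a) by apply: half_exp_continuous; exact: cu.
have cwa := cw Ia.
have cga : continuous (g a) by rewrite /g; cont.
apply: (mulfI (negbT (gt_eqF V0))); rewrite -(VI_half_expM hmu).
have -> : VI (fun p => half_exp (u a) p * half_exp (u t) p) =
   cos (om * (t - a)) * VI (fun p => half_exp (u a) p ^+ 2) +
   sin (om * (t - a)) / om * VI (fun p => half_exp (u a) p * g a p).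
  rewrite (VI_lin2 hmu); [apply: eq_VI => p | by cont | by cont].
  by rewrite -/(f t p) (fsol p om0 It) /f; ring.
rewrite (VI_half_exp_sqr (Cu Ia)).
have -> : VI (fun p => half_exp (u a) p * g a p) = 0.
  rewrite -[RHS](mulr0 2^-1) -(tangent Ia) -(VIZ hmu); last by have cua := cu Ia; cont.
  by apply: eq_VI => p; rewrite /g /f -half_exp_sqr; ring.
by rewrite mulr0 addr0 mulrC.
Qed.

Let om_ge0 : 0 <= om.
Proof. exact: sqrtr_ge0. Qed.

(** Otherwise the geodesic would reach the phase [pi / 2], where its half-density is orthogonal to
    the initial one although both are positive. This excludes longer arcs of the same great circle
    and lets [acos] recover the phase. *)
Let om_small : om * (b - a) < pi / 2.
Proof.
rewrite ltNge; apply/negP => h.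
have pi0 : 0 < (pi : R) by exact: pi_gt0.
have om0 : 0 < om.
  rewrite lt_neqAle om_ge0 andbT eq_sym; apply/eqP => z.
  by move: h; rewrite z mul0r; lra.
pose t := a + pi / 2 / om.
have It : I t.
  rewrite inI /t lerDl divr_ge0 ?divr_ge0 ?(ltW pi0) //=.
  by rewrite -lerBrDl ler_pdivrMr // [_ * om]mulrC.
have := cosang_geodesic It.
have -> : om * (t - a) = pi / 2 by rewrite /t; field; rewrite gt_eqF.
rewrite cos_pihalf => z.
by have := cosang_gt0 hmu (Cu Ia) (Cu It); rewrite z ltxx.
Qed.

Let om_ang : om * (b - a) = ang mu (u a) (u b).
Proof.
have h0 : 0 <= om * (b - a) by rewrite mulr_ge0 // subr_ge0 ltW.
have pi0 : 0 < (pi : R) by exact: pi_gt0.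
by rewrite angE (cosang_geodesic Ib) cosK // in_itv /= h0 /= (le_trans (ltW om_small)) //; lra.
Qed.

(** The formula is multiplied out by [sin (om * (b - a))], so that it also holds at [om = 0]; for
    distinct endpoints this sine is positive and the formula determines the whole curve. *)
Lemma geodesic_form : exists om, [/\ 0 <= om, om * (b - a) = ang mu (u a) (u b),
  om = 0 -> forall t, a <= t <= b -> u t = u a,
  path_length mu a b u = 2 * Num.sqrt V * ang mu (u a) (u b) &
  forall t p, a <= t <= b -> sin (om * (b - a)) * half_exp (u t) p =
    half_exp (u a) p * sin (om * (b - t)) + half_exp (u b) p * sin (om * (t - a))].
Proof.
exists om; split => //.

- have sE t : I t -> Num.sqrt (calabi_metric mu (u t) (w t) (w t)) = 2 * Num.sqrt V * om.
    move=> It; rewrite -[calabi_metric _ _ _ _]/(e t) energy_cst //.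
    have -> : e a = 4 * V * om ^+ 2 by rewrite om2 mulrC divfK // gt_eqF // mulr_gt0.
    rewrite sqrtrM ?mulr_ge0 ?(ltW V0) // sqrtr_sqr ger0_norm // sqrtrM //.
    by rewrite (_ : 4 = 2 ^+ 2) ?sqrtr_sqr ?ger0_norm //; ring.
  rewrite /path_length (@eq_Rintegral _ _ _ _ _ (fun=> 2 * Num.sqrt V * om)); last first.
    by move=> t /set_mem It; exact: sE.
  rewrite Rintegral_cst //= lebesgue_measure_itv /= lte_fin ab /= -om_ang; ring.
- move=> t p; rewrite -inI => It; have [om_0|om0] := eqVneq om 0.
    by rewrite om_0 !mul0r sin0 !mulr0 addr0 mul0r.
  have := fsol p om0 It; have := fsol p om0 Ib; rewrite /f => -> ->.
  have -> : om * (b - t) = om * (b - a) - om * (t - a) by ring.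
  by rewrite sinB; ring.
Qed.

End Geodesic.
End Geodesics.

Section ProductSmoothness.
Context {R : realType} {V W : normedModType R}.

Lemma fst_continuous_linear : exists L : {linear (V * W)%type -> V}, continuous L /\ forall z, L z = z.1.
Proof.
have lf : linear (fst : V * W -> V) by [].
pose LM := GRing.isLinear.Build _ _ _ _ (fst : V * W -> V) lf.
pose L : {linear (V * W)%type -> V} := HB.pack (fst : V * W -> V) LM.
by exists L; split => // z; exact: cvg_fst.
Qed.

Lemma snd_continuous_linear : exists L : {linear (V * W)%type -> W}, continuous L /\ forall z, L z = z.2.
Proof.
have lf : linear (snd : V * W -> W) by [].
pose LM := GRing.isLinear.Build _ _ _ _ (snd : V * W -> W) lf.
pose L : {linear (V * W)%type -> W} := HB.pack (snd : V * W -> W) LM.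
by exists L; split => // z; exact: cvg_snd.
Qed.

Lemma open_snd (U : set W) : open U -> open [set z : V * W | U z.2].
Proof.
move=> oU; apply: (open_comp (f := snd)) => // z _; exact: cvg_snd.
Qed.

Lemma open_fst (U : set V) : open U -> open [set z : V * W | U z.1].
Proof.
move=> oU; apply: (open_comp (f := fst)) => // z _; exact: cvg_fst.
Qed.

Lemma smooth_on_snd (U : set W) (f : W -> R) : open U -> smooth_on U f ->
  smooth_on [set z : V * W | U z.2] (fun z => f z.2).
Proof.
move=> oU sf; have [L [cL LE]] := snd_continuous_linear.
have -> : (fun z : V * W => f z.2) = f \o L by apply/funext => z; rewrite /= LE.
by apply: smooth_on_precomp sf => // [|z]; [exact: open_snd | rewrite LE].
Qed.

Lemma smooth_on_fst (U : set V) (f : V -> R) : open U -> smooth_on U f ->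
  smooth_on [set z : V * W | U z.1] (fun z => f z.1).
Proof.
move=> oU sf; have [L [cL LE]] := fst_continuous_linear.
have -> : (fun z : V * W => f z.1) = f \o L by apply/funext => z; rewrite /= LE.
by apply: smooth_on_precomp sf => // [|z]; [exact: open_fst | rewrite LE].
Qed.

Lemma smooth_on_id (U : set R) : smooth_on U (id : R -> R).
Proof.
apply/smooth_onP => -[|k]; first by apply/Ck0 => x _; exact: ex_diff.
apply/CkS; split=> [x _|v]; first exact: ex_diff.
have -> : 'D_v (id : R -> R) = cst v by apply/funext => x; rewrite derive_id.
exact: (@Ck_cst _ _ R^o).
Qed.

Lemma smooth_on_open_gt0 (U : set V) (g : V -> R) : open U -> smooth_on U g ->
  open (U `&` [set x | 0 < g x]).
Proof.
move=> oU sg; rewrite openE => x [Ux gx].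
have cg := smooth_on_continuous sg Ux.
apply: filterI; first exact: open_nbhs_nbhs.
by apply: (cvgr_gt (g x)).
Qed.

End ProductSmoothness.

(** * Great circle arcs are geodesics *)

Section GreatCircle.
Context {R : realType} (n : nat) (M : ptopologicalType)
  (X : @closed_kahler R n M)
  (mu : {measure set (g_sigma_algebraType (@open M)) -> \bar R}).
Hypothesis hmu : is_kahler_volume X mu.
Local Notation VI := (vol_integral mu).
Local Notation V := (Vol mu).
Local Notation C := (calabi_space X mu).
Local Notation E := 'rV[R]_(n + n).
#[local] Opaque expR vol_integral cos sin ln.

Lemma expR_2ln (x : R) : 0 < x -> expR (2 * ln x) = x ^+ 2.
Proof. by move=> x0; rewrite expRM_natl lnK. Qed.

Definition great_circle (A B : M -> R) (om a : R) : R -> M -> R :=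
  fun t p => 2 * ln (A p * cos (om * (t - a)) + B p * sin (om * (t - a))).

Section GreatCircleGeodesic.
Variables (A B : M -> R) (om a b : R).
Hypothesis ab : a < b.
Hypotheses (sA : smooth_fun X A) (sB : smooth_fun X B).
Let F t p := A p * cos (om * (t - a)) + B p * sin (om * (t - a)).
Let F' t p := om * (B p * cos (om * (t - a)) - A p * sin (om * (t - a))).
Hypothesis F_gt0 : forall t p, a <= t <= b -> 0 < F t p.
Hypothesis F_norm : forall t, a <= t <= b -> VI (fun p => F t p ^+ 2) = V.
Hypothesis F'_norm : forall t, a <= t <= b -> VI (fun p => F' t p ^+ 2) = om ^+ 2 * V.
Let I : set R := `[a, b]%classic.
Let u := great_circle A B om a.

Let inI t : I t = (a <= t <= b).
Proof. by rewrite /I /= in_itv. Qed.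

Let aI t : I t -> accum I t.
Proof. by rewrite inI; exact: accum_itv. Qed.

Let sF t : smooth_fun X (F t).
Proof. by rewrite /F; smooth. Qed.

Lemma great_circle_calabi t : a <= t <= b -> C (great_circle A B om a t).
Proof.
move=> tab; split.
  have sl : smooth_fun X (fun p => ln (F t p)).
    by apply: smooth_fun_ln => // p; exact: F_gt0.
  by rewrite /great_circle; smooth.
rewrite -[RHS](F_norm tab); apply: eq_VI => p.
by rewrite expR_2ln //; exact: F_gt0.
Qed.

Let smooth_phase (f : R -> R) (c : @chart R n M) (D : M -> R) : atlas X c -> smooth_fun X D ->
  smooth_on setT (fun t => f t) ->
  smooth_on [set z : R * E | codom_of c z.2] (fun z => D (param c z.2) * f z.1).
Proof.
move=> ac sD sf; have oc := codom_open ac.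
apply: (smooth_onM (open_snd oc)); first exact: (smooth_on_snd oc (sD _ ac)).
by apply: smooth_on_sub (smooth_on_fst openT sf).
Qed.

Let smooth_cs : smooth_on setT (fun t => cos (om * (t - a))) /\ smooth_on setT (fun t => sin (om * (t - a))).
Proof.
apply: (@smooth_on_cos_sin _ _ setT (fun t => om * (t - a)) openT).
have -> : (fun t => om * (t - a)) = om *: (id + cst (- a)) by [].
apply: smooth_onZ; first exact: openT.
apply: smooth_onD; [exact: openT | exact: smooth_on_id | exact: (@smooth_on_cst _ _ R^o)].
Qed.

Lemma great_circle_smooth_family : smooth_family X I u.
Proof.
move=> c ac [t x] /= [It cx]; have oc := codom_open ac.
pose O := [set z : R * E | codom_of c z.2].
have oO : open O by exact: open_snd.
pose g0 := fun z : R * E => F z.1 (param c z.2).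
have [sc ss] := smooth_cs.
have sg0 : smooth_on O g0.
  by apply: (smooth_onD oO); [exact: (smooth_phase ac sA sc) | exact: (smooth_phase ac sB ss)].
(* The defining formula is its own extension: it is smooth on the open set where the argument of
   [ln] is positive, and this set contains the points over the closed interval. *)
exists (O `&` [set z | 0 < g0 z]), (2 *: (@ln R \o g0)); split.
- exact: smooth_on_open_gt0.
- by split => //=; apply: F_gt0; rewrite -inI.
- apply: smooth_onZ; first exact: smooth_on_open_gt0.
  apply: smooth_on_ln; first exact: smooth_on_open_gt0.
    by move=> z [].
  by apply: smooth_on_sub sg0 => z [].
- by [].
Qed.

Let dF (t : R) p : is_derive t 1 (F ^~ p) (F' t p).
Proof.
have h := is_deriveD (is_deriveZ (A p) (is_derive_cos_phase om a t))
  (is_deriveZ (B p) (is_derive_sin_phase om a t)).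
by apply: (@is_derive_eq _ _ _ _ _ _ _ _ h); rewrite /F' /GRing.scale /=; ring.
Qed.

Let dF' (t : R) p : is_derive t 1 (F' ^~ p) (- om ^+ 2 * F t p).
Proof.
have h := is_deriveZ om (is_deriveB (is_deriveZ (B p) (is_derive_cos_phase om a t))
  (is_deriveZ (A p) (is_derive_sin_phase om a t))).
by apply: (@is_derive_eq _ _ _ _ _ _ _ _ h); rewrite /F /GRing.scale /=; ring.
Qed.

Let W t p := 2 * (F' t p * (F t p)^-1).

Let du t p : I t -> wderiv I (u ^~ p) t (W t p).
Proof.
rewrite inI => tab; apply: is_derive_wderiv.
have d1 := @is_derive1_comp _ (@ln R) (F ^~ p) t _ _ (is_derive1_ln (F_gt0 p tab)) (dF t p).
apply: (@is_derive_eq _ _ _ _ _ _ _ _ (is_deriveZ 2 d1)).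
by rewrite /W /GRing.scale /= [_^-1 * _]mulrC.
Qed.

Let dW t p : I t -> wderiv I (W ^~ p) t (-2 * om ^+ 2 - 2^-1 * W t p ^+ 2).
Proof.
rewrite inI => tab; apply: is_derive_wderiv.
have F0 := lt0r_neq0 (F_gt0 p tab).
have d1 := is_deriveM (dF' t p) (is_deriveV (F0 : (F ^~ p) t != 0) (dF t p)).
apply: (@is_derive_eq _ _ _ _ _ _ _ _ (is_deriveZ 2 d1)).
by rewrite /W /GRing.scale /=; field.
Qed.

Let velE t p : I t -> velocity I u t p = W t p.
Proof. by move=> It; apply: wderiv_derive_within; [exact: aI | exact: du]. Qed.

(** The velocity [W = 2 F' / F] satisfies [W' = - 2 om ^ 2 - W ^ 2 / 2], and the energy is
    [4 om ^ 2 V] by [F'_norm]; its contribution [2 om ^ 2] to the equation cancels the constant. *)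
Lemma great_circle_geodesic : geodesic X mu `[a, b] (great_circle A B om a).
Proof.
split; first split.
- by move=> t It; apply: great_circle_calabi; rewrite -inI.
- exact: great_circle_smooth_family.
move=> t p It; rewrite /cov_derive -/u -/I.
have -> : velocity I (velocity I u) t p = -2 * om ^+ 2 - 2^-1 * W t p ^+ 2.
  apply: wderiv_derive_within; first exact: aI.
  apply: (@wderiv_near _ _ (W ^~ p) _ _ _ 1) => //; last exact: dW.
  by move=> s Is _; rewrite velE.
have tab : a <= t <= b by rewrite -inI.
have -> : VI (fun q => velocity I u t q * velocity I u t q * expR (u t q)) = 4 * (om ^+ 2 * V).
  have cA := smooth_fun_continuous sA; have cB := smooth_fun_continuous sB.
  rewrite -(F'_norm tab) -(VIZ hmu); last by rewrite /F'; cont.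
  apply: eq_VI => q; rewrite velE // /u /great_circle expR_2ln; last exact: F_gt0.
  have F0 := lt0r_neq0 (F_gt0 q tab).
  by rewrite /W -/(F t q); field.
rewrite velE //; field; rewrite gt_eqF //; exact: (Vol_gt0 hmu).
Qed.

End GreatCircleGeodesic.

(** The degenerate great circle with zero normal and zero speed, needed for the distance of a point
    to itself. *)
Lemma constant_geodesic (a b : R) u0 : a < b -> C u0 -> geodesic_joining X mu a b u0 u0 (fun=> u0).
Proof.
move=> ab C0; have [s0 n0] := C0.
have sh : smooth_fun X (half_exp u0).
  have -> : half_exp u0 = (fun p => expR (u0 p * 2^-1)) by apply/funext => p; rewrite half_expE.
  by smooth.
have uE : (fun=> u0) = great_circle (half_exp u0) (fun=> 0) 0 a.
  apply/funext => t; apply/funext => p; rewrite /great_circle !mul0r cos0 mulr1 addr0.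
  by rewrite half_expE expRK mulrC divfK.
split => //; rewrite uE; apply: great_circle_geodesic => // [|t p _|t _|t _].
- exact: smooth_fun_cst.
- by rewrite !mul0r cos0 mulr1 addr0 half_exp_gt0.
- rewrite -(VI_half_exp_sqr C0); apply: eq_VI => p.
  by rewrite !mul0r cos0 mulr1 addr0.
- have -> : VI (fun p => (0 * (0 * cos (0 * (t - a)) - half_exp u0 p * sin (0 * (t - a)))) ^+ 2) = VI (fun=> 0).
    by apply: eq_VI => p; rewrite !mul0r expr0n.
  by rewrite VI_cst mul0r expr0n /= mul0r.
Qed.

(** The tangent at [u0] of the arc towards [u1]: the part of the second half-density orthogonal to
    the first, rescaled to the radius of the sphere. *)
Definition arc_normal u0 u1 : M -> R := fun p =>
  (half_exp u1 p - cos (ang mu u0 u1) * half_exp u0 p) / sin (ang mu u0 u1).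

Definition arc_speed (a b : R) u0 u1 : R := ang mu u0 u1 / (b - a).

Definition arc (a b : R) u0 u1 : R -> M -> R :=
  great_circle (half_exp u0) (arc_normal u0 u1) (arc_speed a b u0 u1) a.

Lemma sin_ang_gt0 u0 u1 : C u0 -> C u1 -> u0 <> u1 -> 0 < sin (ang mu u0 u1).
Proof.
move=> C0 C1 ne; have a0 := ang_gt0 hmu C0 C1 ne; have /andP[_ a1] := ang_itv hmu C0 C1.
have pi0 : 0 < (pi : R) by exact: pi_gt0.
by apply: sin_gt0_pi; rewrite a0 /=; apply: lt_trans a1 _; lra.
Qed.

Lemma half_exp_smooth u : smooth_fun X u -> smooth_fun X (half_exp u).
Proof.
move=> su; have -> : half_exp u = (fun p => expR (u p * 2^-1)) by apply/funext => p; rewrite half_expE.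
by smooth.
Qed.

Lemma arc_normal_smooth u0 u1 : C u0 -> C u1 -> smooth_fun X (arc_normal u0 u1).
Proof.
move=> [s0 _] [s1 _]; have h0 := half_exp_smooth s0; have h1 := half_exp_smooth s1.
by rewrite /arc_normal; smooth.
Qed.

(** Spherical interpolation between the endpoints; in this form both coefficients are nonnegative on
    the arc, which is how its positivity is proved. *)
Lemma arcE (a b t : R) u0 u1 p : C u0 -> C u1 -> u0 <> u1 -> a < b ->
  half_exp u0 p * cos (arc_speed a b u0 u1 * (t - a)) + arc_normal u0 u1 p * sin (arc_speed a b u0 u1 * (t - a)) =
  (half_exp u0 p * sin (arc_speed a b u0 u1 * (b - t)) + half_exp u1 p * sin (arc_speed a b u0 u1 * (t - a))) / sin (ang mu u0 u1).
Proof.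
move=> C0 C1 ne ab; set om := arc_speed a b u0 u1; have s0 := sin_ang_gt0 C0 C1 ne.
have -> : om * (b - t) = ang mu u0 u1 - om * (t - a).
  by rewrite /om /arc_speed; field; rewrite subr_eq0 gt_eqF.
by rewrite sinB /arc_normal; field; rewrite gt_eqF.
Qed.

Lemma arc_phase (a b t : R) u0 u1 : C u0 -> C u1 -> u0 <> u1 -> a < b -> a <= t <= b ->
  [/\ 0 <= arc_speed a b u0 u1 * (t - a), arc_speed a b u0 u1 * (t - a) <= ang mu u0 u1 & arc_speed a b u0 u1 * (t - a) = 0 \/ 0 < arc_speed a b u0 u1 * (t - a)].
Proof.
move=> C0 C1 ne ab /andP[at_ tb]; set om := arc_speed a b u0 u1; have a0 := ang_gt0 hmu C0 C1 ne.
have ba : 0 < b - a by rewrite subr_gt0.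
have om0 : 0 < om by rewrite divr_gt0.
have h0 : 0 <= om * (t - a) by rewrite mulr_ge0 ?subr_ge0 // ltW.
split => //.
  rewrite -[leRHS](divfK (lt0r_neq0 ba)) -/(arc_speed a b u0 u1) ler_wpM2l ?(ltW om0) //.
  by rewrite lerD2r.
by move: h0; rewrite le_eqVlt => /predU1P[<-|]; [left | right].
Qed.

Lemma arc_gt0 (a b t : R) u0 u1 p : C u0 -> C u1 -> u0 <> u1 -> a < b -> a <= t <= b ->
  0 < half_exp u0 p * cos (arc_speed a b u0 u1 * (t - a)) + arc_normal u0 u1 p * sin (arc_speed a b u0 u1 * (t - a)).
Proof.
move=> C0 C1 ne ab tab; set om := arc_speed a b u0 u1; rewrite /om arcE // -/om; have s0 := sin_ang_gt0 C0 C1 ne.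
have [h0 h1 h2] := arc_phase C0 C1 ne ab tab.
have /andP[_ a1] := ang_itv hmu C0 C1.
have pi0 : 0 < (pi : R) by exact: pi_gt0.
rewrite divr_gt0 // -/om.
have -> : om * (b - t) = ang mu u0 u1 - om * (t - a).
  by rewrite /om /arc_speed; field; rewrite subr_eq0 gt_eqF.
rewrite -/om in h0 h1 h2; move: h0 h1 h2 a1 s0; move: (om * (t - a)) (ang mu u0 u1) => x y h0 h1 h2 a1 s0.
have f0 := half_exp_gt0 u0 p; have f1 := half_exp_gt0 u1 p.
have sxy : 0 <= sin (y - x) by apply: sin_ge0_pi; apply/andP; split; lra.
case: h2 => [->|x0]; first by rewrite subr0 sin0 mulr0 addr0 mulr_gt0.
have sx : 0 < sin x by apply: sin_gt0_pi; rewrite x0 /=; lra.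
by rewrite ltr_wpDl // ?mulr_gt0 // mulr_ge0 // ltW.
Qed.

Lemma VI_arc u0 u1 : C u0 -> C u1 -> u0 <> u1 -> forall k l : R,
  VI (fun p => (half_exp u0 p * k + arc_normal u0 u1 p * l) ^+ 2) = (k ^+ 2 + l ^+ 2) * V.
Proof.
move=> C0 C1 ne k l; have s0 := sin_ang_gt0 C0 C1 ne.
set s := sin (ang mu u0 u1); set c := cosang mu u0 u1.
have cE : cos (ang mu u0 u1) = c by rewrite (cos_ang hmu).
have -> : VI (fun p => (half_exp u0 p * k + arc_normal u0 u1 p * l) ^+ 2) =
  VI (fun p => ((k - c * l / s) * half_exp u0 p + (l / s) * half_exp u1 p) *
     ((k - c * l / s) * half_exp u0 p + (l / s) * half_exp u1 p)).
  by apply: eq_VI => p; rewrite /arc_normal cE -/s; field; rewrite gt_eqF.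
rewrite (VI_gram hmu) // !(cosangxx hmu) // (cosangC _ u1 u0) -/c.
have sc : s ^+ 2 = 1 - c ^+ 2 by rewrite -cE -sin2cos2.
have -> : (k ^+ 2 + l ^+ 2) * V = V * (k ^+ 2 + l ^+ 2 * (s ^+ 2 / s ^+ 2)).
  by rewrite divff ?mulr1 1?mulrC // expf_neq0 // gt_eqF.
by rewrite {1}sc; field; rewrite gt_eqF.
Qed.

Lemma arc_geodesic (a b : R) u0 u1 : C u0 -> C u1 -> u0 <> u1 -> a < b ->
  geodesic_joining X mu a b u0 u1 (arc a b u0 u1).
Proof.
move=> C0 C1 ne ab; have [s0 _] := C0; split.
- apply: great_circle_geodesic => //.
  + exact: half_exp_smooth.
  + exact: arc_normal_smooth.
  + by move=> t p tab; exact: arc_gt0.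
  + by move=> t tab; rewrite VI_arc // cos2Dsin2 mul1r.
  + move=> t tab; set x := _ * (t - a).
    rewrite -[X in _ = X * _]mulr1 -(cos2Dsin2 x) mulrDr addrC -!exprMn -(sqrrN (_ * sin x)) -(VI_arc C0 C1 ne).
    by apply: eq_VI => p; ring.
- apply/funext => p; rewrite /arc /great_circle subrr mulr0 cos0 sin0 mulr1 mulr0 addr0.
  by rewrite half_expE expRK mulrC divfK.
- apply/funext => p; rewrite /arc /great_circle arcE // subrr mulr0 sin0 mulr0 add0r.
  have -> : arc_speed a b u0 u1 * (b - a) = ang mu u0 u1.
    by rewrite /arc_speed divfK // subr_eq0 gt_eqF.
  rewrite mulfK ?gt_eqF ?sin_ang_gt0 //.
  by rewrite half_expE expRK mulrC divfK.
Qed.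

End GreatCircle.

(** * Analyticity of arcs *)

Section FaaDiBruno.
Context {R : realType} {V : normedModType R}.

(* Faa di Bruno: the coefficients c j depend on y and s, but not on H. *)
Lemma iter_derive_comp (U : set V) (y : V -> R) (J : set R) (s : seq V) : open U ->
  smooth_on U y -> (forall x, U x -> J (y x)) ->
  exists c : nat -> V -> R, (forall j, smooth_on U (c j)) /\
  forall H : nat -> R -> R, (forall k z, J z -> is_derive z 1 (H k) (H k.+1 z)) ->
  forall x, U x -> iter_derive s (H 0%N \o y) x = \sum_(j < (size s).+1) H j (y x) * c j x.
Proof.
move=> oU sy yJ; elim: s => [|v s [c [sc IH]]].
  exists (fun=> cst 1); split=> [j|H dH x Ux]; first exact: (@smooth_on_cst _ _ R^o).
  by rewrite big_ord_recl big_ord0 addr0 mulr1.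
(* The product rule on [H j (y)] times [c j]: differentiating [c j] keeps the index, differentiating
   [H j (y)] raises it by one and brings out ['D_v y]. *)
pose c' j : V -> R := (if (j <= size s)%N then 'D_v (c j) else cst 0)
  + (if j is j'.+1 then 'D_v y * c j' else cst 0).
exists c'; split=> [j|H dH x Ux].
  apply: smooth_onD => //.
    by case: ifP => _; [exact: smooth_on_derive | exact: (@smooth_on_cst _ _ R^o)].
  case: j => [|j]; first exact: (@smooth_on_cst _ _ R^o).
  by apply: smooth_onM => //; exact: smooth_on_derive.
have near1 : \forall z \near x, iter_derive s (H 0%N \o y) z =
    (\sum_(j < (size s).+1) (H j \o y) * c j) z.
  apply: filterS (open_nbhs_nbhs (conj oU Ux)) => z Uz.
  by rewrite IH // fct_sumE.
rewrite /= (near_eq_derive _ near1).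
have dHy j : differentiable (H j \o y) x /\ 'D_v (H j \o y) x = H j.+1 (y x) * 'D_v y x.
  by apply: derive_comp1; [apply: dH; exact: yJ | exact: (sy [::])].
have dc j : derivable (c j) x v by exact: smooth_on_derivable (sc j) Ux.
have dHc j : derivable ((H j \o y) * c j) x v.
  by apply: derivableM => //; apply: diff_derivable; case: (dHy j).
rewrite derive_sum //.
have dM j : 'D_v ((H j \o y) * c j) x = H j (y x) * 'D_v (c j) x + c j x * (H j.+1 (y x) * 'D_v y x).
  rewrite deriveM //; last by apply: diff_derivable; case: (dHy j).
  by case: (dHy j) => _ ->.
transitivity (\sum_(j < (size s).+1) (H j (y x) * 'D_v (c j) x + c j x * (H j.+1 (y x) * 'D_v y x))).
  by apply: eq_bigr => j _; exact: dM.
rewrite big_split /=.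
have -> : \sum_(j < (size s).+2) H j (y x) * c' j x =
  \sum_(j < (size s).+2) H j (y x) * (if (j <= size s)%N then 'D_v (c j) x else 0) +
  \sum_(j < (size s).+2) H j (y x) * (if (j : nat) is j'.+1 then 'D_v y x * c j' x else 0).
  rewrite -big_split /=; apply: eq_bigr => j _; rewrite -mulrDr /c' fctE /=; congr (_ * (_ + _)).
    by case: ifP.
  by case: (j : nat).
congr (_ + _).
  rewrite [RHS]big_ord_recr /= ltnn mulr0 addr0; apply: eq_bigr => j _.
  by rewrite -ltnS ltn_ord.
rewrite [RHS]big_ord_recl /= mulr0 add0r; apply: eq_bigr => j _.
by rewrite /bump /= add1n add0n; ring.
Qed.

End FaaDiBruno.

Section LogCosTaylor.
Context {R : realType}.
#[local] Opaque expR cos sin ln tan.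

(** Up to sign, the remainder of order [m] in the Taylor expansion of [log_cos 0] from [z] to
    [z + d], differentiated [j] times in [z]; differentiation in [z] raises [j], so these form a
    tower to which [iter_derive_comp] applies. *)
Definition log_cos_rem (m : nat) (d : R) (j : nat) (z : R) : R :=
  \sum_(k < m) d ^+ k / k`!%:R * log_cos (k + j) z - log_cos j (z + d).

Lemma log_cos_rem_derive m d j z : 0 < cos z -> 0 < cos (z + d) ->
  is_derive z 1 (log_cos_rem m d j) (log_cos_rem m d j.+1 z).
Proof.
move=> cz czd.
have h1 k : is_derive z 1 (log_cos (k + j) : R -> R) (log_cos (k + j).+1 z) by exact: log_cos_derive.
have h2 := is_derive_sum (fun k : 'I_m => is_deriveZ (d ^+ k / k`!%:R) (h1 k)).
have da := is_derive_affine d 1 z.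
have e1 : (cst d + 1 *: id : R -> R) z = z + d.
    have -> : (cst d + 1 *: id : R -> R) z = d + 1 * z by [].
    by rewrite mul1r addrC.
have h3 : is_derive ((cst d + 1 *: id : R -> R) z) 1 (log_cos j) (log_cos j.+1 (z + d)).
  by rewrite e1; exact: log_cos_derive.
have h4 := is_deriveB h2 (is_derive1_comp h3 da).
have -> : log_cos_rem m d j = \sum_(k < m) (d ^+ k / k`!%:R) *: (log_cos (k + j) : R -> R)
   - (log_cos j \o (cst d + 1 *: id : R -> R)).
  apply/funext => x; rewrite /log_cos_rem.
  transitivity ((\sum_(k < m) (d ^+ k / k`!%:R) *: (log_cos (k + j) : R -> R)) x - log_cos j (d + 1 * x)); last by [].
  by rewrite fct_sumE mul1r [d + x]addrC.
apply: (@is_derive_eq _ _ _ _ _ _ _ _ h4).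
rewrite mulr1 /log_cos_rem; congr (_ - _); apply: eq_bigr => k _.
by rewrite addnS.
Qed.

(** The quotient of the factorials of [m + j] and of [m] is at most [2 ^ (m + j)] times that of [j];
    the smallness of [d] beats the factor [2 ^ m] and still leaves the inverse of [2 ^ m]. *)
Lemma log_cos_rem_bound m j (d z eta : R) : (0 < m)%N ->
  `|z| + `|d| <= eta -> eta < pi / 2 -> 2 * (cos eta)^-1 * `|d| <= 2^-1 ->
  `|log_cos_rem m d j z| <= 2 * j`!%:R * (2 * (cos eta)^-1) ^+ j * (2^-1) ^+ m.
Proof.
move=> m0 zd e2 hd; set K := (cos eta)^-1 in hd *.
have pi0 : 0 < (pi : R) by exact: pi_gt0.
have eta0 : 0 <= eta by apply: le_trans zd; exact: addr_ge0.
have ce : 0 < cos eta by apply: cos_gt0_pihalf; rewrite e2 andbT; lra.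
have K0 : 0 < K by rewrite invr_gt0.
have near z' : `|z' - z| <= `|d| -> `|z'| <= eta.
  move=> h; apply: le_trans zd; rewrite -lerBlDl; apply: le_trans h.
  exact: lerB_dist.
have cpos z' : `|z' - z| <= `|d| -> 0 < cos z'.
  move=> /near h; apply: cos_gt0_pihalf; rewrite -ltr_norml.
  exact: le_lt_trans e2.
have := @taylor_bound R (fun k => log_cos (k + j)) m (2 * (m + j)`!%:R * K ^+ (m + j)) z d
  (fun k z' h => log_cos_derive (k + j) (cpos z' h)) _.
have -> : \sum_(k < m) d ^+ k * log_cos (k + j) z / k`!%:R =
  \sum_(k < m) d ^+ k / k`!%:R * log_cos (k + j) z by apply: eq_bigr => k _; rewrite mulrAC.
rewrite add0n distrC => H; apply: le_trans (H _) _.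
  move=> z' /near h; apply: (log_cos_bound _ h e2).
  by rewrite addn_gt0 m0.
have fm0 : 0 < m`!%:R :> R by rewrite ltr0n fact_gt0.
have fac : (m + j)`!%:R <= 2 ^+ (m + j) * (m`!%:R * j`!%:R) :> R.
  rewrite -natrX -!natrM ler_nat -(@bin_fact (m + j) m) ?leq_addr // addKn.
  rewrite leq_mul2r; apply/orP; right.
  have := expnDn 1 1 (m + j); rewrite addn1 => ->.
  have mlt : (m < (m + j).+1)%N by rewrite ltnS leq_addr.
  by rewrite (bigD1 (Ordinal mlt)) //= !exp1n !muln1 leq_addr.
have s1 : 2 * (m + j)`!%:R * K ^+ (m + j) * `|d| ^+ m / m`!%:R <=
  2 * (2 ^+ (m + j) * (m`!%:R * j`!%:R)) * K ^+ (m + j) * `|d| ^+ m / m`!%:R.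
  rewrite ler_pM2r ?invr_gt0 // ler_wpM2r ?exprn_ge0 // ler_wpM2r ?exprn_ge0 ?(ltW K0) //.
  by rewrite ler_pM2l.
apply: le_trans s1 _.
have -> : 2 * (2 ^+ (m + j) * (m`!%:R * j`!%:R)) * K ^+ (m + j) * `|d| ^+ m / m`!%:R =
  2 * j`!%:R * (2 * K) ^+ j * (2 * K * `|d|) ^+ m.
  rewrite !exprMn !exprD; field; by rewrite gt_eqF.
rewrite ler_wpM2l //; first by rewrite !mulr_ge0 // exprn_ge0 // mulr_ge0 // ltW.
by rewrite lerXn2r // nnegrE // !mulr_ge0 // ltW.
Qed.

End LogCosTaylor.

Section AnalyticArc.
Context {R : realType} (n : nat) (M : ptopologicalType)
  (X : @closed_kahler R n M)
  (mu : {measure set (g_sigma_algebraType (@open M)) -> \bar R}).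
Hypothesis hmu : is_kahler_volume X mu.
Local Notation C := (calabi_space X mu).
Local Notation E := 'rV[R]_(n + n).
#[local] Opaque expR vol_integral cos sin ln.

Lemma continuous_lt_uniform (f : M -> R) (c : R) : continuous f -> (forall p, f p < c) ->
  exists2 eta, eta < c & forall p, f p <= eta.
Proof.
move=> cf fc.
have [p _ Hp] := @compact_EVT_max _ R f setT (ex_intro _ point I) (manifold_compact X) (continuous_subspaceT cf).
by exists (f p) => // q; apply: Hp; rewrite inE.
Qed.

Lemma smooth_fun_cos (f : M -> R) : smooth_fun X f -> smooth_fun X (fun p => cos (f p)).
Proof. by move=> sf c ac; have [h _] := smooth_on_cos_sin (codom_open ac) (sf _ ac). Qed.

Lemma smooth_fun_log_cos k (f : M -> R) : smooth_fun X f -> (forall p, 0 < cos (f p)) ->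
  smooth_fun X (fun p => log_cos k (f p)).
Proof.
move=> sf f0 c ac.
apply: (@smooth_on_comp _ _ [set z | 0 < cos z] (fun j => log_cos (j + k)) _ (f \o param c)) => //.
- exact: codom_open ac.
- by move=> j y; exact: log_cos_derive.
- by move=> x _; exact: f0.
- exact: sf.
Qed.

(** The coefficients given by [iter_derive_comp] do not depend on [m] and are bounded on the compact
    set, so every seminorm of the remainder is halved at each order. *)
Lemma log_cos_analytic_cvg (y : M -> R) (d eta : R) :
  smooth_fun X y -> (forall p, `|y p| + `|d| <= eta) -> eta < pi / 2 ->
  2 * (cos eta)^-1 * `|d| <= 2^-1 ->
  cinf_cvg X \oo (fun m => \sum_(k < m) d ^+ k *: (fun p => log_cos k (y p) / k`!%:R))
    (fun p => log_cos 0 (y p + d)).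
Proof.
move=> sy yd e2 hd i vi; have [ac cK KC] := vi.
set c := i.1.1 in ac KC *; pose U := codom_of c; have oU : open U by exact: codom_open ac.
pose J : set R := [set z | `|z| + `|d| <= eta].
have cosJ z z' : J z -> `|z'| <= `|d| -> 0 < cos (z + z').
  rewrite /J /= => Jz z'd; apply: cos_gt0_pihalf; rewrite -ltr_norml.
  apply: le_lt_trans e2; apply: le_trans Jz; apply: le_trans (ler_normD _ _) _.
  by rewrite lerD2l.
have [cf [scf Hcf]] := @iter_derive_comp _ _ U (y \o param c) J i.2 oU (sy _ ac) (fun x _ => yd _).
have [B HB] : exists B, forall x, i.1.2 x -> \sum_(j < (size i.2).+1) `|cf j x| <= B.
  have bj j : exists Bj, forall x, i.1.2 x -> `|cf j x| <= Bj.
    have [B [_ HB]] : bounded_set (cf j @` i.1.2).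
      apply: compact_bounded; apply: continuous_compact => //.
      apply: continuous_in_subspaceT => x /set_mem Kx.
      exact: (smooth_on_continuous (scf j) (KC _ Kx)).
    exists (`|B| + 1) => x Kx.
    by apply: (HB (`|B| + 1)); [rewrite (le_lt_trans (ler_norm _)) // ltrDl | exists x].
  have [Bf HBf] := choice bj.
  by exists (\sum_(j < (size i.2).+1) Bf j) => x Kx; apply: ler_sum => j _; exact: HBf.
pose D := \sum_(j < (size i.2).+1) (2 * j`!%:R * (2 * (cos eta)^-1) ^+ j : R).
have K0 : 0 <= (cos eta)^-1 * 2.

  have e0 := le_trans (addr_ge0 (normr_ge0 (y point)) (normr_ge0 d)) (yd point).
  have pi0 : 0 < (pi : R) by exact: pi_gt0.
  by rewrite mulr_ge0 // invr_ge0 cos_ge0_pihalf //; apply/andP; split; lra.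
have term0 j : 0 <= 2 * j`!%:R * (2 * (cos eta)^-1) ^+ j :> R.
  by rewrite !mulr_ge0 // exprn_ge0 // mulrC.
have D0 : 0 <= D by apply: sumr_ge0 => j _; exact: term0.
have bound m : (0 < m)%N -> cinf_seminorm i
    ((\sum_(k < m) d ^+ k *: (fun p => log_cos k (y p) / k`!%:R)) - (fun p => log_cos 0 (y p + d)))
    <= D * `|B| * (2^-1) ^+ m.
  move=> m0; apply: seminorm_le => [|x Kx].
    by rewrite !mulr_ge0 // exprn_ge0 // invr_ge0.
  rewrite -/c.
  have -> : ((\sum_(k < m) d ^+ k *: (fun p => log_cos k (y p) / k`!%:R)) - (fun p => log_cos 0 (y p + d))) \o param c
     = log_cos_rem m d 0 \o (y \o param c).
    apply/funext => z; rewrite /= fctE /log_cos_rem fct_sumE; congr (_ - _).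
    apply: eq_bigr => k _.
    by rewrite addn0 -[LHS]/(d ^+ k * (log_cos k (y (param c z)) / k`!%:R)) mulrA mulrAC.
  have dH k z : J z -> is_derive z 1 (log_cos_rem m d k) (log_cos_rem m d k.+1 z).
    move=> Jz; apply: log_cos_rem_derive; last exact: cosJ.
    by rewrite -[z]addr0; apply: cosJ => //; rewrite normr0.
  rewrite (Hcf _ dH _ (KC _ Kx)).
  apply: le_trans (ler_norm_sum _ _ _) _.
  rewrite /D !mulr_suml; apply: ler_sum => j _; rewrite normrM.
  apply: le_trans (ler_pM _ _ (log_cos_rem_bound j m0 (yd (param c x)) e2 hd) (lexx _)) _ => //.
  rewrite -[leRHS]mulrA [`|B| * _]mulrC mulrA; apply: ler_wpM2l.
    by rewrite mulr_ge0 // exprn_ge0 // invr_ge0.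
  apply: le_trans (ler_norm B); apply: le_trans (HB _ Kx).
  by rewrite (bigD1 j) //= lerDl sumr_ge0.
apply/cvgr0Pnorm_le => e e0.
have geo : (D * `|B|) * (2^-1) ^+ m @[m --> \oo] --> (0 : R).
  rewrite -[X in _ --> X](mulr0 (D * `|B|)); apply: cvgM; first exact: cvg_cst.
  apply: cvg_expr; rewrite ger0_norm // ?invr_ge0 //; lra.
near=> m.
rewrite ger0_norm ?seminorm_ge0 //; apply: le_trans (bound m _) _.
  by near: m; exact: nbhs_infty_gt.
apply: le_trans (ler_norm _) _; near: m.
by move: geo => /cvgr0Pnorm_le; exact.
Unshelve. all: by end_near. Qed.

Lemma arc_analytic (a b : R) u0 u1 : C u0 -> C u1 -> u0 <> u1 -> a < b ->
  analytic_curve X `[a, b] (arc mu a b u0 u1).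
Proof.
move=> C0 C1 ne ab t; rewrite /= in_itv /= => tab.
have [s0 _] := C0; have sh0 := half_exp_smooth s0; have sN := arc_normal_smooth C0 C1.
have h0 p := half_exp_gt0 u0 p.
(* [w] is the tangent of the phase shift [phi] that turns the combination of cosine and sine into a
   single cosine, with an amplitude independent of time. *)
pose w p := arc_normal mu u0 u1 p * (half_exp u0 p)^-1.
have sw : smooth_fun X w.
  by apply: smooth_funM => //; apply: smooth_fun_inv => // p; rewrite gt_eqF.
pose om := arc_speed mu a b u0 u1.
have om0 : 0 < om by rewrite divr_gt0 ?(ang_gt0 hmu) // subr_gt0.
pose phi p := atan (w p); have sphi : smooth_fun X phi by exact: smooth_fun_atan.
have cphi p : 0 < cos (phi p) by apply: cos_gt0_pihalf; rewrite atan_gtNpi2 atan_ltpi2.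
have phase s p : half_exp u0 p * cos (om * (s - a)) + arc_normal mu u0 u1 p * sin (om * (s - a)) =
    half_exp u0 p / cos (phi p) * cos (om * (s - a) - phi p).
  have wE : arc_normal mu u0 u1 p = half_exp u0 p * (sin (phi p) / cos (phi p)).
    have -> : sin (phi p) / cos (phi p) = w p by rewrite -[RHS]atanK /tan.
    by rewrite /w mulrC divfK // gt_eqF.
  by rewrite wE cosB; field; rewrite gt_eqF.
have cpos s p : a <= s <= b -> 0 < cos (om * (s - a) - phi p).
  move=> sab; have := arc_gt0 hmu p C0 C1 ne ab sab; rewrite phase.
  by rewrite pmulr_rgt0 // divr_gt0.
pose G p := 2 * ln (half_exp u0 p) - 2 * ln (cos (phi p)).
have sG : smooth_fun X G.
  have g1 : smooth_fun X (fun p => ln (half_exp u0 p)) by exact: smooth_fun_ln.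
  have g2 : smooth_fun X (fun p => ln (cos (phi p))) by apply: smooth_fun_ln => //; exact: smooth_fun_cos.
  by rewrite /G; smooth.
pose y p := om * (t - a) - phi p.
have sy : smooth_fun X y by rewrite /y; smooth.
have cy := smooth_fun_continuous sy.
have pi0 : 0 < (pi : R) by exact: pi_gt0.
(* A priori [y p] lies between [- pi / 2] and [pi]; the positivity of the half-density, hence of
   [cos (y p)], excludes the values from [pi / 2] on. *)
have ysmall p : `|y p| < pi / 2.
  have [k0 k1 _] := arc_phase hmu C0 C1 ne ab tab; rewrite -/om in k0 k1.
  have /andP[_ k2] := ang_itv hmu C0 C1.
  have f1 := atan_gtNpi2 (w p); have f2 := atan_ltpi2 (w p); rewrite -/(phi p) in f1 f2.
  have yl : - (pi / 2) < y p by rewrite /y; lra.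
  have yu : y p < pi by rewrite /y; lra.
  rewrite ltr_norml yl /= ltNge; apply/negP => yge.
  have := cpos t p tab; rewrite -/(y p) ltNge => /negP; apply.
  rewrite -[y p](subrK (pi / 2)) cosDpihalf oppr_le0 sin_ge0_pi //.
  by apply/andP; split; lra.
have cny : continuous (fun p => `|y p|) by cont.
have [eta eta2 Heta] := continuous_lt_uniform cny ysmall.
have eta0 : 0 <= eta by exact: le_trans (Heta point).
(* Compactness has given [|y| <= eta < pi / 2]. The midpoint [eta1] leaves room for the increment
   [d], and [d0] ensures both [|y| + |d| <= eta1] and the smallness required for the geometric
   bound. *)
pose eta1 := (eta + pi / 2) / 2.
have eta12 : eta1 < pi / 2 by rewrite /eta1; lra.
have ce : 0 < cos eta1 by apply: cos_gt0_pihalf; rewrite eta12 andbT /eta1; lra.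
pose d0 := Num.min (eta1 - eta) (cos eta1 / 4).
have d00 : 0 < d0 by rewrite lt_min divr_gt0 // andbT subr_gt0 /eta1; lra.
(* The time-independent amplitude contributes [G] to the coefficient of degree 0 only; [om ^ k]
   comes from [d = om * h]. *)
pose a_ k p := om ^+ k * (log_cos k (y p) / k`!%:R) + (k == 0%N)%:R * G p.
exists (d0 / om), a_; split.
- by rewrite divr_gt0.
- move=> k; have sl : smooth_fun X (fun p => log_cos k (y p)).
    by apply: smooth_fun_log_cos => // p; exact: cpos.
  by rewrite /a_; smooth.
move=> h hr; rewrite in_itv /= => thab.
pose d := om * h.
have dh : `|d| < d0 by rewrite /d normrM gtr0_norm // mulrC -ltr_pdivlMr.
have hd1 : `|d| <= eta1 - eta by apply: le_trans (ltW dh) _; rewrite ge_min lexx.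
have hd2 : `|d| <= cos eta1 / 4 by apply: le_trans (ltW dh) _; rewrite ge_min lexx orbT.
have cvg1 : cinf_cvg X \oo (fun m => \sum_(k < m) d ^+ k *: (fun p => log_cos k (y p) / k`!%:R))
    (fun p => log_cos 0 (y p + d)).
  apply: (@log_cos_analytic_cvg _ _ eta1) => //.
    by move=> p; have := Heta p; lra.
  have -> : 2 * (cos eta1)^-1 * `|d| = 2 * (`|d| / cos eta1) by rewrite -mulrA [_^-1 * _]mulrC.
  have : `|d| / cos eta1 <= 4^-1 by rewrite ler_pdivrMr // mulrC.
  lra.
move=> i vi; have := cvg1 i vi; apply: cvg_trans; apply: near_eq_cvg.
near=> m; congr (cinf_seminorm i _); apply/funext => p.
have m0 : (0 < m)%N by near: m; exact: nbhs_infty_gt.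
rewrite !fctE !fct_sumE /=.
have -> : arc mu a b u0 u1 (t + h) p = G p + log_cos 0 (y p + d).
  rewrite /arc /great_circle -/om phase /G /=.
  have -> : om * (t + h - a) - phi p = y p + d by rewrite /y /d; ring.
  have cyd : 0 < cos (y p + d).
    by have := cpos _ p thab; rewrite (_ : om * (t + h - a) - phi p = y p + d) // /y /d; ring.
  rewrite lnM ?posrE ?divr_gt0 // ln_div ?posrE //; ring.
have -> : \sum_(k < m) (h ^+ k *: a_ k) p = \sum_(k < m) (d ^+ k *: (fun p => log_cos k (y p) / k`!%:R)) p + G p.
  have -> : G p = \sum_(k < m) h ^+ k * ((k == 0 :> nat)%:R * G p).
    rewrite (bigD1 (Ordinal m0)) //= big1 ?addr0 ?expr0 ?mul1r // => k k0.
    have -> : (k == 0 :> nat) = false by apply/negbTE; apply: contra k0 => /eqP e; apply/eqP/val_inj.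
    by rewrite mul0r mulr0.
  rewrite -big_split /=; apply: eq_bigr => k _.
  rewrite -[LHS]/(h ^+ k * (om ^+ k * (log_cos k (y p) / k`!%:R) + (k == 0 :> nat)%:R * G p)).
  rewrite -[(d ^+ k *: _) p]/(d ^+ k * (log_cos k (y p) / k`!%:R)).
  by rewrite mulrDr mulrA -exprMn [h * om]mulrC.
by rewrite opprD addrA addrK.
Unshelve. all: by end_near. Qed.

End AnalyticArc.

(** * Lengths of paths *)

Section UniformContinuity.
Context {R : realType}.
Implicit Types (I : set R).

Definition ucont (P : Type) I (F : R -> P -> R) (t : R) : Prop :=
  (exists B, forall p, `|F t p| <= B) /\
  forall e, 0 < e -> exists2 d, 0 < d &
    forall s, I s -> `|s - t| < d -> forall p, `|F s p - F t p| <= e.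

Lemma udiff_ucont (P : Type) I (F : R -> P -> R) t L : udiff I F t L -> ucont I F t.
Proof.
move=> [[B HB] H]; split; first by exists B => p; case: (HB p).
move=> e e0; have [d d0 Hd] := H 1 ltr01.
have B0 : 0 < 1 + `|B| by rewrite ltr_pwDl.
exists (Num.min d (e / (1 + `|B|))); first by rewrite lt_min d0 divr_gt0.
move=> s Is; rewrite lt_min => /andP[sd se] p; have h := Hd s Is sd p.
have -> : F s p - F t p = (F s p - F t p - (s - t) * L p) + (s - t) * L p by ring.
apply: le_trans (ler_normD _ _) _; apply: le_trans (lerD h (lexx _)) _.
have [_ hL] := HB p; rewrite mul1r normrM -[X in X + _]mulr1 -mulrDr.
apply: (@le_trans _ _ (`|s - t| * (1 + `|B|))).
  by rewrite ler_wpM2l // lerD2l (le_trans hL) // ler_norm.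
by rewrite -ler_pdivlMr // ltW.
Qed.

Lemma ucontM (P : Type) I (F G : R -> P -> R) t : ucont I F t -> ucont I G t ->
  ucont I (fun s p => F s p * G s p) t.
Proof.
move=> [[B0 HB0] HF] [[B0' HB0'] HG]; pose B := `|B0| + `|B0'| + 1.
have B1 : 1 <= B by rewrite lerDr addr_ge0.
have Bp : 0 < B by exact: lt_le_trans B1.
have hF p : `|F t p| <= B.
  by apply: le_trans (HB0 p) _; rewrite /B; have := ler_norm B0; have := normr_ge0 B0'; lra.
have hG p : `|G t p| <= B.
  by apply: le_trans (HB0' p) _; rewrite /B; have := ler_norm B0'; have := normr_ge0 B0; lra.
split; first by exists (B * B) => p; rewrite normrM ler_pM.
move=> e e0; pose e1 := Num.min 1 (e / (3 * B)).
have e10 : 0 < e1 by rewrite lt_min ltr01 divr_gt0 // mulr_gt0.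
have e11 : e1 <= 1 by rewrite ge_min lexx.
have e1e : e1 * (3 * B) <= e by rewrite -ler_pdivlMr ?mulr_gt0 // ge_min lexx orbT.
have [d d0 Hd] := HF _ e10; have [d' d'0 Hd'] := HG _ e10.
exists (Num.min d d'); first by rewrite lt_min d0.
move=> s Is; rewrite lt_min => /andP[/(Hd _ Is) h1 /(Hd' _ Is) h2] p.
have {}h1 := h1 p; have {}h2 := h2 p.
have -> : F s p * G s p - F t p * G t p = (F s p - F t p) * (G s p - G t p)
   + (F s p - F t p) * G t p + F t p * (G s p - G t p) by ring.
apply: le_trans e1e; have -> : e1 * (3 * B) = e1 * B + e1 * B + B * e1 by ring.
apply: le_trans (ler_normD _ _) _; apply: lerD; last by rewrite normrM ler_pM.
apply: le_trans (ler_normD _ _) _; apply: lerD; last by rewrite normrM ler_pM.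
by rewrite normrM ler_pM // (le_trans h2) // (le_trans e11).
Qed.

Lemma ucont_cst (P : Type) I (f : P -> R) t : (exists B, forall p, `|f p| <= B) ->
  ucont I (fun=> f) t.
Proof.
by move=> HB; split => // e e0; exists 1 => // s _ _ p; rewrite subrr normr0 ltW.
Qed.

Lemma ler_acos (x y : R) : -1 <= x -> x <= y -> y <= 1 -> acos y <= acos x.
Proof.
move=> x1 xy y1; have hx : -1 <= x <= 1 by rewrite x1 (le_trans xy).
have hy : -1 <= y <= 1 by rewrite y1 (le_trans x1).
rewrite leNgt -ltr_cos ?in_itv /= ?acos_ge0 ?acos_lepi // !acosK ?in_itv //=.
by rewrite -leNgt.
Qed.

Lemma cos_small (e : R) : 0 < e -> e <= 2^-1 -> [/\ 0 < cos e, cos e < 1 & acos (cos e) = e].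
Proof.
move=> e0 e1; have p2 := @pi_ge2 R; have e2 : e < pi / 2 by lra.
split; first by apply: cos_gt0_pihalf; rewrite e2 andbT; lra.
  by rewrite -cos0 ltr_cos ?in_itv /= ?lexx ?pi_ge0 ?(ltW e0) //=; lra.
by rewrite cosK // in_itv /= (ltW e0) /=; lra.
Qed.

(** Here [x] stands for the normalized inner product, [y] for its derivative and [l] for the speed.
    The contraction by [k] keeps the bound because [k ^ 2 * (1 - x ^ 2) <= 1 - (k * x) ^ 2]. *)
Lemma contracted_speed (v k x y l : R) : 0 < v -> 0 <= x <= 1 -> 0 < 1 - (k * x) ^+ 2 ->
  0 <= k <= 1 -> y ^+ 2 <= (1 - x ^+ 2) * (l ^+ 2 / (4 * v)) ->
  (2 * Num.sqrt v * (- (Num.sqrt (1 - (k * x) ^+ 2))^-1 * (k * y))) ^+ 2 <= l ^+ 2.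
Proof.
move=> v0 /andP[x0 x1] r0 /andP[k0 k1] h.
have k2 : k ^+ 2 <= 1 by rewrite expr_le1.
have r1 : k ^+ 2 * (1 - x ^+ 2) <= 1 - (k * x) ^+ 2 by rewrite exprMn; lra.
move: (1 - (k * x) ^+ 2) r0 r1 => r r0 r1.
rewrite !exprMn sqrrN exprVn !sqr_sqrtr ?(ltW v0) ?(ltW r0) //.
have -> : 2 ^+ 2 * v * (r^-1 * (k ^+ 2 * y ^+ 2)) =
  4 * v * (k ^+ 2 * y ^+ 2) / r by field; rewrite gt_eqF.
rewrite ler_pdivrMr // mulrC -ler_pdivlMr ?mulr_gt0 //.
apply: (@le_trans _ _ (k ^+ 2 * ((1 - x ^+ 2) * (l ^+ 2 / (4 * v))))).
  by rewrite ler_wpM2l // sqr_ge0.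
have -> : l ^+ 2 * r / (4 * v) = r * (l ^+ 2 / (4 * v)).
  by field; rewrite gt_eqF.
by rewrite mulrA; apply: ler_wpM2r => //; rewrite divr_ge0 ?sqr_ge0 ?mulr_ge0 // ltW.
Qed.

End UniformContinuity.

Section MinimalLength.
Context {R : realType} (n : nat) (M : ptopologicalType)
  (X : @closed_kahler R n M)
  (mu : {measure set (g_sigma_algebraType (@open M)) -> \bar R}).
Hypothesis hmu : is_kahler_volume X mu.
Local Notation VI := (vol_integral mu).
Local Notation V := (Vol mu).
Local Notation C := (calabi_space X mu).
#[local] Opaque expR vol_integral cos sin ln.

Lemma cinf_cvg_uniform (T : Type) (F : set_system T) (FF : Filter F) (f : T -> M -> R) g :
  cinf_cvg X F f g -> (\forall x \near F, smooth_fun X (f x)) -> smooth_fun X g ->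
  forall e, 0 < e -> \forall x \near F, forall p, `|f x p - g p| <= e.
Proof.
move=> fg sf sg e e0; have [m [i [vi Hi]]] := sup_norm_seminorm X.
(* Dividing by [m.+1] avoids a division by zero when [m = 0]. *)
have em : 0 < e / m.+1%:R by rewrite divr_gt0.
have H1 : \forall x \near F, forall j, cinf_seminorm (i j) (f x - g) <= e / m.+1%:R.
  apply: filter_forall => j; have /cvgr0Pnorm_le /(_ _ em) := fg _ (vi j).
  by apply: filterS => x /(le_trans (ler_norm _)).
apply: filterS2 H1 sf => x h1 sfx p.
have sfg : smooth_fun X (fun p => f x p - g p) by smooth.
apply: le_trans (Hi _ p sfg) _.
apply: le_trans (_ : \sum_(j < m) e / m.+1%:R <= _); first by apply: ler_sum => j _; exact: h1.
rewrite sumr_const card_ord -[_ *+ m]mulr_natr -mulrA ler_piMr ?(ltW e0) //.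
by rewrite mulrC ler_pdivrMr // mul1r ler_nat.
Qed.

Lemma ucont_VI (I : set R) (U : R -> M -> R) t : I t -> ucont I U t ->
  (forall s, I s -> continuous (U s)) ->
  VI (U s) @[s --> within I (nbhs t)] --> VI (U t).
Proof.
move=> It [_ H] cU; apply/cvgrPdist_le => e e0; have V0 := Vol_gt0 hmu.
have eV : 0 < e / V by rewrite divr_gt0.
have [d d0 Hd] := H _ eV; rewrite near_withinE; apply/nbhs_ballP; exists d => //= s ts Is.
have st : `|s - t| < d by rewrite distrC.
have cs := cU _ Is; have ct := cU _ It.
rewrite distrC -(VIB hmu) //.
apply: le_trans (VI_bound hmu (B := e / V) _ _) _; first by cont.
  by move=> p; exact: Hd.
by rewrite divfK // gt_eqF.
Qed.

Section C1Path.
Variables (a b : R) (c v : R -> M -> R).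
Hypothesis ab : a < b.
Let I : set R := `[a, b]%classic.
Hypothesis Cc : forall t, I t -> C (c t).
Hypothesis Hv : forall t, I t ->
    [/\ smooth_fun X (v t),
        cinf_cvg X (within I t^') (fun s => (s - t)^-1 *: (c s - c t)) (v t) &
        cinf_cvg X (within I (nbhs t)) v (v t)].

Let inI t : I t = (a <= t <= b).
Proof. by rewrite /I /= in_itv. Qed.

Let aI t : I t -> accum I t.
Proof. by rewrite inI; exact: accum_itv. Qed.

Let cc t : I t -> continuous (c t).
Proof. by move=> It; exact: (calabi_continuous (Cc It)). Qed.

Let cv t : I t -> continuous (v t).
Proof. by move=> It; have [sv _ _] := Hv It; exact: (smooth_fun_continuous sv). Qed.

Let dc t : I t -> udiff I c t (v t).
Proof.
move=> It; have [sv qv _] := Hv It; split.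
  have [B _ HB] := continuous_bounded X (cc It).
  have [B' _ HB'] := continuous_bounded X (cv It).
  exists (Num.max B B') => p; rewrite !le_max HB HB' orbT //.
move=> e e0.
have sq : \forall s \near within I t^', smooth_fun X ((s - t)^-1 *: (c s - c t)).
  rewrite near_withinE; near=> s => Is.
  have [sc _] := Cc Is; have [st _] := Cc It.
  have -> : (s - t)^-1 *: (c s - c t) = (fun p => (s - t)^-1 * (c s p - c t p)) by [].
  by smooth.
have := @cinf_cvg_uniform _ (within I t^') (within_filter I (dnbhs_filter t)) _ _ qv sq sv e e0.
rewrite !near_withinE => /nbhs_ballP[d /= d0 Hd]; exists d => // s Is sd p.
have [->|st] := eqVneq s t; first by rewrite !subrr mul0r subr0 normr0 mulr0.
have st0 : s - t != 0 by rewrite subr_eq0.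
have bs : ball t d s by rewrite /ball /= distrC.
have := Hd s bs st Is p; rewrite -[((s - t)^-1 *: (c s - c t)) p]/((s - t)^-1 * (c s p - c t p)) => h.
have -> : c s p - c t p - (s - t) * v t p = ((s - t)^-1 * (c s p - c t p) - v t p) * (s - t) by field.
by rewrite normrM ler_wpM2r.
Unshelve. all: by end_near. Qed.

Let uv t : I t -> ucont I v t.
Proof.
move=> It; have [sv _ vv] := Hv It; split.
  by have [B' _ HB'] := continuous_bounded X (cv It); exists B'.
move=> e e0.
have sq : \forall s \near within I (nbhs t), smooth_fun X (v s).
  by rewrite near_withinE; near=> s => Is; have [] := Hv Is.
have := @cinf_cvg_uniform _ (within I (nbhs t)) (within_filter I (nbhs_filter t)) _ _ vv sq sv e e0.
rewrite !near_withinE => /nbhs_ballP[d /= d0 Hd]; exists d => // s Is sd p.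
by apply: (Hd s) => //; rewrite /ball /= distrC.
Unshelve. all: by end_near. Qed.

Let velE t p : I t -> velocity I c t p = v t p.
Proof. by move=> It; apply: wderiv_derive_within; [exact: aI | exact: udiff_wderiv (dc It)]. Qed.

Let f t := half_exp (c t).
Let g t p := 2^-1 * (v t p * f t p).

Let fE : f = (fun s p => expR (2^-1 * c s p)).
Proof. by apply/funext => s; apply/funext => p; rewrite /f half_expE mulrC. Qed.

Let df t : I t -> udiff I f t (g t).
Proof.
move=> It; have B2 : exists B : R, forall p : M, `|2^-1 : R| <= B by exists `|2^-1|.
have h := udiff_expR (udiffM (udiff_cst I t B2) (dc It)).
rewrite fE; have -> // : g t = (fun p => expR (2^-1 * c t p) * (0 * c t p + 2^-1 * v t p)).
by apply/funext => p; rewrite /g fE; ring.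
Qed.

Let cf t : I t -> continuous (f t).
Proof. by move=> It; apply: half_exp_continuous; exact: cc. Qed.

Let cg t : I t -> continuous (g t).
Proof. by move=> It; have h1 := cf It; have h2 := cv It; rewrite /g; cont. Qed.

Let Ia : I a.
Proof. by rewrite inI lexx ltW. Qed.

Let Ib : I b.
Proof. by rewrite inI lexx ltW. Qed.

Let V0 : 0 < V.
Proof. exact: Vol_gt0 hmu. Qed.

Let psi t := VI (fun p => f t p * f a p) / V.
Let psi' t := VI (fun p => g t p * f a p) / V.
Let ell t := Num.sqrt (calabi_metric mu (c t) (v t) (v t)).

Let bfa : exists B, forall p, `|f a p| <= B.
Proof. by have [B _ HB] := continuous_bounded X (cf Ia); exists B. Qed.

Let psi_cosang t : I t -> psi t = cosang mu (c t) (c a).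
Proof. by move=> It; rewrite /psi /f (VI_half_expM hmu) mulrC mulKf // gt_eqF. Qed.

Let dpsi t : I t -> wderiv I psi t (psi' t).
Proof.
move=> It; have cfa := cf Ia; have cgt := cg It; have cft := cf It.
have h := wderiv_VI hmu It (udiffM (df It) (udiff_cst I t bfa)).
have {}h := h ltac:(by move=> s Is; have cfs := cf Is; cont) ltac:(by cont).
have := wderivZ V^-1 h.
have -> : psi = (fun s => V^-1 * VI (fun p => f s p * f a p)) by apply/funext => s; rewrite mulrC.
have -> // : psi' t = V^-1 * VI (fun p => g t p * f a p + f t p * 0).
by rewrite /psi' mulrC; congr (_ * _); apply: eq_VI => p; rewrite mulr0 addr0.
Qed.

Let cvg_psi' t : I t -> psi' s @[s --> within I (nbhs t)] --> psi' t.
Proof.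
move=> It; have B2 : exists B : R, forall p : M, `|2^-1 : R| <= B by exists `|2^-1|.
apply: cvgM; last exact: cvg_cst.
apply: (ucont_VI It) => [|s Is].
  apply: ucontM; last exact: ucont_cst.
  apply: ucontM; first exact: (ucont_cst I t B2).
  by apply: ucontM; [exact: uv | exact: udiff_ucont (df It)].
by have h1 := cg Is; have h2 := cf Ia; cont.
Qed.

Let cvg_ell t : I t -> ell s @[s --> within I (nbhs t)] --> ell t.
Proof.
move=> It; apply: (@cvg_comp _ _ _ (fun s => calabi_metric mu (c s) (v s) (v s)) Num.sqrt _ _ _ _ (@sqrt_continuous R _)).
apply: (@ucont_VI I (fun s p => v s p * v s p * expR (c s p)) t It) => [|s Is].
  apply: ucontM; first by apply: ucontM; exact: uv.
  exact: udiff_ucont (udiff_expR (dc It)).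
by have h1 := cv Is; have h2 := cc Is; cont.
Qed.

Let tangent t : I t -> VI (fun p => f t p * g t p) = 0.
Proof.
move=> It; have cft := cf It; have cgt := cg It.
have h := wderiv_VI hmu It (udiffM (df It) (df It)).
have {}h := h ltac:(by move=> s Is; have cfs := cf Is; cont) ltac:(by cont).
have z : VI (fun p => g t p * f t p + f t p * g t p) = 0.
  apply: wderiv_unique (aI It) h _.
  apply: (@wderiv_near _ _ (fun=> V) _ _ _ 1) => //; last exact: wderiv_cst.
  by move=> s Is _; rewrite -(VI_half_exp_sqr (Cc Is)); apply: eq_VI => p; rewrite expr2.
move: z; have -> : VI (fun p => g t p * f t p + f t p * g t p) = 2 * VI (fun p => f t p * g t p).
  by rewrite -(VIZ hmu); [apply: eq_VI => p; ring | cont].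
by move=> /eqP; rewrite mulf_eq0 pnatr_eq0 /= => /eqP.
Qed.

(** Cauchy-Schwarz with the part of [f a] orthogonal to [f t]: as [g t] is orthogonal to [f t], its
    product with this part is [V * psi' t], and the part has squared norm [V * (1 - psi t ^ 2)]. *)
Lemma speed_bound t : I t -> psi' t ^+ 2 <= (1 - psi t ^+ 2) * (ell t ^+ 2 / (4 * V)).
Proof.
move=> It; have cft := cf It; have cgt := cg It; have cfa := cf Ia; have cvt := cv It; have cct := cc It.
have cG : continuous (fun p => f a p - psi t * f t p) by cont.
have := VI_cauchy_schwarz hmu cG cgt.
have -> : VI (fun p => (f a p - psi t * f t p) * g t p) = V * psi' t.
  have -> : VI (fun p => (f a p - psi t * f t p) * g t p) =
    1 * VI (fun p => g t p * f a p) + (- psi t) * VI (fun p => f t p * g t p).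
    rewrite (VI_lin2 hmu); [apply: eq_VI => p; ring | by cont | by cont].
  by rewrite tangent // mulr0 addr0 mul1r /psi' mulrC divfK // gt_eqF.
have -> : VI (fun p => (f a p - psi t * f t p) ^+ 2) = V * (1 - psi t ^+ 2).
  have -> : VI (fun p => (f a p - psi t * f t p) ^+ 2) =
    1 * VI (fun p => f a p ^+ 2) + (psi t ^+ 2) * VI (fun p => f t p ^+ 2) +
    ((-2 * psi t) * VI (fun p => f t p * f a p) + 0 * VI (fun p => f t p * f a p)).
    by rewrite (VI_lin4 hmu); [apply: eq_VI => p; ring | by cont | by cont | by cont | by cont].
  have -> : VI (fun p => f t p * f a p) = V * psi t by rewrite /psi mulrC divfK // gt_eqF.
  by rewrite (VI_half_exp_sqr (Cc Ia)) (VI_half_exp_sqr (Cc It)); ring.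
have -> : VI (fun p => g t p ^+ 2) = ell t ^+ 2 / 4.
  rewrite sqr_sqrtr; last by apply: VI_ge0 => p; rewrite mulr_ge0 ?expR_ge0 // -expr2 sqr_ge0.
  rewrite [RHS]mulrC -(VIZ hmu); last by cont.
  by apply: eq_VI => p; rewrite /g -half_exp_sqr -/(f t p); field.
have -> : (V * psi' t) ^+ 2 = V ^+ 2 * psi' t ^+ 2 by ring.
have -> : V * (1 - psi t ^+ 2) * (ell t ^+ 2 / 4) = V ^+ 2 * ((1 - psi t ^+ 2) * (ell t ^+ 2 / (4 * V))).
  by field; rewrite gt_eqF.
by rewrite ler_pM2l ?exprn_gt0.
Qed.

Let psi01 t : I t -> 0 <= psi t <= 1.
Proof.
move=> It; rewrite psi_cosang // ltW; last by apply: (cosang_gt0 hmu); [exact: Cc | exact: Cc].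
by rewrite (cosang_le1 hmu (Cc It) (Cc Ia)).
Qed.

(** Since [psi a = 1], the slope of [acos] is infinite at the start of the path; with [k < 1] the
    argument remains inside the open interval, and the fundamental theorem of calculus applies on
    the whole of [I]. *)
Lemma contracted_acos_le k : 0 < k -> k < 1 ->
  2 * Num.sqrt V * (acos (k * psi b) - acos (k * psi a)) <= \int[@lebesgue_measure R]_(t in I) ell t.
Proof.
move=> k0 k1.
have kpsi t : I t -> -1 < k * psi t < 1.
  move=> It; have /andP[p0 p1] := psi01 It.
  have h0 : 0 <= k * psi t by rewrite mulr_ge0 // ltW.
  have h1 : k * psi t <= k by rewrite ler_piMr // ltW.
  lra.
have root_gt0 t : I t -> 0 < 1 - (k * psi t) ^+ 2.
  by move=> It; have /andP[h1 h2] := kpsi _ It; nra.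
pose A t := acos (k * psi t).
pose A' t := - (Num.sqrt (1 - (k * psi t) ^+ 2))^-1 * (k * psi' t).
have cpsi t : I t -> psi s @[s --> within I (nbhs t)] --> psi t.
  move=> It; have /subspace_continuousP h : {within `[a, b], continuous psi}.
    by apply: wderiv_continuous => s; rewrite -inI => Is; exists (psi' s); exact: dpsi.
  exact: h.
have ckpsi t : I t -> k * psi s @[s --> within I (nbhs t)] --> k * psi t.
  by move=> It; apply: cvgM; [exact: cvg_cst | exact: cpsi].
have cA : {within `[a, b], continuous A}.
  apply/subspace_continuousP => t It; apply: (@cvg_comp _ _ _ (fun s => k * psi s) acos _ _ _ (ckpsi _ It)).
  exact: continuous_acos (kpsi _ It).
have cA' : {within `[a, b], continuous A'}.
  apply/subspace_continuousP => t It; apply: cvgM.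
    apply: cvgN; apply: cvgV; first by rewrite gt_eqF // sqrtr_gt0 root_gt0.
    apply: continuous_cvg; first exact: (@sqrt_continuous R).
    apply: cvgB; first exact: cvg_cst.
    by rewrite expr2; under eq_cvg do rewrite expr2; apply: cvgM; exact: ckpsi.
  by apply: cvgM; [exact: cvg_cst | exact: cvg_psi'].
have cell : {within `[a, b], continuous ell} by apply/subspace_continuousP => t It; exact: cvg_ell.
have [_ Aa Ab] := (continuous_within_itvP A ab).1 cA.
have dA t : t \in `]a, b[ -> is_derive t 1 A (A' t).
  rewrite in_itv /= => tab; have It : I t by rewrite inI; case/andP: tab => /ltW -> /ltW ->.
  have h := wderiv_is_derive tab (wderivZ k (dpsi It)).
  have h2 := is_derive1_acos (kpsi _ It).
  exact: (@is_derive1_comp _ acos (fun s => k * psi s) t _ _ h2 h).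
have FTC : (\int[@lebesgue_measure R]_(t in `[a, b]) (A' t)%:E = (A b)%:E - (A a)%:E)%E.
  apply: (@continuous_FTC2 _ A' A a b ab cA').
    by split; [move=> t /dA[] | exact: Aa | exact: Ab].
  by move=> t /dA[_ <-]; rewrite derive1E.
have cpt : compact `[a, b] by exact: segment_compact.
have iA' := continuous_compact_integrable cpt cA'.
have iell := continuous_compact_integrable cpt cell.
have s0 : 0 < 2 * Num.sqrt V by rewrite mulr_gt0 // sqrtr_gt0.
have -> : acos (k * psi b) - acos (k * psi a) = \int[@lebesgue_measure R]_(t in I) A' t.
  by rewrite /Rintegral FTC.
rewrite -RintegralZl //; last exact: measurable_itv.
apply: le_Rintegral iell _; first exact: measurable_itv.
  apply: continuous_compact_integrable cpt _; apply/subspace_continuousP => t It.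
  by apply: cvgM; [exact: cvg_cst | move/subspace_continuousP: cA'; exact].
move=> t It; apply: le_trans (ler_norm _) _.
have ell0 : 0 <= ell t by exact: sqrtr_ge0.
rewrite -ler_sqr ?nnegrE // real_normK ?num_real //.
by apply: contracted_speed (speed_bound It); [|exact: psi01|exact: root_gt0|rewrite (ltW k0) ltW].
Qed.

Lemma path_length_speed : path_length mu a b c = \int[@lebesgue_measure R]_(t in I) ell t.
Proof.
apply: eq_Rintegral => t; rewrite inE => It; rewrite /ell; congr Num.sqrt.
by apply: eq_VI => p; rewrite velE.
Qed.

(** With [k = cos e] the value at the start is [acos k = e], while
    [acos (k * psi b) >= acos (psi b)]; the loss [e] is arbitrarily small. *)
Lemma le_path_length : 2 * Num.sqrt V * ang mu (c a) (c b) <= path_length mu a b c.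
Proof.
have s0 : 0 < 2 * Num.sqrt V by rewrite mulr_gt0 // sqrtr_gt0.
have psia : psi a = 1 by rewrite psi_cosang // (cosangxx hmu (Cc Ia)).
have /andP[pb0 pb1] := psi01 Ib.
rewrite path_length_speed; set L := Rintegral _ _ _.
have le_e e : 0 < e -> e <= 2^-1 -> 2 * Num.sqrt V * (ang mu (c a) (c b) - e) <= L.
  move=> e0 e1; have [k0 k1 acosk] := cos_small e0 e1.
  have := contracted_acos_le k0 k1; rewrite psia mulr1 acosk.
  apply: le_trans; rewrite ler_pM2l // lerD2r angC angE -psi_cosang //.
  apply: ler_acos => //; first by apply: le_trans (mulr_ge0 (ltW k0) pb0); rewrite oppr_le0.
  by rewrite ler_piMl // ltW.
rewrite leNgt; apply/negP => Llt.
pose d := 2 * Num.sqrt V * ang mu (c a) (c b) - L.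
have d0 : 0 < d by rewrite subr_gt0.
(* With this [e] at most half of the gap [d] is lost, which contradicts the bound just proved. *)
pose e := Num.min 2^-1 (d / (2 * (2 * Num.sqrt V))).
have e0 : 0 < e by rewrite lt_min invr_gt0 ltr0n /= divr_gt0 // mulr_gt0.
have e1 : e <= 2^-1 by rewrite ge_min lexx.
have he : e <= d / (2 * (2 * Num.sqrt V)) by rewrite /e ge_min lexx orbT.
have : e * (2 * (2 * Num.sqrt V)) <= d by rewrite -ler_pdivlMr //; exact: mulr_gt0.
have := le_e _ e0 e1; clear le_e Llt; move: d0; rewrite /d; clearbody e; clear he d e0 e1 s0 psia.
move: (2 * Num.sqrt V) (ang _ _ _) L => S g0 L; rewrite mulrBr; lra.
Qed.

End C1Path.

Lemma C1_path_length_ge a b c : a < b -> C1_path X mu a b c ->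
  2 * Num.sqrt V * ang mu (c a) (c b) <= path_length mu a b c.
Proof. by move=> ab [Cc [v Hv]]; apply: (le_path_length ab Cc Hv). Qed.

End MinimalLength.

(** * Analyticity of the distance *)

Section PowerSeriesComposition.
Context {R : realType}.

Definition set_entry (T : Type) (h : nat -> T) (i : nat) (y : T) : nat -> T :=
  fun j => if j == i then y else h j.

(** The part of degree [k] of a product of two series of multilinear forms: the first [i] arguments
    go to [P i], the following ones to the other factor. It is not symmetrized, analyticity being
    stated with multilinear forms and their diagonal values. *)
Definition cauchy_prod (T : Type) (P Q : nat -> (nat -> T) -> R) (k : nat) (h : nat -> T) : R :=
  \sum_(i < k.+1) P i h * Q (k - i)%N (fun j => h (i + j)%N).

Fixpoint cauchy_pow (T : Type) (P : nat -> (nat -> T) -> R) (m : nat) : nat -> (nat -> T) -> R :=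
  if m is m'.+1 then cauchy_prod P (cauchy_pow P m') else fun k _ => (k == 0)%:R.

(* A k-linear form on L, encoded as a function of the first k entries of an
   infinite sequence. *)
Definition multilinear_form (E : lmodType R) (L : set E) (k : nat) (P : (nat -> E) -> R) : Prop :=
  (forall h h', (forall i, (i < k)%N -> h i = h' i) -> P h = P h') /\
  forall h i a y z, (i < k)%N -> (forall j, L (h j)) -> L y -> L z ->
    P (set_entry h i (a *: y + z)) = a * P (set_entry h i y) + P (set_entry h i z).

Section MultilinearForms.
Variables (E : lmodType R) (L : set E) (P : nat -> (nat -> E) -> R).
Hypothesis mP : forall k, multilinear_form L k (P k).

Lemma multilinear_cauchy_prod (Q : nat -> (nat -> E) -> R) : (forall k, multilinear_form L k (Q k)) ->
  forall k, multilinear_form L k (cauchy_prod P Q k).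
Proof.
move=> mQ k; split=> [h h' hh|h i a y z ik Lh Ly Lz].
  apply: eq_bigr => i _; have ik : (i <= k)%N by rewrite -ltnS.
  congr (_ * _); first by apply: (mP i).1 => j ji; apply: hh; exact: leq_trans ji ik.
  by apply: (mQ _).1 => j ji; apply: hh; rewrite -ltn_subRL.
rewrite mulr_sumr -big_split; apply: eq_bigr => j _ /=.
have jk : (j <= k)%N by rewrite -ltnS.
have [ij|ji] := ltnP i j.
  have sh w : (fun l => set_entry h i w (j + l)%N) = (fun l => h (j + l)%N).
    by apply/funext => l; rewrite /set_entry gtn_eqF // ltn_addr.
  by rewrite !sh (mP j).2 //; ring.
have sh w : (fun l => set_entry h i w (j + l)%N) = set_entry (fun l => h (j + l)%N) (i - j) w.
  by apply/funext => l; rewrite /set_entry -{1}(subnKC ji) eqn_add2l.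
have Pu w : P j (set_entry h i w) = P j h.
  by apply: (mP j).1 => l lj; rewrite /set_entry ltn_eqF // (leq_trans lj).
by rewrite !sh !Pu (mQ _).2 //; [ring | rewrite ltn_sub2r // (leq_ltn_trans ji)].
Qed.

Lemma multilinear_cauchy_pow m k : multilinear_form L k (cauchy_pow P m k).
Proof.
elim: m k => [|m IH] k /=; last exact: multilinear_cauchy_prod.
by split=> // h [|i] a y z; case: k => //= k _ _ _ _; rewrite !mulr0 addr0.
Qed.

End MultilinearForms.

Section Bounds.
Variables (T : Type) (P : nat -> (nat -> T) -> R).
Hypothesis P0 : forall h, P 0%N h = 0.

(** Without constant term, the [m]-th power starts in degree [m], so each degree of the composed
    series receives finitely many terms. *)
Lemma cauchy_pow_eq0 m k h : (k < m)%N -> cauchy_pow P m k h = 0.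
Proof.
elim: m k h => // m IH k h km /=; rewrite /cauchy_prod big1 // => -[[|i] ik] _ /=.
  by rewrite P0 mul0r.
rewrite IH ?mulr0 //; apply: (@leq_trans k); last by rewrite -ltnS.
by rewrite ltn_subrL /=; case: k ik {km}.
Qed.

(** The factor [2 ^ k] bounds the number of ways to write [k] as an ordered sum of [m] positive
    integers, independently of [m]. *)
Lemma cauchy_pow_bound (L : set T) (q : T -> R) : (forall y, 0 <= q y) ->
  (forall k h, (forall j, L (h j)) -> `|P k h| <= \prod_(j < k) q (h j)) ->
  forall m k h, (forall j, L (h j)) -> `|cauchy_pow P m k h| <= 2 ^+ k * \prod_(j < k) q (h j).
Proof.
move=> q0 HP; elim=> [|m IH] k h Lh /=.
  case: k => [|k] /=; first by rewrite big_ord0 expr0 mulr1 normr1.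
  by rewrite normr0 mulr_ge0 ?exprn_ge0 ?prodr_ge0.
rewrite /cauchy_prod big_ord_recl P0 mul0r add0r.
apply: le_trans (ler_norm_sum _ _ _) _.
apply: (@le_trans _ _ (\sum_(i < k) 2 ^+ (k - i.+1) * \prod_(j < k) q (h j))).
  apply: ler_sum => i _; rewrite normrM !lift0 mulrC.
  have -> : \prod_(j < k) q (h j) = \prod_(j < i.+1) q (h j) * \prod_(j < k - i.+1) q (h (i.+1 + j)%N).
    rewrite -(big_mkord xpredT (fun j => q (h j))) (big_cat_nat _ (n := i.+1)) //=.
    rewrite big_mkord; congr (_ * _).
    have -> : \prod_(i.+1 <= l < k) q (h l) = \prod_(0 + i.+1 <= l < k) q (h l) by [].
    by rewrite big_addn big_mkord; apply: eq_bigr => j _; rewrite addnC.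
  rewrite mulrA [_ * \prod_(j < i.+1) _]mulrC -mulrA mulrC.
  by apply: ler_pM => //; [apply: HP | apply: IH].
rewrite -mulr_suml ler_wpM2r ?prodr_ge0 //.
rewrite (reindex_inj rev_ord_inj) /=.
have -> : \sum_(j < k) (2 : R) ^+ (k - (k - j.+1).+1) = \sum_(j < k) 2 ^+ j.
  by apply: eq_bigr => j _; congr (_ ^+ _); rewrite subnSK // subKn // ltnW.
elim: k {h Lh IH} => [|k IHk]; first by rewrite big_ord0.
by rewrite big_ord_recr /= exprS; lra.
Qed.

End Bounds.

Lemma sum_triangle (F : nat -> nat -> R) N :
  \sum_(k < N) \sum_(i < k.+1) F i (k - i)%N = \sum_(i < N) \sum_(j < N - i) F i j.
Proof.
elim: N => [|N IH]; first by rewrite !big_ord0.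
rewrite !big_ord_recr /= IH subnn addrA -big_split /=; congr (_ + _).
  apply: eq_bigr => i _; rewrite subSn ?big_ord_recr //; exact: ltnW.
by rewrite subSnn big_ord1.
Qed.

(** Induction on [m], splitting the error of a product into the error on the remaining power and
    that on the first factor. The former gives a geometric sum of ratio 1/2, because [P i] brings
    [x ^ i] where [(2 * x) ^ i] is available; the latter gives twice [3 ^ m], whence [3 ^ (m + 1)]
    in all. *)
Lemma cauchy_pow_approx (T : Type) (P : nat -> (nat -> T) -> R) (e : T) (x y : R) : 0 <= x ->
  P 0%N (fun=> e) = 0 -> (forall k, `|P k (fun=> e)| <= x ^+ k) ->
  (forall N, `|y - \sum_(i < N) P i (fun=> e)| <= 2 * x ^+ N) ->
  forall m N, `|y ^+ m - \sum_(k < N) cauchy_pow P m k (fun=> e)| <= 3 ^+ m * (2 * x) ^+ N.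
Proof.
move=> x0 P0 HP Hy; have X0 : 0 <= 2 * x by rewrite mulr_ge0.
have y3 : `|y| <= 3.
  by have := Hy 0%N; rewrite big_ord0 subr0 expr0; lra.
elim=> [|m IH] N.
  case: N => [|N]; first by rewrite big_ord0 subr0 !expr0 mulr1 normr1.
  rewrite big_ord_recl /= big1; last by move=> i _.
  by rewrite addr0 expr0 subrr normr0 mul1r exprn_ge0.
rewrite [X in y ^+ _ - X](_ : _ = \sum_(i < N) P i (fun=> e) *
    \sum_(j < N - i) cauchy_pow P m j (fun=> e)); last first.
  rewrite -(@sum_triangle (fun i j => P i (fun=> e) * cauchy_pow P m j (fun=> e))) in (RHS) || idtac.
  under [RHS]eq_bigr do rewrite mulr_sumr.
  by rewrite -(sum_triangle (fun i j => P i (fun=> e) * cauchy_pow P m j (fun=> e))).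
have -> : y ^+ m.+1 - \sum_(i < N) P i (fun=> e) * \sum_(j < N - i) cauchy_pow P m j (fun=> e) =
    \sum_(i < N) P i (fun=> e) * (y ^+ m - \sum_(j < N - i) cauchy_pow P m j (fun=> e)) +
    y ^+ m * (y - \sum_(i < N) P i (fun=> e)).
  under [X in _ = X + _]eq_bigr do rewrite mulrBr.
  by rewrite sumrB -mulr_suml exprSr; ring.
apply: le_trans (ler_normD _ _) _.
have -> : 3 ^+ m.+1 * (2 * x) ^+ N = 1 * (3 ^+ m * (2 * x) ^+ N) + 3 ^+ m * (2 * (2 * x) ^+ N).
  by rewrite exprS; ring.
apply: lerD; last first.
  have hm : `|y ^+ m| <= 3 ^+ m by rewrite normrX lerXn2r ?nnegrE.
  have hN : `|y - \sum_(i < N) P i (fun=> e)| <= 2 * (2 * x) ^+ N.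
    apply: le_trans (Hy N) _; rewrite ler_wpM2l // lerXn2r ?nnegrE //; lra.
  by rewrite normrM; apply: ler_pM.
apply: le_trans (ler_norm_sum _ _ _) _.
have half_sum n : \sum_(i < n) (if i == 0 :> nat then 0 else (2^-1 : R) ^+ i) <= 1.
  case: n => [|n]; first by rewrite big_ord0.
  suff -> : \sum_(i < n.+1) (if i == 0 :> nat then 0 else (2^-1 : R) ^+ i) = 1 - 2^-1 ^+ n.
    by rewrite gerBl exprn_ge0.
  elim: n => [|n IHn]; first by rewrite big_ord_recr big_ord0 /= expr0 subrr addr0.
  by rewrite big_ord_recr IHn /= exprS; lra.
apply: le_trans (_ : (\sum_(i < N) (if i == 0 :> nat then 0 else (2^-1 : R) ^+ i)) *
   (3 ^+ m * (2 * x) ^+ N) <= _); last by rewrite ler_wpM2r // mulr_ge0 ?exprn_ge0.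
rewrite mulr_suml; apply: ler_sum => -[[|i] iN] _ /=; first by rewrite P0 !mul0r normr0.
rewrite normrM; apply: le_trans (ler_pM _ _ (HP _) (IH _)) _ => //.
rewrite -{2}(subnKC (ltnW iN)) [(2 * x) ^+ (_ + _)]exprD [(2 * x) ^+ i.+1]exprMn.
rewrite le_eqVlt; apply/orP; left; apply/eqP.
have h : (2^-1 : R) ^+ i.+1 * 2 ^+ i.+1 = 1 by rewrite -exprMn mulVf ?expr1n // pnatr_eq0.
rewrite [RHS](_ : _ = ((2^-1 : R) ^+ i.+1 * 2 ^+ i.+1) * (x ^+ i.+1 * (3 ^+ m * (2 * x) ^+ (N - i.+1)))); last by ring.
by rewrite h mul1r.
Qed.

Definition acos_coef (c : R) (m : nat) : R := acos_diff m c / m`!%:R.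

(** [acos_diff_bound] is used at the midpoint [(1 + c) / 2] rather than at [c]: the Taylor remainder
    around [c] needs this margin, and the same constant then serves for both. *)
Lemma acos_coef_bound (c : R) m : 0 < c -> c < 1 -> `|acos_coef c m| <= (2 / (1 - c)) ^+ m.+1.
Proof.
move=> c0 c1; have d0 : 0 < 1 - c by lra.
have K2 : 2 <= 2 / (1 - c) by rewrite ler_pdivlMr //; lra.
case: m => [|m]; rewrite /acos_coef.
  have a0 : 0 <= acos c by apply: acos_ge0; apply/andP; split; lra.
  rewrite fact0 divr1 expr1 /= ger0_norm //.
  apply: le_trans (_ : pi / 2 <= _); last by have := @pihalf_lt2 R; lra.
  by rewrite -acos0; apply: ler_acos; lra.
have f0 : 0 < (m.+1)`!%:R :> R by rewrite ltr0n fact_gt0.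
rewrite normrM normfV (gtr0_norm f0) ler_pdivrMr // mulrC.
have -> : 2 / (1 - c) = (1 - (1 + c) / 2)^-1.
  by rewrite -[LHS]invrK invf_div; congr (_^-1); field.
by apply: acos_diff_bound => //; [rewrite gtr0_norm; lra | lra].
Qed.

(** Two errors are added: the Taylor remainder of [acos] at [c], and the truncation of the powers of
    [y]. The latter is a sum of [N] terms at most [K * (6 * K * x) ^ N]; since [6 * K * x <= 1 / 4]
    and [N <= 2 ^ N], it is at most [K / 2 ^ N]. *)
Lemma acos_series (T : Type) (P : nat -> (nat -> T) -> R) (e : T) (c x y : R) :
  0 < c -> c < 1 -> 0 <= x -> 48 * (2 / (1 - c)) * x <= 1 ->
  (forall h, P 0%N h = 0) -> (forall k, `|P k (fun=> e)| <= x ^+ k) ->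
  (forall N, `|y - \sum_(i < N) P i (fun=> e)| <= 2 * x ^+ N) ->
  series (fun k => \sum_(m < k.+1) acos_coef c m * cauchy_pow P m k (fun=> e)) @ \oo --> acos (c + y).
Proof.
move=> c0 c1 x0; have [K KE] : exists K : R, K = 2 / (1 - c) by eexists.
rewrite -KE => Kx P0 HP Hy.
have coef m : `|acos_coef c m| <= K ^+ m.+1 by rewrite KE; exact: acos_coef_bound.
have d0 : 0 < 1 - c by lra.
have K2 : 2 <= K by rewrite KE ler_pdivlMr //; lra.
have KV : K^-1 = (1 - c) / 2 by rewrite KE invf_div.
have Kp : 0 < K by lra.
have y2 : `|y| <= 2 * x.
  by have := Hy 1%N; rewrite big_ord_recl big_ord0 P0 addr0 subr0 expr1.
have yK : `|y| <= K^-1.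
  by apply: le_trans y2 _; rewrite -[K^-1]mul1r ler_pdivlMr //; nra.
have rem N : (0 < N)%N -> `|acos (c + y) - \sum_(m < N) acos_coef c m * y ^+ m| <= K * 2^-1 ^+ N.
  move=> N0.
  have near_c z : `|z - c| <= `|y| -> `|z| <= (1 + c) / 2.
    move=> zc; have : `|z - c| <= (1 - c) / 2 by rewrite -KV (le_trans zc).
    by rewrite ler_norml => /andP[? ?]; rewrite ler_norml; apply/andP; split; lra.
  have h1 k z : `|z - c| <= `|y| -> is_derive z 1 (acos_diff k) (acos_diff k.+1 z).
    move=> /near_c; rewrite ler_norml => /andP[? ?]; apply: acos_diff_derive; apply/andP; split; lra.
  have h2 z : `|z - c| <= `|y| -> `|acos_diff N z| <= N`!%:R * K ^+ N.+1.
    move=> /near_c zc; have -> : K = (1 - (1 + c) / 2)^-1 by rewrite -[LHS]invrK KV; congr (_^-1); field.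
    by apply: acos_diff_bound => //; lra.
  have := taylor_bound h1 h2; rewrite -[acos_diff 0 (c + y)]/(acos (c + y)).
  have -> : \sum_(k < N) y ^+ k * acos_diff k c / k`!%:R = \sum_(m < N) acos_coef c m * y ^+ m.
    by apply: eq_bigr => k _; rewrite /acos_coef; ring.
  move=> /le_trans; apply.
  have f0 : N`!%:R != 0 :> R by rewrite pnatr_eq0 -lt0n fact_gt0.
  have -> : N`!%:R * K ^+ N.+1 * `|y| ^+ N / N`!%:R = K * (K * `|y|) ^+ N.
    by rewrite exprS exprMn; field.
  rewrite ler_wpM2l ?(ltW Kp) // lerXn2r ?nnegrE ?mulr_ge0 ?(ltW Kp) //.
  by apply: le_trans (_ : K * (2 * x) <= _); [rewrite ler_wpM2l // ltW | nra].
have err N : (0 < N)%N -> `|acos (c + y) -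
    \sum_(k < N) \sum_(m < k.+1) acos_coef c m * cauchy_pow P m k (fun=> e)| <= 2 * K * 2^-1 ^+ N.
  move=> N0.
  (* The powers with [m > k] vanish in degree [k], so the triangle of summation may be completed to
     a square. *)
  have -> : \sum_(k < N) \sum_(m < k.+1) acos_coef c m * cauchy_pow P m k (fun=> e) =
      \sum_(m < N) acos_coef c m * \sum_(k < N) cauchy_pow P m k (fun=> e).
    under [RHS]eq_bigr do rewrite mulr_sumr.
    rewrite exchange_big /=; apply: eq_bigr => k _.
    rewrite (big_ord_widen N (fun m => acos_coef c m * cauchy_pow P m k (fun=> e))) // big_mkcond /=.
    by apply: eq_bigr => m _; case: ltnP => // km; rewrite cauchy_pow_eq0 // mulr0.
  have -> : acos (c + y) - \sum_(m < N) acos_coef c m * \sum_(k < N) cauchy_pow P m k (fun=> e) =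
     (acos (c + y) - \sum_(m < N) acos_coef c m * y ^+ m) +
     \sum_(m < N) acos_coef c m * (y ^+ m - \sum_(k < N) cauchy_pow P m k (fun=> e)).
    under [X in _ = _ + X]eq_bigr do rewrite mulrBr.
    by rewrite sumrB; ring.
  apply: le_trans (ler_normD _ _) _.
  have -> : 2 * K * 2^-1 ^+ N = K * 2^-1 ^+ N + K * 2^-1 ^+ N by ring.
  apply: lerD; first exact: rem.
  apply: le_trans (ler_norm_sum _ _ _) _.
  apply: (@le_trans _ _ (\sum_(m < N) K * (K * 3 * (2 * x)) ^+ N)).
    apply: ler_sum => m _; rewrite normrM.
    have h := cauchy_pow_approx x0 (P0 _) HP Hy m N.
    apply: le_trans (ler_pM _ _ (coef m) h) _ => //.
    have -> : K ^+ m.+1 * (3 ^+ m * (2 * x) ^+ N) = K * ((K * 3) ^+ m * (2 * x) ^+ N).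
      by rewrite exprS [(K * 3) ^+ m]exprMn; ring.
    have X0 : 0 <= 2 * x by rewrite mulr_ge0.
    rewrite [X in _ <= _ * X]exprMn ler_wpM2l ?(ltW Kp) // ler_wpM2r ?exprn_ge0 //.
    by rewrite ler_weXn2l ?(ltnW (ltn_ord m)) //; lra.
  rewrite sumr_const card_ord -[_ *+ N]mulr_natr -mulrA ler_wpM2l ?(ltW Kp) //.
  apply: (@le_trans _ _ ((4^-1) ^+ N * 2 ^+ N)).
    apply: ler_pM; rewrite ?exprn_ge0 ?mulr_ge0 ?(ltW Kp) //.
      rewrite lerXn2r ?nnegrE ?mulr_ge0 ?(ltW Kp) //; lra.
    by rewrite -natrX ler_nat ltnW // ltn_expl.
  by rewrite -exprMn lerXn2r ?nnegrE //; lra.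
have cv : 2 * K * 2^-1 ^+ N @[N --> \oo] --> (0 : R).
  by apply: (@cvg_geometric R (2 * K) 2^-1); rewrite ger0_norm //; lra.
apply/cvgrPdist_le => eps eps0; near=> N.
rewrite /series /= big_mkord; apply: le_trans (err N _) _; first by near: N; exact: nbhs_infty_gt.
have h0 : 0 <= 2 * K * 2^-1 ^+ N by rewrite mulr_ge0 ?exprn_ge0 // mulr_ge0 // ltW.
rewrite -(ger0_norm h0); near: N.
by move/cvgr0Pnorm_le : cv; apply.
Unshelve. all: by end_near. Qed.

End PowerSeriesComposition.

Section DistanceFormula.
Context {R : realType} (n : nat) (M : ptopologicalType)
  (X : @closed_kahler R n M)
  (mu : {measure set (g_sigma_algebraType (@open M)) -> \bar R}).
Hypothesis hmu : is_kahler_volume X mu.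
Local Notation VI := (vol_integral mu).
Local Notation V := (Vol mu).
Local Notation C := (calabi_space X mu).
#[local] Opaque expR vol_integral cos sin ln.

(** All geodesics between two points have the same length, whatever their parameter interval, and at
    least one exists; so the [xget] of [calabi_dist] does not fall back on its default. *)
Lemma geodesic_lengthsE u0 u1 : C u0 -> C u1 ->
  geodesic_lengths X mu u0 u1 = [set 2 * Num.sqrt V * ang mu u0 u1].
Proof.
move=> C0 C1.
have sub : geodesic_lengths X mu u0 u1 `<=` [set 2 * Num.sqrt V * ang mu u0 u1].
  move=> l [a [b [u [ab [gu ua ub] ->]]]].
  by have [om [_ _ _ h _]] := geodesic_form hmu ab gu; rewrite /= h ua ub.
apply/seteqP; split => // _ ->.
have [u gu] : exists u, geodesic_joining X mu 0 1 u0 u1 u.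
  have [->|ne] := pselect (u0 = u1).
    by exists (fun=> u1); apply: constant_geodesic.
  by exists (arc mu 0 1 u0 u1); apply: arc_geodesic.
have h : geodesic_lengths X mu u0 u1 (path_length mu 0 1 u) by exists 0, 1, u.
by rewrite -(sub _ h).
Qed.

Lemma calabi_distE u0 u1 : C u0 -> C u1 ->
  calabi_dist X mu u0 u1 = 2 * Num.sqrt V * ang mu u0 u1.
Proof.
by move=> C0 C1; rewrite /calabi_dist geodesic_lengthsE //; apply: xget_unique => // y ->.
Qed.

End DistanceFormula.

Section DistanceAnalytic.
Context {R : realType} (n : nat) (M : ptopologicalType)
  (X : @closed_kahler R n M)
  (mu : {measure set (g_sigma_algebraType (@open M)) -> \bar R}).
Hypothesis hmu : is_kahler_volume X mu.
Local Notation VI := (vol_integral mu).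
Local Notation V := (Vol mu).
Local Notation C := (calabi_space X mu).
Local Notation E := ((M -> R) * (M -> R))%type.
#[local] Opaque expR vol_integral cos sin ln.

Lemma continuous_prod k (F : 'I_k -> M -> R) : (forall j, continuous (F j)) ->
  continuous (fun p => \prod_(j < k) F j p).
Proof.
elim: k F => [|k IH] F cF; first by under eq_fun do rewrite big_ord0; exact: cont_cst.
under eq_fun do rewrite big_ord_recl.
by apply: contM; [exact: cF | apply: IH => j; exact: cF].
Qed.

(** The terms of degree below [k] of [expR s - 1]; the zero kept in degree 0 aligns the degrees with
    those of [form]. *)
Let exp_tail (k : nat) (s : R) : R := \sum_(i < k) (if i == 0 :> nat then 0 else s ^+ i / i`!%:R).

Let exp_tail_bound k (s x : R) : `|s| <= x -> x <= 4^-1 ->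
  `|expR s - 1 - exp_tail k s| <= 2 * x ^+ k.
Proof.
move=> sx x4; have x0 : 0 <= x by apply: le_trans sx.
have exp2 z : `|z - 0| <= `|s| -> `|expR z| <= 2.
  rewrite subr0 => zs; have : `|z| <= 4^-1 by rewrite (le_trans zs) // (le_trans sx).
  rewrite ler_norml => /andP[z1 z2]; rewrite ger0_norm ?expR_ge0 //.
  have h := expR_ge1Dx (- z); have e0 := expR_gt0 z.
  have : expR z * expR (- z) = 1 by rewrite -expRD subrr expR0.
  by nra.
have tb N : (0 < N)%N -> `|expR s - 1 - exp_tail N s| <= 2 * x ^+ N.
  move=> N0.
  have := @taylor_bound R (fun=> expR) N 2 0 s (fun _ z _ => is_derive_expR z) exp2; rewrite add0r.
  have -> : expR s - \sum_(k0 < N) s ^+ k0 * expR 0 / k0`!%:R = expR s - 1 - exp_tail N s.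
    rewrite /exp_tail; case: N N0 => // N _; rewrite !big_ord_recl /= expR0 fact0 expr0 mulr1 divr1 add0r opprD addrA.
    by congr (_ - _); apply: eq_bigr => i _; rewrite mulr1.
  move=> /le_trans; apply; rewrite ler_pdivrMr ?ltr0n ?fact_gt0 // -mulrA ler_wpM2l //.
  apply: le_trans (_ : x ^+ N <= _); first by rewrite lerXn2r ?nnegrE.
  by rewrite ler_peMr ?exprn_ge0 // ler1n fact_gt0.
case: k => [|k]; last exact: tb.
have := tb 1%N isT; rewrite /exp_tail big_ord0 big_ord1 /= expr0 expr1 !subr0; lra.
Qed.

Section AtPair.
Variable z : E.
Hypotheses (C1 : C z.1) (C2 : C z.2) (ne : z.1 <> z.2).
Let c := cosang mu z.1 z.2.
Let w p := half_exp z.1 p * half_exp z.2 p.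
Let mid (h : E) p := 2^-1 * (h.1 p + h.2 p).
(** The part of degree [k] of [cosang] at [z + h], with the constant [c] removed: the product of the
    half-densities at [z + h] is [w * expR (mid h)]. *)
Let form (k : nat) (h : nat -> E) : R :=
  if k is 0 then 0 else VI (fun p => w p * \prod_(j < k) mid (h j) p) / (V * k`!%:R).

Let V0 : 0 < V. Proof. exact: Vol_gt0 hmu. Qed.

Let cw : continuous w.
Proof.
have h1 := half_exp_continuous (calabi_continuous C1).
by have h2 := half_exp_continuous (calabi_continuous C2); rewrite /w; cont.
Qed.

Let w0 p : 0 <= w p. Proof. by rewrite mulr_ge0 // ltW // half_exp_gt0. Qed.

Let VIw : VI w = V * c. Proof. exact: (VI_half_expM hmu). Qed.

Let c0 : 0 < c. Proof. by apply: (cosang_gt0 hmu); [exact: C1 | exact: C2]. Qed.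

Let c1 : c < 1.
Proof.
rewrite lt_neqAle (cosang_le1 hmu C1 C2) andbT.
by apply/eqP => /(cosang_eq1 hmu C1 C2).
Qed.

Let cmid h : smooth_pair X h -> continuous (mid h).
Proof.
by move=> [/smooth_fun_continuous s1 /smooth_fun_continuous s2]; rewrite /mid; cont.
Qed.

Let multilinear_form_form k : multilinear_form (smooth_pair X) k (form k).
Proof.
case: k => [|k]; split=> //.
  move=> h h' hh; congr (_ / _); apply: eq_VI => p; congr (_ * _).
  by apply: eq_bigr => j _; rewrite hh.
move=> h i a y y' ik Lh Ly Ly'.
have Lset v : smooth_pair X v -> forall j, smooth_pair X (set_entry h i v j).
  by move=> Lv j; rewrite /set_entry; case: eqP.
have cp v : smooth_pair X v -> continuous (fun p => w p * \prod_(j < k.+1) mid (set_entry h i v j) p).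
  move=> Lv; have cpr : continuous (fun p => \prod_(j < k.+1) mid (set_entry h i v j) p).
    by apply: continuous_prod => j; apply: cmid; exact: Lset.
  by cont.
have cy := cp _ Ly; have cy' := cp _ Ly'.
rewrite /form mulrA -mulrDl; congr (_ / _).
rewrite -[VI (fun p => w p * \prod_(j < k.+1) mid (set_entry h i y' j) p)]mul1r (VI_lin2 hmu) //.
apply: eq_VI => p.
have pr v : \prod_(j < k.+1) mid (set_entry h i v j) p =
    mid v p * \prod_(j < k.+1 | j != Ordinal ik) mid (h j) p.
  rewrite (bigD1 (Ordinal ik)) //= /set_entry eqxx; congr (_ * _).
  by apply: eq_bigr => j ji; case: eqP => // e; case/eqP: ji; apply: val_inj.
rewrite !pr.
have -> : mid (a *: y + y') p = a * mid y p + mid y' p.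
  by rewrite /mid -[(a *: y + y').1 p]/(a * y.1 p + y'.1 p) -[(a *: y + y').2 p]/(a * y.2 p + y'.2 p); ring.
by ring.
Qed.

Let form_bound (q : E -> R) : (forall h, 0 <= q h) ->
  (forall h p, smooth_pair X h -> `|mid h p| <= q h) ->
  forall k h, (forall j, smooth_pair X (h j)) -> `|form k h| <= \prod_(j < k) q (h j).
Proof.
move=> q0 Hq [|k] h Lh; first by rewrite normr0 big_ord0.
have Q0 : 0 <= \prod_(j < k.+1) q (h j) by apply: prodr_ge0.
have cpr : continuous (fun p => \prod_(j < k.+1) mid (h j) p).
  by apply: continuous_prod => j; apply: cmid.
have cf : continuous (fun p => w p * \prod_(j < k.+1) mid (h j) p) by cont.
have Vk : 0 < V * (k.+1)`!%:R by rewrite mulr_gt0 // ltr0n fact_gt0.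
rewrite /form normrM normfV (gtr0_norm Vk) ler_pdivrMr //.
apply: le_trans (VI_norm hmu cf) _.
apply: (@le_trans _ _ (VI (fun p => (\prod_(j < k.+1) q (h j)) * w p))).
  apply: (le_VI hmu); [by cont | by cont |] => p.
  rewrite normrM (ger0_norm (w0 p)) mulrC ler_wpM2r // normr_prod.
  by apply: ler_prod => j _; rewrite normr_ge0 Hq.
rewrite (VIZ hmu) // VIw ler_wpM2l // ler_pM2l //.
by apply: le_trans (ltW c1) _; rewrite ler1n fact_gt0.
Qed.

Let cont_tail (N : nat) h : smooth_pair X h -> continuous (fun p => exp_tail N (mid h p)).
Proof.
move=> /cmid cm; rewrite /exp_tail; elim: N => [|N IH].
  by under eq_fun do rewrite big_ord0; exact: cont_cst.
under eq_fun do rewrite big_ord_recr /=.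
have ct : continuous (fun p => if N == 0 :> nat then 0 else mid h p ^+ N / N`!%:R).
  by case: eqP => _; cont.
exact: contD IH ct.
Qed.

Let form_sum h N : smooth_pair X h ->
  \sum_(i < N) form i (fun=> h) = VI (fun p => w p * exp_tail N (mid h p)) / V.
Proof.
move=> Lh; have cm := cmid Lh; elim: N => [|N IH].
  rewrite big_ord0 (_ : VI _ = 0) ?mul0r //.
  rewrite (_ : (fun p => _) = (fun=> 0)); first by rewrite (VI_cst mu) mul0r.
  by apply/funext => p; rewrite /exp_tail big_ord0 mulr0.
have cT : continuous (fun p => exp_tail N (mid h p)) by exact: cont_tail.
rewrite big_ord_recr /= IH; case: N IH cT => [|N] IH cT.
  by rewrite addr0; congr (_ / _); apply: eq_VI => p; rewrite /exp_tail big_ord1 big_ord0.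
have -> : form N.+1 (fun=> h) = VI (fun p => w p * mid h p ^+ N.+1) / (V * (N.+1)`!%:R).
  by congr (_ / _); apply: eq_VI => p; rewrite prodr_const card_ord.
have -> : VI (fun p => w p * exp_tail N.+2 (mid h p)) =
  1 * VI (fun p => w p * exp_tail N.+1 (mid h p)) + (N.+1)`!%:R^-1 * VI (fun p => w p * mid h p ^+ N.+1).
  rewrite (VI_lin2 hmu); [| by cont | by cont]; apply: eq_VI => p.
  by rewrite /exp_tail [in LHS]big_ord_recr /=; ring.
have f0 : (N.+1)`!%:R != 0 :> R by rewrite pnatr_eq0 -lt0n fact_gt0.
by field; rewrite f0 gt_eqF.
Qed.

Let form_approx h x : smooth_pair X h -> (forall p, `|mid h p| <= x) -> x <= 4^-1 ->
  forall N, `|cosang mu (z + h).1 (z + h).2 - c - \sum_(i < N) form i (fun=> h)| <= 2 * x ^+ N.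
Proof.
move=> Lh Hx x4 N; have cm := cmid Lh.
have x0 : 0 <= x by apply: le_trans (Hx point).
have cT : continuous (fun p => exp_tail N (mid h p)) by exact: cont_tail.
have -> : cosang mu (z + h).1 (z + h).2 - c - \sum_(i < N) form i (fun=> h) =
    VI (fun p => w p * (expR (mid h p) - 1 - exp_tail N (mid h p))) / V.
  rewrite form_sum //.
  have -> : c = VI w / V by rewrite VIw mulrC mulKf // gt_eqF.
  have -> : cosang mu (z + h).1 (z + h).2 = VI (fun p => w p * expR (mid h p)) / V.
    congr (_ / _); apply: eq_VI => p; rewrite /w half_expM -expRD; congr expR.
    by rewrite /mid -[(z + h).1 p]/(z.1 p + h.1 p) -[(z + h).2 p]/(z.2 p + h.2 p); field.
  rewrite -!mulrBl -(VIB hmu); [| by cont | by cont].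
  rewrite -(VIB hmu); [| by cont | by cont].
  by congr (_ / _); apply: eq_VI => p; ring.
rewrite normrM normfV (gtr0_norm V0) ler_pdivrMr //.
have cf : continuous (fun p => w p * (expR (mid h p) - 1 - exp_tail N (mid h p))) by cont.
apply: le_trans (VI_norm hmu cf) _.
apply: (@le_trans _ _ (VI (fun p => (2 * x ^+ N) * w p))).
  apply: (le_VI hmu); [by cont | by cont |] => p.
  by rewrite normrM (ger0_norm (w0 p)) mulrC ler_wpM2r // exp_tail_bound.
rewrite (VIZ hmu) // VIw ler_wpM2l ?mulr_ge0 ?exprn_ge0 //.
by rewrite ler_piMr // ltW.
Qed.

(** Passes between the forms on ['I_k -> E] of the definition of analyticity and those on
    sequences. *)
Let ext k (h : 'I_k -> E) (i : nat) : E := if insub i is Some j then h j else 0.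

Let ext_ord k (h : 'I_k -> E) (i : 'I_k) : ext h i = h i.
Proof. by rewrite /ext valK. Qed.

Let ext_upd k (h : 'I_k -> E) i y : ext (dfwith h i y) = set_entry (ext h) i y.
Proof.
apply/funext => j; rewrite /set_entry /ext; case: insubP => [j' _ <-|jk]; last first.
  by case: eqP jk => // ->; rewrite ltn_ord.
have [ij|] := eqVneq i j'; first by rewrite ij eqxx dfwithin.
move=> ij; rewrite dfwithout //; case: eqP => // e.
by case/eqP: ij; apply: val_inj.
Qed.

Lemma dist_analytic_at : exists (q : E -> R) (B : R) (P : forall k, ('I_k -> E) -> R),
    [/\ cinf_seminorm2 X q,
        forall k i (h : 'I_k -> E) a y y', (forall j, smooth_pair X (h j)) ->
          smooth_pair X y -> smooth_pair X y' ->
          P k (dfwith h i (a *: y + y')) = a * P k (dfwith h i y) + P k (dfwith h i y'),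
        forall k (h : 'I_k -> E), (forall j, smooth_pair X (h j)) ->
          `|P k h| <= B * \prod_j q (h j) &
        forall h, smooth_pair X h -> q h < 1 -> C (z + h).1 -> C (z + h).2 ->
          series (fun k => P k (fun=> h)) @ \oo --> calabi_dist X mu (z + h).1 (z + h).2].
Proof.
have [m [i [vi Hi]]] := sup_norm_seminorm X.
have [K KE] : exists K : R, K = 2 / (1 - c) by eexists.
have d0 : 0 < 1 - c by have := c1; lra.
have K2 : 2 <= K by rewrite KE ler_pdivlMr //; have := c0; lra.
pose S (h : E) := \sum_j (cinf_seminorm (i j) h.1 + cinf_seminorm (i j) h.2).
have S0 h : 0 <= S h by apply: sumr_ge0 => j _; rewrite addr_ge0 ?seminorm_ge0.
pose q0 h := 2^-1 * S h.
have q00 h : 0 <= q0 h by rewrite mulr_ge0.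
have Hq h p : smooth_pair X h -> `|mid h p| <= q0 h.
  move=> [s1 s2]; rewrite /mid /q0 normrM ger0_norm // ler_wpM2l //.
  apply: le_trans (ler_normD _ _) _; rewrite /S big_split /=.
  by apply: lerD; exact: Hi.
have s0 : 0 <= 2 * Num.sqrt V by rewrite mulr_ge0 ?sqrtr_ge0.
pose P k (h : 'I_k -> E) := 2 * Num.sqrt V *
  \sum_(l < k.+1) acos_coef c l * cauchy_pow form l k (ext h).
(* [24 * K * S] is [48 * K * q0], so that [q h < 1] gives the convergence condition of
   [acos_series]. It also absorbs the bound in degree [k]: there are [k + 1] terms, each at most
   [K ^ (k + 1) * 2 ^ k] times the product of the [q0], and [k + 1 <= 24 ^ k]. *)
exists (fun h => 24 * K * S h), (2 * Num.sqrt V * K), P; split.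
- by exists (24 * K), m, i; split => //; lra.
- move=> k j h a y y' Lh Ly Ly'; rewrite /P !ext_upd.
  have Lext l : smooth_pair X (ext h l).
    rewrite /ext; case: insubP => [l' _ _|_]; first exact: Lh.
    by split; exact: smooth_fun_cst.
  rewrite mulrCA -mulrDr; congr (_ * _); rewrite mulr_sumr -big_split; apply: eq_bigr => l _ /=.
  by rewrite (multilinear_cauchy_pow multilinear_form_form l k).2 //; ring.
- move=> k h Lh; rewrite /P normrM (ger0_norm s0) -[X in _ <= X]mulrA ler_wpM2l //.
  have Lext l : smooth_pair X (ext h l).
    rewrite /ext; case: insubP => [l' _ _|_]; first exact: Lh.
    by split; exact: smooth_fun_cst.
  have Q0 : 0 <= \prod_(j < k) q0 (h j) by apply: prodr_ge0.
  have bd l : `|cauchy_pow form l k (ext h)| <= 2 ^+ k * \prod_(j < k) q0 (h j).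
    have := cauchy_pow_bound (P := form) (fun=> erefl) q00 (form_bound q00 Hq) l k Lext.
    by under eq_bigr do rewrite ext_ord.
  apply: le_trans (ler_norm_sum _ _ _) _.
  apply: (@le_trans _ _ (\sum_(l < k.+1) K ^+ k.+1 * (2 ^+ k * \prod_(j < k) q0 (h j)))).
    apply: ler_sum => l _; rewrite normrM; apply: ler_pM => //.
    apply: le_trans (acos_coef_bound l c0 c1) _; rewrite -KE ler_weXn2l //.
    by lra.
  rewrite sumr_const card_ord -[_ *+ _]mulr_natr.
  have -> : \prod_j (24 * K * S (h j)) = (48 * K) ^+ k * \prod_(j < k) q0 (h j).
    have -> : (48 * K) ^+ k = \prod_(j < k) (48 * K) by rewrite prodr_const card_ord.
    rewrite -big_split /=.
    by apply: eq_bigr => j _; rewrite /q0; field.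
  have -> : K ^+ k.+1 * (2 ^+ k * \prod_(j < k) q0 (h j)) * k.+1%:R =
     K * ((2 * K) ^+ k * k.+1%:R * \prod_(j < k) q0 (h j)) by rewrite [(2 * K) ^+ k]exprMn exprS; ring.
  rewrite ler_wpM2l //; first by lra.
  rewrite ler_wpM2r //.
  have -> : 48 * K = 24 * (2 * K) by ring.
  rewrite [X in _ <= X]exprMn mulrC ler_wpM2r ?exprn_ge0 //; first by lra.
  by rewrite -natrX ler_nat ltn_expl.
move=> h Lh qh Ch1 Ch2.
pose x := q0 h.
have x48 : 48 * K * x <= 1 by apply: ltW; move: qh; rewrite /x /q0; have -> : 48 * K * (2^-1 * S h) = 24 * K * S h by field.
have x0 : 0 <= x by exact: q00.
have x4 : x <= 4^-1 by nra.
have Hx p : `|mid h p| <= x by exact: Hq.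
rewrite (calabi_distE hmu) // angE.
have -> : cosang mu (z + h).1 (z + h).2 = c + (cosang mu (z + h).1 (z + h).2 - c) by ring.
have fb k : `|form k (fun=> h)| <= x ^+ k.
  apply: le_trans (form_bound q00 Hq k (h := fun=> h) (fun=> Lh)) _.
  by rewrite prodr_const card_ord.
rewrite KE in x48.
have := acos_series c0 c1 x0 x48 (P := form) (fun=> erefl) fb (form_approx Lh Hx x4).
move=> /(cvgM (cvg_cst (2 * Num.sqrt V))).
move=> H; suff -> : series (fun k => P k (fun=> h)) = (fun=> 2 * Num.sqrt V) \*
   series (fun k => \sum_(l < k.+1) acos_coef c l * cauchy_pow form l k (fun=> h)) by [].
apply/funext => N; rewrite /series /= mulr_sumr; apply: eq_bigr => k _.
rewrite /P; congr (_ * _); apply: eq_bigr => l _; congr (_ * _).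
apply: (multilinear_cauchy_pow multilinear_form_form l k).1 => j jk.
by rewrite -[j]/(nat_of_ord (Ordinal jk)) ext_ord.
Qed.

End AtPair.

Lemma calabi_dist_analytic : analytic_within (smooth_pair X) (cinf_seminorm2 X)
  [set z : E | [/\ C z.1, C z.2 & z.1 <> z.2]] (fun z => calabi_dist X mu z.1 z.2).
Proof.
move=> z [C1 C2 ne]; have [q [B [P [h1 h2 h3 h4]]]] := dist_analytic_at C1 C2 ne.
exists q, B, P; split; [exact: h1 | exact: h2 | exact: h3 |].
by move=> h Lh qh [Ch1 Ch2 _]; exact: (h4 h Lh qh Ch1 Ch2).
Qed.

End DistanceAnalytic.

(** * Curvature and diameter *)

Section Postcomposition.
Context {R : realType} {V : normedModType R}.

Lemma smooth_on_postcomp (W W' : normedModType R) (L : {linear W -> W'}) (U : set V) (f : V -> W) :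
  continuous L -> open U -> smooth_on U f -> smooth_on U (L \o f).
Proof.
move=> cL oU sf0; have dL y : differentiable L y by exact: linear_differentiable.
have dLf (g : V -> W) x : differentiable g x -> differentiable (L \o g) x.
  by move=> dg; exact: differentiable_comp.
apply/smooth_onP => k.
elim: k f sf0 => [|k IH] f /[dup] sf0 /smooth_onP sf.
  by apply/Ck0 => x Ux; apply: dLf; exact: Ck_diff (sf 0%N) Ux.
apply/CkS; split=> [x Ux|v]; first by apply: dLf; exact: Ck_diff (sf 0%N) Ux.
apply: Ck_eq (IH ('D_v f) _) => //; last exact: smooth_on_derive.
move=> x Ux; have df := Ck_diff (sf 0%N) Ux.
have dLf' : differentiable (L \o f) x by exact: dLf.
by rewrite /= [RHS]deriveE // diff_comp //= diff_lin // deriveE.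
Qed.

End Postcomposition.

(** * Bump functions on the manifold *)

Section BumpFunctions.
Context {R : realType} (n : nat) (M : ptopologicalType)
  (X : @closed_kahler R n M)
  (mu : {measure set (g_sigma_algebraType (@open M)) -> \bar R}).
Hypothesis hmu : is_kahler_volume X mu.
Local Notation VI := (vol_integral mu).
Local Notation V := (Vol mu).
Local Notation E := 'rV[R]_(n + n).
Local Notation coord := Defs.coord.
#[local] Opaque expR vol_integral cos sin ln flat_bump.

Lemma entry_continuous_linear (j : 'I_(n + n)) :
  exists L : {linear E -> R^o}, continuous L /\ forall z, L z = z ord0 j.
Proof.
have lf : linear (fun z : E => z ord0 j : R^o) by move=> a y z; rewrite !mxE.
pose LM := GRing.isLinear.Build _ _ _ _ (fun z : E => z ord0 j : R^o) lf.
pose L : {linear E -> R^o} := HB.pack (fun z : E => z ord0 j : R^o) LM.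
exists L; split => // x; apply/(@cvgrPdist_lt _ _ _ _ (nbhs_filter (x : E))) => e e0; apply: (@filterS _ (nbhs (x : E)) (nbhs_filter (x : E)) _ _ _ (box_nbhs x e0)) => z H.
by rewrite distrC; exact: H.
Qed.

Lemma smooth_on_entry (W : normedModType R) (U : set W) (f : W -> E) j : open U ->
  smooth_on U f -> smooth_on U (fun x => f x ord0 j : R).
Proof.
move=> oU sf; have [L [cL LE]] := entry_continuous_linear j.
have -> : (fun x => f x ord0 j : R) = L \o f by apply/funext => x; rewrite /= LE.
exact: smooth_on_postcomp.
Qed.

Definition chart_bump (c : @chart R n M) (x : E) (r : R) (p : M) : R :=
  if `[< dom c p >] then flat_bump (r ^+ 2 - \sum_j (coord c p ord0 j - x ord0 j) ^+ 2) else 0.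

Section ChartBump.
Variables (c : @chart R n M) (x : E) (r : R).
Hypotheses (ac : atlas X c) (r0 : 0 < r).
Let K : set E := [set z | forall j, `[x ord0 j - r, x ord0 j + r]%classic (z ord0 j)].
Hypothesis Kc : K `<=` codom_of c.

Lemma chart_bump_ge0 p : 0 <= chart_bump c x r p.
Proof. by rewrite /chart_bump; case: ifP => // _; exact: flat_bump_ge0. Qed.

Lemma chart_bump_support p : chart_bump c x r p != 0 ->
  dom c p /\ forall j, `|coord c p ord0 j - x ord0 j| <= r.
Proof.
rewrite /chart_bump; case: asboolP => [dp|_]; last by rewrite eqxx.
set s := \sum_j _; move=> b0; split => // j.
have : 0 < flat_bump (r ^+ 2 - s) by rewrite lt_neqAle eq_sym b0 flat_bump_ge0.
rewrite flat_bump_gt0 subr_gt0 => sr.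
rewrite -ler_sqr ?nnegrE ?(ltW r0) // real_normK ?num_real //.
apply: le_trans (ltW sr); rewrite /s (bigD1 j) //= lerDl.
by apply: sumr_ge0 => i _; exact: sqr_ge0.
Qed.

Lemma chart_bump_center : 0 < chart_bump c x r (param c x).
Proof.
have cx : codom_of c x by apply: Kc => j; rewrite /= in_itv /= lerBlDr !lerDl (ltW r0).
have [dp cp] := paramK ac cx.
rewrite /chart_bump asboolT // flat_bump_gt0 cp big1 ?subr0 ?exprn_gt0 // => j _.
by rewrite subrr expr0n.
Qed.

(** The image of the closed cube is compact, hence closed as [M] is Hausdorff. In a chart [d], a
    point over this image has the overlap with [c] as a neighbourhood, where the transition map
    gives a smooth formula; around any other point the function is 0. *)
Lemma smooth_fun_chart_bump : smooth_fun X (chart_bump c x r).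
Proof.
have cK : compact K.
  by apply: (@rV_compact R _ (fun j => `[x ord0 j - r, x ord0 j + r]%classic)) => j; exact: segment_compact.
have clK : closed (param c @` K).
  apply: compact_closed (manifold_hausdorff X) _; apply: continuous_compact cK.
  apply/subspace_continuousP => z Kz; apply: cvg_within_filter.
  exact: (param_continuous ac (Kc Kz)).
move=> d ad; apply: smooth_on_bigcup => y cy; have [dy cyE] := paramK ad cy.
have [pK|pK] := pselect ((param c @` K) (param d y)).
  have dcy : dom c (param d y) by case: pK => z Kz <-; case: (paramK ac (Kc Kz)).
  have [tr _] := atlas_holomorphic ad ac.
  have oO : open (overlap d c).
    rewrite openE => z [q [dq cq] <-].
    have cz : codom_of d (coord d q) by exists q.
    have nc : \forall z' \near coord d q, dom c (param d z').
      apply: (param_continuous ad cz); rewrite (coordK ad dq).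
      exact: open_nbhs_nbhs (conj (chart_open ac) cq).
    apply: filterS (filterI (open_nbhs_nbhs (conj (codom_open ad) cz)) nc) => z' [cz' dz'].
    by have [dd <-] := paramK ad cz'; exists (param d z').
  exists (overlap d c); first by exists (param d y).
  pose g (z : E) := r ^+ 2 - \sum_j ((transition d c z) ord0 j - x ord0 j) ^+ 2.
  have sg : smooth_on (overlap d c) g.
    apply: (@smooth_onB _ _ _ (cst (r ^+ 2)) (fun z => \sum_j ((transition d c z) ord0 j - x ord0 j) ^+ 2)) => //.
      exact: smooth_on_cst.
    have -> : (fun z : E => \sum_j ((transition d c z) ord0 j - x ord0 j) ^+ 2) =
      \sum_j (fun z : E => ((transition d c z) ord0 j - x ord0 j) ^+ 2).
      by apply/funext => z; rewrite fct_sumE.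
    apply: smooth_on_sum => // j _.
    have se : smooth_on (overlap d c) (fun z => (transition d c z) ord0 j - x ord0 j).
      apply: (@smooth_onB _ _ _ (fun z => (transition d c z) ord0 j) (cst (x ord0 j))) => //.
        exact: smooth_on_entry.
      exact: smooth_on_cst.
    have -> : (fun z : E => ((transition d c z) ord0 j - x ord0 j) ^+ 2) =
       (fun z => (transition d c z) ord0 j - x ord0 j) * (fun z => (transition d c z) ord0 j - x ord0 j).
      by apply/funext => z; rewrite expr2.
    exact: smooth_onM.
  apply: smooth_on_eq (smooth_on_flat_exp 1 oO sg) => // z [q [dq cq] <-].
  have [dz _] := paramK ad (ex_intro2 _ _ q dq erefl : codom_of d (coord d q)).
  by rewrite /= (coordK ad dq) /chart_bump asboolT // /g /transition /= (coordK ad dq).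
have oW : open (~` (param c @` K)) by exact: closed_openC.
have : \forall z \near y, (~` (param c @` K)) (param d z).
  exact: (param_continuous ad cy) (open_nbhs_nbhs (conj oW pK)).
move=> /(filterI (open_nbhs_nbhs (conj (codom_open ad) cy))).
rewrite nbhsE => -[U [oU Uy] HU]; exists U => //.
apply: smooth_on_eq (@smooth_on_cst _ _ R^o U 0) => // z /HU [cz nK].
apply/esym/eqP; apply: contraT => /chart_bump_support [dz hz]; case: nK.
exists (coord c (param d z)); last exact: (coordK ac dz).
by move=> j; have := hz j; rewrite ler_distl /= in_itv /=.
Qed.

End ChartBump.

Lemma disjoint_bumps (k : nat) : (0 < n)%N -> exists f : 'I_k -> M -> R,
  [/\ forall i, smooth_fun X (f i), forall i p, 0 <= f i p, forall i, 0 < VI (f i) &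
      forall i j p, i != j -> f i p * f j p = 0].
Proof.
move=> n0; have [c ac dp] := atlas_cover X point.
have cx : codom_of c (coord c point) by exists point.
set x := coord c point in cx.
have [s s0 sc] := nbhs_box (open_nbhs_nbhs (conj (codom_open ac) cx)).
pose j0 : 'I_(n + n) := lshift n (Ordinal n0).
(* Centres [2 * d] apart along one real coordinate and radii [d / 2] keep the supports disjoint, and
   all [k] of them fit into the box of radius [s]. *)
pose d := s / (4 * k.+1%:R).
have k0 : 0 < k.+1%:R :> R by rewrite ltr0n.
have d0 : 0 < d by rewrite divr_gt0 // mulr_gt0.
have dk : d * (4 * k.+1%:R) = s by rewrite divfK // mulf_neq0 // gt_eqF.
pose y (i : 'I_k) : E := x + \row_j (if j == j0 then 2 * d * i%:R else 0).
pose r := d / 2.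
have r0 : 0 < r by rewrite divr_gt0.
have yE (i : 'I_k) j : y i ord0 j = x ord0 j + if j == j0 then 2 * d * i%:R else 0 by rewrite !mxE.
have Ki (i : 'I_k) : [set z : E | forall j, `[y i ord0 j - r, y i ord0 j + r]%classic (z ord0 j)] `<=` codom_of c.
  move=> z H; apply: sc => j; have := H j; rewrite /= in_itv /= -ler_distl yE => h.
  have ik : i%:R <= k%:R :> R by rewrite ler_nat ltnW.
  have i0 : 0 <= i%:R :> R by rewrite ler0n.
  have k1 : k.+1%:R = k%:R + 1 :> R by rewrite -natr1.
  move: h; rewrite ler_norml /r => /andP[h1 h2]; rewrite ltr_norml; apply/andP.
  by case: (j == j0) h1 h2 => h1 h2; rewrite k1 in dk; split; nra.
exists (fun i => chart_bump c (y i) r); split.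
- by move=> i; exact: (smooth_fun_chart_bump ac r0 (Ki i)).
- by move=> i p; exact: chart_bump_ge0.
- move=> i; apply: (VI_gt0 hmu (p := param c (y i))) => [|p|].
  + by exact: (smooth_fun_continuous (smooth_fun_chart_bump ac r0 (Ki i))).
  + exact: chart_bump_ge0.
  + exact: (chart_bump_center ac r0 (Ki i)).
move=> i j p ij; apply/eqP; rewrite mulf_eq0; apply: contraT; rewrite negb_or => /andP[].
move=> /(chart_bump_support r0)[_ /(_ j0) hi] /(chart_bump_support r0)[_ /(_ j0) hj].
move: hi hj; rewrite !yE eqxx => hi hj.
have : 2 * d * `|i%:R - j%:R| <= d.
  have -> : 2 * d * `|i%:R - j%:R| = `|2 * d * i%:R - 2 * d * j%:R|.
    by rewrite -mulrBr normrM (gtr0_norm (mulr_gt0 _ d0)).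
  move: hi hj; rewrite !ler_norml /r => /andP[? ?] /andP[? ?]; apply/andP; split; lra.
have : 1 <= `|i%:R - j%:R| :> R.
  have : (i : nat) != j by apply: contra ij => /eqP e; apply/eqP; exact: val_inj.
  rewrite neq_ltn => /orP[] lt.
    by rewrite ler_normr; apply/orP; right; rewrite opprB lerBrDr nat1r ler_nat.
  by rewrite ler_normr; apply/orP; left; rewrite lerBrDr nat1r ler_nat.
by move=> h1 h2; exfalso; nra.
Qed.

(* Each e_i is the difference of two bump functions of equal integral. *)
Lemma orthonormal_frame : (0 < n)%N -> exists e : bool -> M -> R,
  [/\ forall i, smooth_fun X (e i), forall i, VI (e i) = 0,
      forall i, VI (fun p => e i p ^+ 2) = V & forall p, e false p * e true p = 0].
Proof.
move=> n0; have [f [sf f0 If fd]] := disjoint_bumps 4 n0.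
have cf i : continuous (f i) by exact: smooth_fun_continuous.
have V0 := Vol_gt0 hmu.
(* Four bumps with disjoint supports, two for each function: [A] enters with a plus sign and [B]
   with a minus sign. *)
pose A (b : bool) : 'I_4 := if b then @Ordinal 4 0 isT else @Ordinal 4 1 isT.
pose B (b : bool) : 'I_4 := if b then @Ordinal 4 2 isT else @Ordinal 4 3 isT.
pose h b p := (VI (f (A b)))^-1 * f (A b) p - (VI (f (B b)))^-1 * f (B b) p.
have sh b : smooth_fun X (h b).
  by rewrite /h; have s1 := sf (A b); have s2 := sf (B b); smooth.
have ch b : continuous (h b) by exact: smooth_fun_continuous.
have nAB b : A b != B b by case: b.
have fp i : exists p, 0 < f i p.
  apply: contrapT => H; have := If i; rewrite (_ : VI (f i) = 0) ?ltxx //.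
  have -> : f i = (fun=> 0).
    apply/funext => p; apply/eqP; rewrite eq_le f0 andbT leNgt; apply/negP => fp; apply: H; by exists p.
  by rewrite (VI_cst mu) mul0r.
have Nh b : 0 < VI (fun p => h b p ^+ 2).
  have [p pA] := fp (A b).
  apply: (VI_gt0 hmu (p := p)) => [|q|]; [by have := ch b; move=> c1; cont | exact: sqr_ge0 |].
  have fB : f (B b) p = 0.
    by have /eqP := fd _ _ p (nAB b); rewrite mulf_eq0 gt_eqF //= => /eqP.
  by rewrite /h fB mulr0 subr0 exprn_gt0 // mulr_gt0 ?invr_gt0.
pose a b := Num.sqrt (V / VI (fun p => h b p ^+ 2)).
exists (fun b p => a b * h b p); split.
- by move=> b; have s1 := sh b; smooth.
- move=> b; have c1 := cf (A b); have c2 := cf (B b); rewrite (VIZ hmu) // /h (VIB hmu); [|by cont|by cont].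
  by rewrite !(VIZ hmu) // !mulVf ?subrr ?mulr0 // gt_eqF.
- move=> b; have c1 := ch b.
  rewrite (_ : VI _ = a b ^+ 2 * VI (fun p => h b p ^+ 2)); last first.
    by rewrite -(VIZ hmu); [apply: eq_VI => p; rewrite exprMn | cont].
  by rewrite sqr_sqrtr ?divr_ge0 ?(ltW V0) ?(ltW (Nh b)) // divfK // gt_eqF.
- move=> p; have z i j : i != j -> f i p * f j p = 0 by exact: fd.
  rewrite /h /A /B.
  set w1 := VI _; set w2 := VI _; set w3 := VI _; set w4 := VI _.
  have e1 := z (@Ordinal 4 1 isT) (@Ordinal 4 0 isT) isT.
  have e2 := z (@Ordinal 4 1 isT) (@Ordinal 4 2 isT) isT.
  have e3 := z (@Ordinal 4 3 isT) (@Ordinal 4 0 isT) isT.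
  have e4 := z (@Ordinal 4 3 isT) (@Ordinal 4 2 isT) isT.
  move: (f (@Ordinal 4 1 isT) p) (f (@Ordinal 4 0 isT) p) (f (@Ordinal 4 2 isT) p) (f (@Ordinal 4 3 isT) p) e1 e2 e3 e4.
  move=> g1 g0 g2 g3 e1 e2 e3 e4.
  move: (a false) (a true) (w1^-1) (w2^-1) (w3^-1) (w4^-1) => a0 a1 v1 v2 v3 v4.
  rewrite (_ : a0 * (v1 * g1 - v2 * g3) * (a1 * (v3 * g0 - v4 * g2)) =
    a0 * a1 * (v1 * v3 * (g1 * g0) - v1 * v4 * (g1 * g2) - v2 * v3 * (g3 * g0) + v2 * v4 * (g3 * g2))); last by ring.
  by rewrite e1 e2 e3 e4; ring.
Qed.

End BumpFunctions.

(** * Curvature of a test surface *)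

Section HalfDensities.
Context {R : realType} (n : nat) (M : ptopologicalType)
  (X : @closed_kahler R n M)
  (mu : {measure set (g_sigma_algebraType (@open M)) -> \bar R}).
Hypothesis hmu : is_kahler_volume X mu.
Local Notation VI := (vol_integral mu).
Local Notation V := (Vol mu).
#[local] Opaque expR vol_integral cos sin ln.
Implicit Types (u v f g : R -> M -> R).

Let is_derive_2ln (h : R -> R) (h' t : R) : 0 < h t -> is_derive t 1 h h' ->
  is_derive t 1 (fun s => 2 * ln (h s)) (2 * h' / h t).
Proof.
move=> h0 dh; have d1 := is_derive1_ln h0.
have d2 : is_derive t 1 (fun s => ln (h s)) ((h t)^-1 * h') by exact: (is_derive1_comp d1 dh).
have d3 := is_deriveZ 2 d2.
by apply: (@is_derive_eq _ _ _ _ _ _ _ _ d3); rewrite /GRing.scale /=; ring.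
Qed.

Lemma velocity_half_density u f (f' t : R) p d : 0 < d ->
  (forall s, `|s - t| < d -> 0 < f s p /\ u s p = 2 * ln (f s p)) ->
  is_derive t 1 (f ^~ p) f' -> velocity [set: R] u t p = 2 * f' / f t p.
Proof.
move=> d0 H df; have ft0 : 0 < f t p by apply: (H t _).1; rewrite subrr normr0.
apply: wderiv_derive_within (@accum_setT _ t) _.
apply: (wderiv_near d0 _ _ (is_derive_wderiv setT (is_derive_2ln ft0 df))) => // s _ /H[_ ->].
by [].
Qed.

(* In terms of half-densities f = e^(u/2), g = v f / 2, the covariant derivative
   is the derivative of g projected orthogonally to f. *)
Lemma cov_derive_half_density u v f g (f' g' : M -> R) t d p : 0 < d ->
  (forall s p, `|s - t| < d ->
     [/\ 0 < f s p, u s p = 2 * ln (f s p) & v s p = 2 * g s p / f s p]) ->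
  (forall p, is_derive t 1 (f ^~ p) (f' p)) ->
  (forall p, is_derive t 1 (g ^~ p) (g' p)) ->
  continuous (fun p => g t p * f' p) ->
  cov_derive mu [set: R] u v t p =
    2 * (g' p + VI (fun q => g t q * f' q) / V * f t p) / f t p.
Proof.
move=> d0 H df dg cgf; have V0 := Vol_gt0 hmu.
have tt : `|t - t| < d by rewrite subrr normr0.
have f0 q : 0 < f t q by case: (H t q tt).
have uE q : velocity [set: R] u t q = 2 * f' q / f t q.
  by apply: velocity_half_density d0 _ (df q) => s /(H s q)[].
have vE : velocity [set: R] v t p = 2 * (g' p / f t p - g t p * f' p / f t p ^+ 2).
  apply: wderiv_derive_within (@accum_setT _ t) _.
  have dV : is_derive t 1 (fun s => (f s p)^-1) (- (f t p) ^- 2 * f' p).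
    have fp0 : (f ^~ p) t != 0 by exact: (lt0r_neq0 (f0 p)).
    have h := is_deriveV fp0 (df p).
    by apply: (@is_derive_eq _ _ _ _ _ _ _ _ h); rewrite /GRing.scale.
  have dM : is_derive t 1 (2 *: ((g ^~ p : R -> R) * (fun s => (f s p)^-1)))
      (2 * (g' p / f t p - g t p * f' p / f t p ^+ 2)).
    have h := is_deriveZ 2 (is_deriveM (dg p) dV).
    by apply: (@is_derive_eq _ _ _ _ _ _ _ _ h); rewrite /GRing.scale /=; ring.
  apply: (wderiv_near d0 _ _ (is_derive_wderiv setT dM)) => // s _ /(H s p)[_ _ ->].
  by rewrite -mulrA.
rewrite /cov_derive vE uE.
have -> : VI (fun q => v t q * velocity [set: R] u t q * expR (u t q)) = 4 * VI (fun q => g t q * f' q).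
  rewrite -(VIZ hmu) //; apply: eq_VI => q; have [fq uq vq] := H t q tt.
  by rewrite uE vq uq expR_2ln //; field; rewrite gt_eqF.
have [fp _ ->] := H t p tt.
by field; rewrite !gt_eqF.
Qed.

End HalfDensities.

Section SectionalCurvature.
Context {R : realType} (n : nat) (M : ptopologicalType)
  (X : @closed_kahler R n M)
  (mu : {measure set (g_sigma_algebraType (@open M)) -> \bar R}).
Hypothesis hmu : is_kahler_volume X mu.
Local Notation VI := (vol_integral mu).
Local Notation V := (Vol mu).
Local Notation C := (calabi_space X mu).
Local Notation E := 'rV[R]_(n + n).
#[local] Opaque expR vol_integral cos sin ln.

Section Frame.
Variable e : bool -> M -> R.
Hypotheses (se : forall i, smooth_fun X (e i)) (Ve0 : forall i, VI (e i) = 0)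
  (Ve1 : forall i, VI (fun p => e i p ^+ 2) = V) (ee : forall p, e false p * e true p = 0).

Let V0 : 0 < V. Proof. exact: Vol_gt0 hmu. Qed.

Let ce i : continuous (e i). Proof. exact: smooth_fun_continuous. Qed.

Let VI_frame a0 a1 a2 b0 b1 b2 :
  VI (fun p => (a0 + a1 * e false p + a2 * e true p) * (b0 + b1 * e false p + b2 * e true p)) =
  V * (a0 * b0 + a1 * b1 + a2 * b2).
Proof.
have c1 : continuous (e false) by exact: ce.
have c2 : continuous (e true) by exact: ce.
have -> : V * (a0 * b0 + a1 * b1 + a2 * b2) =
  ((a0 * b1 + a1 * b0) * VI (e false) + (a0 * b2 + a2 * b0) * VI (e true) +
   (a1 * b1 * VI (fun p => e false p ^+ 2) + a2 * b2 * VI (fun p => e true p ^+ 2))) + VI (fun=> a0 * b0).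
  by rewrite !Ve0 !Ve1 (VI_cst mu); ring.
rewrite (VI_lin4 hmu); [|by cont|by cont|by cont|by cont].
rewrite -(VID hmu); [|by cont|by cont]; apply: eq_VI => p.
have -> : (a0 + a1 * e false p + a2 * e true p) * (b0 + b1 * e false p + b2 * e true p) =
  (a0 * b1 + a1 * b0) * e false p + (a0 * b2 + a2 * b0) * e true p +
  (a1 * b1 * e false p ^+ 2 + a2 * b2 * e true p ^+ 2) + a0 * b0 + (a1 * b2 + a2 * b1) * (e false p * e true p) by ring.
by rewrite ee mulr0 addr0.
Qed.

Let l s p := cos s + sin s * e false p.
Let m s p := - sin s + cos s * e false p.
(** Longitude [s] and latitude [t] on the 2-sphere spanned by 1 and the two functions [e], with
    [u = 0] at the origin; the lines of constant [s] are great circles. [Ft], [Fs] and [Fst] are the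
    partial derivatives. *)
Let F s t p := cos t * l s p + sin t * e true p.
Let Ft s t p := - sin t * l s p + cos t * e true p.
Let Fs s t p := cos t * m s p.
Let Fst s t p := - sin t * m s p.
Let u s t p := 2 * ln (F s t p).

Let dl (s : R) p : is_derive s 1 (l ^~ p) (m s p).
Proof.
have d1 := is_derive_cos s; have d2 := is_derive_sin s.
have d3 := is_deriveD d1 (is_deriveZ (e false p) d2).
have -> : l ^~ p = cos + (e false p *: sin : R -> R) by apply/funext => x; rewrite /l mulrC.
by apply: (@is_derive_eq _ _ _ _ _ _ _ _ d3); rewrite /m /GRing.scale /=; ring.
Qed.

Let dm (s : R) p : is_derive s 1 (m ^~ p) (- l s p).
Proof.
have d1 := is_derive_cos s; have d2 := is_derive_sin s.
have d3 := is_deriveD (is_deriveN d2) (is_deriveZ (e false p) d1).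
have -> : m ^~ p = (- sin) + (e false p *: cos : R -> R) by apply/funext => x; rewrite /m mulrC.
by apply: (@is_derive_eq _ _ _ _ _ _ _ _ d3); rewrite /l /GRing.scale /=; ring.
Qed.

Let dlin (a b t : R) : is_derive t 1 (fun x => cos x * a + sin x * b) (- sin t * a + cos t * b).
Proof.
have d1 := is_derive_cos t; have d2 := is_derive_sin t.
have d3 := is_deriveD (is_deriveZ a d1) (is_deriveZ b d2).
have -> : (fun x => cos x * a + sin x * b) = (a *: cos : R -> R) + (b *: sin : R -> R).
  by apply/funext => x; rewrite mulrC [sin x * b]mulrC.
by apply: (@is_derive_eq _ _ _ _ _ _ _ _ d3); rewrite /GRing.scale /=; ring.
Qed.

Let dFt (s t : R) p : is_derive t 1 (fun x => F s x p) (Ft s t p).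
Proof. exact: dlin. Qed.

Let dFtt (s t : R) p : is_derive t 1 (fun x => Ft s x p) (- F s t p).
Proof.
have h := dlin (e true p) (- l s p) t.
have -> : (fun x => Ft s x p) = (fun x => cos x * e true p + sin x * - l s p).
  by apply/funext => x; rewrite /Ft; ring.
by apply: (@is_derive_eq _ _ _ _ _ _ _ _ h); rewrite /F; ring.
Qed.

Let dFst_t (s t : R) p : is_derive t 1 (fun x => Fst s x p) (- Fs s t p).
Proof.
have h := dlin 0 (- m s p) t.
have -> : (fun x => Fst s x p) = (fun x => cos x * 0 + sin x * - m s p).
  by apply/funext => x; rewrite /Fst; ring.
by apply: (@is_derive_eq _ _ _ _ _ _ _ _ h); rewrite /Fs; ring.
Qed.

Let dFs (s t : R) p : is_derive s 1 (fun x => F x t p) (Fs s t p).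
Proof.
have h := is_deriveD (is_deriveZ (cos t) (dl s p)) (is_derive_cst (sin t * e true p) s 1).
have -> : (fun x => F x t p) = (cos t *: (l ^~ p) : R -> R) + cst (sin t * e true p).
  by apply/funext => x.
by apply: (@is_derive_eq _ _ _ _ _ _ _ _ h); rewrite /Fs /GRing.scale /= addr0.
Qed.

Let dFts (s t : R) p : is_derive s 1 (fun x => Ft x t p) (Fst s t p).
Proof.
have h := is_deriveD (is_deriveZ (- sin t) (dl s p)) (is_derive_cst (cos t * e true p) s 1).
have -> : (fun x => Ft x t p) = (- sin t *: (l ^~ p) : R -> R) + cst (cos t * e true p).
  by apply/funext => x.
by apply: (@is_derive_eq _ _ _ _ _ _ _ _ h); rewrite /Fst /GRing.scale /= addr0.
Qed.

Let bound : exists2 B, 0 < B & forall i p, `|e i p| <= B.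
Proof.
have [B B0 HB] := continuous_bounded X (@ce true); have [B' B'0 HB'] := continuous_bounded X (@ce false).
exists (Num.max B B'); first by rewrite lt_max B0.
by case=> p; rewrite le_max ?HB ?HB' // orbT.
Qed.

(** The functions [e] are bounded, so positivity near [(0, 0)], where [F = 1], holds for all points
    of [M] at once; [G] is a continuous lower bound of [F]. *)
Let domain : exists O : set (R * R), [/\ open O, O (0, 0) & forall s t p, O (s, t) -> 0 < F s t p].
Proof.
have [B B0 HB] := bound.
pose G (z : R * R) := cos z.2 * cos z.1 - B * `|cos z.2 * sin z.1| - B * `|sin z.2|.
have cG : continuous G.
  have fstc (k : R -> R) : continuous k -> continuous (fun z : R * R => k z.1).
    by move=> ck z; apply: (continuous_comp (@cvg_fst _ _ _ _ _)); exact: ck.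
  have sndc (k : R -> R) : continuous k -> continuous (fun z : R * R => k z.2).
    by move=> ck z; apply: (continuous_comp (@cvg_snd _ _ _ _ _)); exact: ck.
  have c1 := fstc _ (@continuous_cos R); have c2 := sndc _ (@continuous_cos R).
  have c3 := fstc _ (@continuous_sin R); have c4 := sndc _ (@continuous_sin R).
  by rewrite /G; cont.
exists [set z | 0 < G z]; split.
- by apply: (@open_comp _ _ G [set x | 0 < x]); [move=> z _; exact: cG | exact: open_gt].
- by rewrite /= /G /= cos0 sin0 mulr0 normr0 !mulr0 !subr0 mulr1.
move=> s t p /= /lt_le_trans; apply; rewrite /G /F /l /=.
have h1 : `|cos t * sin s * e false p| <= B * `|cos t * sin s| by rewrite normrM mulrC ler_wpM2r.
have h2 : `|sin t * e true p| <= B * `|sin t| by rewrite normrM mulrC ler_wpM2r.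
move: h1 h2; rewrite !ler_norml => /andP[h1 _] /andP[h2 _].
have -> : cos t * (cos s + sin s * e false p) + sin t * e true p =
   cos t * cos s + cos t * sin s * e false p + sin t * e true p by ring.
by apply: lerD; [apply: lerD |].
Qed.

(** Constant curvature is assumed, so its value can be read at the single point [(0, 0)] of one
    surface, where both sides reduce to integrals of the frame: [4 V = kappa * (4 V) ^ 2]. *)
Lemma curvature_of_frame kappa : constant_sectional_curvature X mu kappa -> kappa = (4 * V)^-1.
Proof.
move=> hK; have [W [oW W0 F_gt0]] := domain.
have c1 : continuous (e false) by exact: ce.
have c2 : continuous (e true) by exact: ce.
have nbO s t : W (s, t) -> exists2 d, 0 < d & forall s' t', `|s' - s| < d -> `|t' - t| < d -> W (s', t').
  move=> Ost; have : nbhs (s, t) W by exact: open_nbhs_nbhs.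
  move=> /nbhs_ballP[d /= d0 H]; exists d => // s' t' hs ht; apply: H.
  by split; rewrite /ball /= distrC.
have CO s t : W (s, t) -> C (u s t).
  move=> Ost; split.
    have sF : smooth_fun X (F s t).
      by rewrite /F /l; have s1 := se false; have s2 := se true; smooth.
    have sl := smooth_fun_ln sF (fun p => F_gt0 s t p Ost).
    by rewrite /u; smooth.
  rewrite (eq_VI mu (g := fun p => (cos t * cos s + cos t * sin s * e false p + sin t * e true p) *
     (cos t * cos s + cos t * sin s * e false p + sin t * e true p))); last first.
    by move=> p; rewrite expR_2ln ?F_gt0 // /F /l; ring.
  rewrite VI_frame.
  have -> : cos t * cos s * (cos t * cos s) + cos t * sin s * (cos t * sin s) + sin t * sin t =
    cos t ^+ 2 * (cos s ^+ 2 + sin s ^+ 2) + sin t ^+ 2 by ring.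
  by rewrite cos2Dsin2 mulr1 cos2Dsin2 mulr1.
have sm c : atlas X c -> smooth_within [set z : (R * R) * E | W z.1 /\ codom_of c z.2]
    (fun z => u z.1.1 z.1.2 (param c z.2)).
  move=> ac z Sz; have oc := codom_open ac.
  pose U := [set z : (R * R) * E | W z.1 /\ codom_of c z.2].
  have oU : open U by exact: openI (open_fst oW) (open_snd oc).
  have [sc ss] := smooth_on_cos_sin openT (@smooth_on_id R [set: R]).
  have tr (k : R -> R) : smooth_on setT k -> smooth_on U (fun z => k z.1.1) /\ smooth_on U (fun z => k z.1.2).
    move=> sk; split.
      by apply: smooth_on_sub (smooth_on_fst openT (smooth_on_fst openT sk)).
    by apply: smooth_on_sub (smooth_on_fst openT (smooth_on_snd openT sk)).
  have se' i : smooth_on U (fun z => e i (param c z.2)).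
    by apply: smooth_on_sub (smooth_on_snd oc (se i ac)) => w [].
  have [cs ct] := tr _ sc; have [ss' st] := tr _ ss.
  have h := smooth_onD oU (smooth_onM oU ct (smooth_onD oU cs (smooth_onM oU ss' (se' false))))
    (smooth_onM oU st (se' true)).
  have pos x : U x -> 0 < F x.1.1 x.1.2 (param c x.2).
    by move=> [Ox _]; apply: F_gt0; case: x.1 Ox.
  exists U, (fun z => u z.1.1 z.1.2 (param c z.2)); split => //.
  exact: smooth_onZ oU (smooth_on_ln oU pos h).
pose us := fun s t => velocity setT (u ^~ t) s.
pose ut := fun s t => velocity setT (u s) t.
pose Ds (v : R -> R -> M -> R) := fun s t => cov_derive mu setT (u ^~ t) (v ^~ t) s.
pose Dt (v : R -> R -> M -> R) := fun s t => cov_derive mu setT (u s) (v s) t.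
have H : calabi_metric mu (u 0 0) (Ds (Dt ut) 0 0 - Dt (Ds ut) 0 0) (us 0 0) =
    kappa * (calabi_metric mu (u 0 0) (us 0 0) (us 0 0) * calabi_metric mu (u 0 0) (ut 0 0) (ut 0 0)
      - calabi_metric mu (u 0 0) (us 0 0) (ut 0 0) ^+ 2) := hK W u oW CO sm 0 0 W0.
have z0 (x d : R) : 0 < d -> `|x - x| < d by rewrite subrr normr0.
have usE s t p : W (s, t) -> us s t p = 2 * Fs s t p / F s t p.
  move=> /nbO[d d0 Hd]; apply: (velocity_half_density (f := F ^~ t) d0 _ (dFs s t p)) => s' ss'.
  by split => //; apply: F_gt0; apply: Hd => //; exact: z0.
have utE s t p : W (s, t) -> ut s t p = 2 * Ft s t p / F s t p.
  move=> /nbO[d d0 Hd]; apply: (velocity_half_density (f := F s) d0 _ (dFt s t p)) => t' tt'.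
  by split => //; apply: F_gt0; apply: Hd => //; exact: z0.
(* The [t]-lines are great circles of angular speed 1. The equation is proved on all of [W], since
   it is still to be differentiated in [s]. *)
have DtutE s t p : W (s, t) -> Dt ut s t p = 0.
  move=> Ost; have [d d0 Hd] := nbO _ _ Ost.
  rewrite /Dt (cov_derive_half_density hmu p (f := F s) (g := Ft s) d0 _ (dFt s t) (dFtt s t)).
  - rewrite (eq_VI mu (g := fun p => (- sin t * cos s + - sin t * sin s * e false p + cos t * e true p) *
       (- sin t * cos s + - sin t * sin s * e false p + cos t * e true p))); last first.
      by move=> q; rewrite /Ft /l; ring.
    rewrite VI_frame.
    have -> : - sin t * cos s * (- sin t * cos s) + - sin t * sin s * (- sin t * sin s) + cos t * cos t =
      sin t ^+ 2 * (cos s ^+ 2 + sin s ^+ 2) + cos t ^+ 2 by ring.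
    by rewrite cos2Dsin2 mulr1 [sin t ^+ 2 + _]addrC cos2Dsin2 mulr1 divff ?gt_eqF // mul1r addNr mulr0 mul0r.
  - by move=> t' q tt'; have Ot' := Hd s t' (z0 _ _ d0) tt'; split; [exact: F_gt0 | by [] | exact: utE].
  - by rewrite /Ft /l; cont.
have DsutE s t p : W (s, t) -> Ds ut s t p = 2 * Fst s t p / F s t p.
  move=> Ost; have [d d0 Hd] := nbO _ _ Ost.
  rewrite /Ds (cov_derive_half_density hmu p (f := F ^~ t) (g := Ft ^~ t) d0 _ (fun q => dFs s t q) (fun q => dFts s t q)).
  - rewrite (eq_VI mu (g := fun p => (- sin t * cos s + - sin t * sin s * e false p + cos t * e true p) *
       (- cos t * sin s + cos t * cos s * e false p + 0 * e true p))); last first.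
      by move=> q; rewrite /Ft /Fs /l /m; ring.
    rewrite VI_frame.
    have -> : - sin t * cos s * (- cos t * sin s) + - sin t * sin s * (cos t * cos s) + cos t * 0 = 0 by ring.
    by rewrite mulr0 !mul0r addr0.
  - by move=> s' q ss'; have Os' := Hd s' t ss' (z0 _ _ d0); split; [exact: F_gt0 | by [] | exact: utE].
  - by rewrite /Ft /Fs /l /m; cont.
have F00 p : F 0 0 p = 1 by rewrite /F /l cos0 sin0; ring.
have DsDtut : Ds (Dt ut) 0 0 = (fun=> 0).
  apply/funext => p; have [d d0 Hd] := nbO _ _ W0.
  have dz (q : M) : is_derive (0 : R) 1 ((fun _ _ => 0 : R) ^~ q) 0 by exact: is_derive_cst.
  rewrite /Ds (cov_derive_half_density hmu p (f := F ^~ 0) (g := fun _ _ => 0) (g' := fun=> 0) d0 _ (fun q => dFs 0 0 q) dz).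
  - rewrite (eq_VI mu (g := fun=> 0)); last by move=> q; rewrite mul0r.
    by rewrite (VI_cst mu) !mul0r addr0 mulr0 mul0r.
  - move=> s' q ss'; have Os' := Hd s' 0 ss' (z0 _ _ d0); split; [exact: F_gt0 | by [] |].
    by rewrite DtutE // mulr0 mul0r.
  - by under eq_fun do rewrite mul0r; exact: cont_cst.
(* The whole curvature sits here: [Fst] vanishes at [t = 0], so the projection adds no correction,
   and its derivative in [t] is [- Fs]. *)
have DtDsut : Dt (Ds ut) 0 0 = (fun p => - 2 * e false p).
  apply/funext => p; have [d d0 Hd] := nbO _ _ W0.
  rewrite /Dt (cov_derive_half_density hmu p (f := F 0) (g := Fst 0) d0 _ (dFt 0 0) (dFst_t 0 0)).
  - rewrite (eq_VI mu (g := fun=> 0)); last by move=> q; rewrite /Fst sin0 oppr0 !mul0r.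
    by rewrite (VI_cst mu) !mul0r addr0 F00 /Fs /m cos0 sin0; field.
  - by move=> t' q tt'; have Ot' := Hd 0 t' (z0 _ _ d0) tt'; split; [exact: F_gt0 | by [] | exact: DsutE].
  - by rewrite /Fst /m /Ft /l; cont.
have us0 : us 0 0 = (fun p => 2 * e false p).
  by apply/funext => p; rewrite usE // F00 /Fs /m cos0 sin0; field.
have ut0 : ut 0 0 = (fun p => 2 * e true p).
  by apply/funext => p; rewrite utE // F00 /Ft /l cos0 sin0; field.
have u0 p : expR (u 0 0 p) = 1 by rewrite /u F00 ln1 mulr0 expR0.
have VIe a i : VI (fun p => a * e i p ^+ 2) = a * V.
  have ci : continuous (e i) by exact: ce.
  by rewrite (VIZ hmu) ?Ve1 //; cont.
move: H; rewrite DsDtut DtDsut us0 ut0 /calabi_metric.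
rewrite (eq_VI mu (g := fun p => 4 * e false p ^+ 2)); last first.
  by move=> p; rewrite u0 -[LHS]/((0 - (- 2 * e false p)) * (2 * e false p) * 1); ring.
rewrite [X in kappa * (X * _ - _)](eq_VI mu (g := fun p => 4 * e false p ^+ 2)); last by move=> p; rewrite u0; ring.
rewrite [X in kappa * (_ * X - _)](eq_VI mu (g := fun p => 4 * e true p ^+ 2)); last by move=> p; rewrite u0; ring.
rewrite [X in kappa * (_ - X ^+ 2)](eq_VI mu (g := fun p => 0)); last first.
  move=> p; rewrite u0 mulr1; have -> : 2 * e false p * (2 * e true p) = 4 * (e false p * e true p) by ring.
  by rewrite ee mulr0.
rewrite !VIe (VI_cst mu) mul0r expr0n subr0 => H.
have n0 : 4 * V != 0 by rewrite mulf_neq0 // gt_eqF.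
apply: (mulIf n0); rewrite mulVf //; apply: (mulIf n0); rewrite mul1r -mulrA -H //.
Qed.

End Frame.

Lemma sectional_curvature_unique kappa : (0 < n)%N ->
  constant_sectional_curvature X mu kappa -> kappa = (4 * V)^-1.
Proof.
move=> n0; have [e [se e0 e1 ee]] := orthonormal_frame hmu n0.
exact: (curvature_of_frame se e0 e1 ee).
Qed.

End SectionalCurvature.

(** * Diameter *)

Section Diameter.
Context {R : realType} (n : nat) (M : ptopologicalType)
  (X : @closed_kahler R n M)
  (mu : {measure set (g_sigma_algebraType (@open M)) -> \bar R}).
Hypothesis hmu : is_kahler_volume X mu.
Local Notation VI := (vol_integral mu).
Local Notation V := (Vol mu).
Local Notation C := (calabi_space X mu).
#[local] Opaque expR vol_integral cos sin ln.

(* The half-densities f + d, with f a bump function and d small, are nearly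
   orthogonal when the bump functions have disjoint supports. *)
Lemma small_cosang (eta : R) : (0 < n)%N -> 0 < eta ->
  exists u0 u1, [/\ C u0, C u1 & cosang mu u0 u1 <= eta].
Proof.
move=> n0 eta0; have V0 := Vol_gt0 hmu.
have [f [sf f0 If fd]] := disjoint_bumps hmu 2 n0.
have cf i : continuous (f i) by exact: smooth_fun_continuous.
have If2 i : 0 < VI (fun p => f i p ^+ 2).
  have [p fp] : exists p, 0 < f i p.
    apply: contrapT => H; have := If i; rewrite (_ : VI (f i) = 0) ?ltxx //.
    have -> : f i = (fun=> 0).
      apply/funext => p; apply/eqP; rewrite eq_le f0 andbT leNgt; apply/negP => fp; apply: H; by exists p.
    by rewrite (VI_cst mu) mul0r.
  have c1 : continuous (f i) by exact: cf.
  by apply: (VI_gt0 hmu (p := p)) => [|q|]; [cont | exact: sqr_ge0 | exact: exprn_gt0].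
pose i0 : 'I_2 := ord0; pose i1 : 'I_2 := ord_max.
pose b i := Num.sqrt (V / VI (fun p => f i p ^+ 2)).
have b0 i : 0 < b i by rewrite sqrtr_gt0 divr_gt0.
(* The normalizing factor [a i] of [f i + d] is at most [b i], which does not involve [d]. As the
   products of bumps vanish, the integral of the product of the two half-densities is then at most
   [d * D]. *)
pose D := b i0 * b i1 * (VI (f i0) + VI (f i1) + V).
have D0 : 0 < D by rewrite mulr_gt0 ?mulr_gt0 // addr_gt0 // addr_gt0.
pose d := Num.min 1 (eta * V / D).
have d0 : 0 < d by rewrite lt_min ltr01 divr_gt0 // mulr_gt0.
have d1 : d <= 1 by rewrite ge_min lexx.
have dD : d * D <= eta * V.
  have : d <= eta * V / D by rewrite ge_min lexx orbT.
  by rewrite ler_pdivlMr.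
pose F i p := f i p + d.
have sF i : smooth_fun X (F i) by have s1 := sf i; rewrite /F; smooth.
have cF i : continuous (F i) by exact: smooth_fun_continuous.
have F0 i p : 0 < F i p by rewrite ltr_wpDl.
have le_F2 i : VI (fun p => f i p ^+ 2) <= VI (fun p => F i p ^+ 2).
  have c1 := @cf i; have c2 := @cF i.
  apply: (le_VI hmu); [by cont | by cont |] => p.
  by rewrite lerXn2r ?nnegrE ?(ltW (F0 _ _)) // lerDl ltW.
have IF2 i : 0 < VI (fun p => F i p ^+ 2) by exact: lt_le_trans (le_F2 i).
pose a i := Num.sqrt (V / VI (fun p => F i p ^+ 2)).
have a0 i : 0 < a i by rewrite sqrtr_gt0 divr_gt0.
have ab i : a i <= b i.
  by rewrite ler_sqrt ?divr_ge0 ?(ltW V0) ?(ltW (If2 i)) // ler_pM2l // lef_pV2 ?posrE.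
pose u i p := 2 * ln (a i * F i p).
have aF0 i p : 0 < a i * F i p by rewrite mulr_gt0.
have Cu i : C (u i).
  split.
    have s1 := sF i; have s2 : smooth_fun X (fun p => a i * F i p) by smooth.
    have s3 := smooth_fun_ln s2 (aF0 i).
    by rewrite /u; smooth.
  have c2 := @cF i.
  transitivity (a i ^+ 2 * VI (fun p => F i p ^+ 2)).
    by rewrite -(VIZ hmu); [apply: eq_VI => p; rewrite expR_2ln // exprMn | cont].
  by rewrite sqr_sqrtr ?divr_ge0 ?(ltW V0) ?(ltW (IF2 i)) // divfK // gt_eqF.
have uE i p : half_exp (u i) p = a i * F i p.
  by rewrite half_expE /u mulrC mulKf // lnK // posrE.
exists (u i0), (u i1); split => //.
have c0 := @cf i0; have c1 := @cf i1.
have <- : VI (fun p => half_exp (u i0) p * half_exp (u i1) p) / V = cosang mu (u i0) (u i1).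
  by rewrite (VI_half_expM hmu) mulrC mulKf // gt_eqF.
rewrite ler_pdivrMr //; apply: le_trans dD.
have -> : VI (fun p => half_exp (u i0) p * half_exp (u i1) p) =
    a i0 * a i1 * (d * (VI (f i0) + VI (f i1) + d * V)).
  rewrite -(VI_cst mu) -(VID hmu) // -(VID hmu); [|by cont|by cont].
  rewrite -(VIZ hmu); last by cont.
  rewrite -(VIZ hmu); last by cont.
  apply: eq_VI => p; rewrite !uE /F.
  have -> : a i0 * (f i0 p + d) * (a i1 * (f i1 p + d)) =
    a i0 * a i1 * (f i0 p * f i1 p + d * (f i0 p + f i1 p + d)) by ring.
  by rewrite fd // add0r.
have -> : d * D = b i0 * b i1 * (d * (VI (f i0) + VI (f i1) + V)) by rewrite /D; ring.
have I0 := ltW (If i0); have I1 := ltW (If i1).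
have dV0 : 0 <= d * V by rewrite mulr_ge0 // ltW.
apply: ler_pM.
- by rewrite mulr_ge0 // ltW.
- by rewrite mulr_ge0 ?(ltW d0) // addr_ge0 // addr_ge0.
- by apply: ler_pM; rewrite ?ab // ltW.
- by rewrite ler_pM2l // lerD2l ler_piMl // ltW.
Qed.

(** The supremum is not attained, all angles being below [pi / 2]; a pair with cosine at most
    [sin e1] has an angle within [e1] of it. *)
Lemma diameter_calabi : (0 < n)%N ->
  ereal_sup [set (calabi_dist X mu z.1 z.2)%:E | z in
       [set z : (M -> R) * (M -> R) | C z.1 /\ C z.2]] =
  (pi / 2 * (2 * Num.sqrt V))%:E.
Proof.
move=> n0; have V0 := Vol_gt0 hmu.
have S0 : 0 < 2 * Num.sqrt V by rewrite mulr_gt0 // sqrtr_gt0.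
have pi2 := @pihalf_ge1 R; have pi0 := @pi_gt0 R.
apply/eqP; rewrite eq_le; apply/andP; split.
  apply: ge_ereal_sup => _ [z [C0 C1] <-]; rewrite lee_fin (calabi_distE hmu) // mulrC ler_pM2r //.
  by have /andP[_ /ltW] := ang_itv hmu C0 C1.
apply/lee_addgt0Pr => e e0.
pose e1 := Num.min 1 (e / (2 * Num.sqrt V)).
have e10 : 0 < e1 by rewrite lt_min ltr01 divr_gt0.
have e11 : e1 <= 1 by rewrite ge_min lexx.
have eS : e1 * (2 * Num.sqrt V) <= e.
  have : e1 <= e / (2 * Num.sqrt V) by rewrite ge_min lexx orbT.
  by rewrite ler_pdivlMr.
have sin0 : 0 < sin e1 by apply: sin_gt0_pi; rewrite e10 /=; lra.
have [u0 [u1 [C0 C1 small]]] := small_cosang n0 sin0.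
have le_ang : pi / 2 - e1 <= ang mu u0 u1.
  rewrite angE -[leLHS](cosK (x := pi / 2 - e1)); last first.
    by rewrite in_itv /=; apply/andP; split; lra.
  apply: ler_acos.
  - by have := cosang_gt0 hmu C0 C1; lra.
  - by rewrite cosB cos_pihalf sin_pihalf mul0r add0r mul1r.
  - exact: cos_le1.
apply: (@le_trans _ _ ((calabi_dist X mu u0 u1)%:E + e%:E)%E).
  rewrite -EFinD lee_fin (calabi_distE hmu) //; move: eS S0 le_ang.
  by move: (2 * Num.sqrt V) (ang _ _ _) => S th; nra.
by apply: leeD2r; apply: ereal_sup_ubound; exists (u0, u1).
Qed.

End Diameter.

(** * Uniqueness of geodesics, and the theorem *)

Section GeodesicUniqueness.
Context {R : realType} (n : nat) (M : ptopologicalType)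
  (X : @closed_kahler R n M)
  (mu : {measure set (g_sigma_algebraType (@open M)) -> \bar R}).
Hypothesis hmu : is_kahler_volume X mu.
Local Notation VI := (vol_integral mu).
Local Notation V := (Vol mu).
Local Notation C := (calabi_space X mu).
#[local] Opaque expR vol_integral cos sin ln.
Implicit Types (u v : R -> M -> R).

(** A curve is a function on the whole line, but velocities within the interval see only its values
    there. This serves the converse of the explicit formula, which prescribes the curve on the
    interval only. *)
Lemma geodesic_eq_on (a b : R) u v : a < b -> (forall t, a <= t <= b -> u t = v t) ->
  geodesic X mu `[a, b] u -> geodesic X mu `[a, b] v.
Proof.
move=> ab uv [[Cu su] gu]; pose I := `[a, b]%classic.
have inI t : I t = (a <= t <= b) by rewrite /I /= in_itv.
have aI t : I t -> accum I t by rewrite inI; exact: accum_itv.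
have vel w w' : smooth_family X I w -> (forall t, I t -> w t = w' t) ->
    forall t, I t -> velocity I w t = velocity I w' t.
  move=> sw ww t It; apply/funext => p.
  have h := udiff_wderiv p (smooth_family_udiff aI sw It).
  apply/esym; apply: wderiv_derive_within (aI _ It) _.
  by apply: (wderiv_near ltr01 It _ h) => s Is _; rewrite ww.
have {}uv t : I t -> u t = v t by rewrite inI; exact: uv.
have vuv := vel u v su uv.
have svu := smooth_family_velocity aI su.
split; first split=> [t It|c ac z Sz].
- by rewrite -uv //; exact: Cu.
- have [U [g [oU Uz sg gE]]] := su c ac z Sz; exists U, g; split => // y Uy [Iy cy].
  by rewrite gE // uv.
move=> t p It; have := gu t p It; rewrite /cov_derive -!(vuv t It) -(uv t It).
by rewrite (vel _ _ svu vuv t It).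
Qed.

(** Both curves run through the same angle, so the affine change of parameter matches their phases;
    the two interpolation formulas then agree, with a nonzero sine in front. *)
Lemma geodesic_joining_unique (a b a' b' : R) u u' (u0 u1 : M -> R) : C u0 -> C u1 -> u0 <> u1 ->
  a < b -> a' < b' ->
  geodesic_joining X mu a b u0 u1 u -> geodesic_joining X mu a' b' u0 u1 u' ->
  forall t, a' <= t <= b' -> u' t = u (a + (t - a') / (b' - a') * (b - a)).
Proof.
move=> C0 C1 ne ab ab' [gu ua ub] [gu' ua' ub'] t /andP[ta tb].
have [om [_ om1 _ _ form]] := geodesic_form hmu ab gu.
have [om' [_ om1' _ _ form']] := geodesic_form hmu ab' gu'.
have s0 := sin_ang_gt0 hmu C0 C1 ne.
have ba : 0 < b - a by lra.
have ba' : 0 < b' - a' by lra.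
have z' : b' - a' != 0 by rewrite gt_eqF.
set s := a + _.
have hs0 : 0 <= (t - a') / (b' - a') by rewrite divr_ge0 ?(ltW ba') //; lra.
have hs1 : (t - a') / (b' - a') <= 1 by rewrite ler_pdivrMr //; lra.
have sab : a <= s <= b by rewrite /s; apply/andP; split; nra.
have tab : a' <= t <= b' by rewrite ta tb.
have e1 : om * (s - a) = om' * (t - a').
  have -> : om * (s - a) = (om * (b - a)) * ((t - a') / (b' - a')) by rewrite /s; ring.
  by rewrite om1 ua ub -ua' -ub' -om1'; field.
have e2 : om * (b - s) = om' * (b' - t).
  have -> : om * (b - s) = om * (b - a) - om * (s - a) by ring.
  by rewrite e1 om1 ua ub -ua' -ub' -om1'; ring.
apply/funext => p; apply: half_exp_inj.
have := form' t p tab; have := form s p sab.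
rewrite e1 e2 om1 om1' ua ub ua' ub' => <- /mulfI; apply.
by rewrite gt_eqF.
Qed.

(** The parameter interval has the length of the angle, so the angular speed [om] is 1. *)
Lemma geodesic_explicit (t0 : R) u (u0 u1 : M -> R) : C u0 -> C u1 -> u0 <> u1 -> t0 = ang mu u0 u1 ->
  geodesic_joining X mu 0 t0 u0 u1 u -> forall t p, 0 <= t <= t0 ->
  half_exp (u t) p = half_exp u0 p * (cos t + expR ((u1 p - u0 p) / 2) * (sin t / sin t0)
                       - cos t0 * (sin t / sin t0)).
Proof.
move=> C0 C1 ne t0E [gu ua ub] t p tab.
have t00 : 0 < t0 by rewrite t0E; exact: (ang_gt0 hmu C0 C1 ne).
have s0 : 0 < sin t0 by rewrite t0E; exact: (sin_ang_gt0 hmu C0 C1 ne).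
have [om [_ om1 _ _ form]] := geodesic_form hmu t00 gu.
have omE : om = 1.
  apply: (mulIf (lt0r_neq0 t00)); rewrite mul1r -[X in om * X = _]subr0 om1 ua ub -t0E //.
have := form t p tab; rewrite omE !mul1r !subr0 ua ub sinB => h.
apply: (mulfI (lt0r_neq0 s0)); rewrite h.
have -> : half_exp u1 p = half_exp u0 p * expR ((u1 p - u0 p) / 2).
  by rewrite !half_expE -expRD; congr expR; field.
by field; rewrite gt_eqF.
Qed.

End GeodesicUniqueness.

Theorem theorem1p4 (R : realType) (n : nat) (n_gt0 : (0 < n)%N)
    (M : ptopologicalType) (X : @closed_kahler R n M)
    (mu : {measure set (g_sigma_algebraType (@open M)) -> \bar R})
    (hmu : is_kahler_volume X mu) :
  (* (1) *)
  (forall u0 u1 : M -> R, calabi_space X mu u0 -> calabi_space X mu u1 ->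
     u0 <> u1 ->
     [/\ forall a b : R, a < b ->
           exists2 u, geodesic_joining X mu a b u0 u1 u & analytic_curve X `[a, b] u,
         forall (a b a' b' : R) (u u' : R -> M -> R), a < b -> a' < b' ->
           geodesic_joining X mu a b u0 u1 u ->
           geodesic_joining X mu a' b' u0 u1 u' ->
           forall t, t \in `[a', b'] ->
             u' t = u (a + (t - a') / (b' - a') * (b - a)) &
         Vol mu = 4^-1 ->
           exists t0 : R,
             [/\ 0 < t0 < pi / 2,
                 vol_integral mu (fun p => expR ((u0 p + u1 p) / 2)) = 4^-1 * cos t0,
                 forall t : R, 0 < t < pi / 2 ->
                   vol_integral mu (fun p => expR ((u0 p + u1 p) / 2)) = 4^-1 * cos t ->
                   t = t0 &
                 forall u : R -> M -> R,
                   geodesic_joining X mu 0 t0 u0 u1 u <->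
                   (forall t p, t \in `[0, t0] ->
                      expR (u t p / 2) =
                      expR (u0 p / 2) *
                      (cos t + expR ((u1 p - u0 p) / 2) * (sin t / sin t0)
                       - cos t0 * (sin t / sin t0)))]]) /\
  (* (2) *)
  [/\ forall u0 u1 : M -> R, calabi_space X mu u0 -> calabi_space X mu u1 ->
        geodesic_lengths X mu u0 u1 = [set calabi_dist X mu u0 u1],
      forall u0 u1 : M -> R, calabi_space X mu u0 -> calabi_space X mu u1 ->
        0 <= calabi_dist X mu u0 u1 /\
        (calabi_dist X mu u0 u1 = 0 <-> u0 = u1),
      forall u0 u1 : M -> R, calabi_space X mu u0 -> calabi_space X mu u1 ->
        calabi_dist X mu u0 u1 = calabi_dist X mu u1 u0,
      forall u0 u1 u2 : M -> R, calabi_space X mu u0 -> calabi_space X mu u1 ->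
        calabi_space X mu u2 ->
        calabi_dist X mu u0 u2 <= calabi_dist X mu u0 u1 + calabi_dist X mu u1 u2 &
      (* a distance is never analytic on the diagonal *)
      analytic_within (smooth_pair X) (cinf_seminorm2 X)
        [set z : (M -> R) * (M -> R) |
           [/\ calabi_space X mu z.1, calabi_space X mu z.2 & z.1 <> z.2]]
        (fun z => calabi_dist X mu z.1 z.2)] /\
  (* (3) *)
  (forall (a b a' b' : R) (u c : R -> M -> R), a < b -> a' < b' ->
     geodesic X mu `[a, b] u -> C1_path X mu a' b' c ->
     c a' = u a -> c b' = u b ->
     path_length mu a b u <= path_length mu a' b' c) /\
  (* (4) *)
  (forall Rad : R, 0 < Rad ->
     constant_sectional_curvature X mu ((Rad ^+ 2)^-1) ->
     ereal_sup [set (calabi_dist X mu z.1 z.2)%:E | z in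
       [set z : (M -> R) * (M -> R) |
          calabi_space X mu z.1 /\ calabi_space X mu z.2]] =
     (pi / 2 * Rad)%:E).
Proof.
have V0 := Vol_gt0 hmu.
have S0 : 0 < 2 * Num.sqrt (Vol mu) by rewrite mulr_gt0 // sqrtr_gt0.
split; [|split; [|split]].
- move=> u0 u1 C0 C1 ne; split.
  + move=> a b ab; exists (arc mu a b u0 u1); first exact: (arc_geodesic hmu C0 C1 ne ab).
    exact: (arc_analytic hmu C0 C1 ne ab).
  + move=> a b a' b' u u' ab ab' gu gu' t; rewrite in_itv /= => tab.
    exact: (geodesic_joining_unique hmu C0 C1 ne ab ab' gu gu').
  (* For volume 1/4 the condition on [t0] says that [cos t0] is [cosang mu u0 u1]; uniqueness is the
     injectivity of [cos]. *)
  move=> V4; set t0 := ang mu u0 u1.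
  have t00 : 0 < t0 by exact: (ang_gt0 hmu C0 C1 ne).
  have t01 : t0 < pi / 2 by have /andP[] := ang_itv hmu C0 C1.
  have pi0 := @pi_gt0 R.
  have mid : vol_integral mu (fun p => expR ((u0 p + u1 p) / 2)) = 4^-1 * cos t0.
    rewrite (cos_ang hmu C0 C1) -V4 -(VI_half_expM hmu); apply: eq_VI => p.
    by rewrite half_expM.
  exists t0; split => //; first by rewrite t00.
    move=> t /andP[ta tb]; rewrite mid => /mulfI e.
    apply/esym/cos_inj; rewrite ?in_itv /=; [apply/andP; split; lra | apply/andP; split; lra |].
    by apply: e; rewrite invr_eq0.
  move=> u; split=> [gu t p|form].
    rewrite in_itv /= => tab.
    exact: (geodesic_explicit hmu C0 C1 ne erefl gu p tab).
  (* A curve given by the formula coincides with the arc on the interval, and so inherits the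
     geodesic equation and the endpoints. *)
  have [ga aa ab] := arc_geodesic hmu C0 C1 ne t00.
  have ua t : 0 <= t <= t0 -> arc mu 0 t0 u0 u1 t = u t.
    move=> tab; apply/funext => p; apply: half_exp_inj.
    rewrite (geodesic_explicit hmu C0 C1 ne erefl (And3 ga aa ab) p tab).
    by apply/esym/form; rewrite in_itv.
  split; first exact: (geodesic_eq_on t00 ua ga).
    by rewrite -ua ?aa // lexx ltW.
  by rewrite -ua ?ab // lexx ltW.
- split.
  + by move=> u0 u1 C0 C1; rewrite (geodesic_lengthsE hmu C0 C1) (calabi_distE hmu C0 C1).
  + move=> u0 u1 C0 C1; rewrite (calabi_distE hmu C0 C1).
    have /andP[a0 _] := ang_itv hmu C0 C1; split; first by rewrite mulr_ge0 // ltW.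
    split=> [/eqP|->]; last by rewrite (angxx hmu C1) mulr0.
    rewrite mulf_eq0 gt_eqF //= => /eqP a00; apply: contrapT => ne.
    by have := ang_gt0 hmu C0 C1 ne; rewrite a00 ltxx.
  + by move=> u0 u1 C0 C1; rewrite (calabi_distE hmu C0 C1) (calabi_distE hmu C1 C0) angC.
  + move=> u0 u1 u2 C0 C1 C2.
    rewrite (calabi_distE hmu C0 C2) (calabi_distE hmu C0 C1) (calabi_distE hmu C1 C2) -mulrDr.
    by rewrite ler_pM2l //; exact: (ang_triangle hmu C0 C1 C2).
  exact: (calabi_dist_analytic hmu).
- move=> a b a' b' u c ab ab' gu hc ca cb.
  have [om [_ _ _ -> _]] := geodesic_form hmu ab gu.
  by rewrite -ca -cb; exact: (C1_path_length_ge hmu ab' hc).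
(* The curvature hypothesis identifies [Rad] with twice the radius of the sphere of half-densities;
   the factor 2 is the scale of the map to that sphere. *)
move=> Rad Rad0 /(sectional_curvature_unique hmu n_gt0) /invr_inj e.
have -> : Rad = 2 * Num.sqrt (Vol mu).
  apply/eqP; rewrite -(eqrXn2 (n := 2)) // ?(ltW Rad0) ?(ltW S0) // e exprMn sqr_sqrtr ?(ltW V0) //.
  by apply/eqP; ring.
exact: (diameter_calabi hmu n_gt0).
Qed.
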